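(* For every $n\in\mathbb{N}$, the homeomorphism equivalence relation on $\mathcal{K}([0,1]^n)$ is Borel reducible to the homeomorphism equivalence relation on $\mathsf{C}_n([0,1]^{n+1})$. In particular $H_n\le_B C_{n+1}$.
   Context: For a Polish space $X$, $\mathcal{K}(X)$ is the space of compact subsets with the Vietoris topology, $\mathsf{C}(X)$ the (closed) subspace of continua (nonempty connected compacta), and $\mathsf{C}_n(X)$ the (Borel) subspace of continua of covering dimension exactly $n$. The homeomorphism relation on a Borel $B\subseteq\mathcal{K}(X)$ relates $K,L\in B$ iff they are homeomorphic. $H_n$ and $C_n$ denote the homeomorphism relations on $\mathcal{K}([0,1]^n)$ and $\mathsf{C}([0,1]^n)$ respectively. $E\le_B F$ means there is a Borel map $f$ with $xEx'\iff f(x)Ff(x')$.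
   Formalization: The statement is proved for n ≥ 1 only; for n = 0 it fails, since K([0,1]^0) has two homeomorphism classes (the empty set and a point) while every 0-dimensional continuum in [0,1] is a point. *)

(* Defs.v *)
From HB Require Import structures.
From mathcomp Require Import all_boot all_order all_algebra.
From mathcomp Require Import all_classical all_reals all_analysis.
Unset Strict Implicit. Unset Printing Implicit Defensive.
Import Order.TTheory GRing.Theory Num.Theory.
Import numFieldNormedType.Exports.
Local Open Scope classical_set_scope.
Local Open Scope ring_scope.

Section Hyperspace.
Variable R : realType.

(* points of R^n : row vectors with their (sup-norm) normed topology *)
Definition pt (n : nat) := 'rV[R]_n.

Definition cube (n : nat) : set (pt n) :=
  [set x | forall i : 'I_n, 0 <= x ord0 i <= 1].

(* K([0,1]^n): compact subsets of the cube (the empty set included) *)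
Definition Kspace (n : nat) : set (set (pt n)) :=
  [set K | compact K /\ K `<=` cube n].

Definition vietoris_basic (n : nat) (U : set (pt n)) (k : nat)
    (V : 'I_k -> set (pt n)) : set (set (pt n)) :=
  [set K | Kspace n K /\ K `<=` U /\ forall j, K `&` V j !=set0].

Definition vopen (n : nat) (O : set (set (pt n))) : Prop :=
  O `<=` Kspace n /\
  forall K, O K -> exists (U : set (pt n)) (k : nat) (V : 'I_k -> set (pt n)),
    [/\ open U, (forall j, open (V j)), vietoris_basic n U k V K &
        vietoris_basic n U k V `<=` O].

Definition vborel (n : nat) : set (set (set (pt n))) :=
  <<s Kspace n, vopen n >>.

Definition borel_map (n m : nat) (f : set (pt n) -> set (pt m)) : Prop :=
  (forall K, Kspace n K -> Kspace m (f K)) /\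
  forall B, vborel m B -> vborel n (Kspace n `&` f @^-1` B).

Definition homeomorphic (n m : nat) (K : set (pt n)) (L : set (pt m)) : Prop :=
  exists (f : pt n -> pt m) (g : pt m -> pt n),
    [/\ f @` K `<=` L, g @` L `<=` K,
        (forall x, K x -> g (f x) = x), (forall y, L y -> f (g y) = y) &
        ({within K, continuous f} /\ {within L, continuous g})].

Definition continuum (n : nat) (K : set (pt n)) : Prop :=
  K !=set0 /\ compact K /\ connected K.

Definition Cspace (n : nat) : set (set (pt n)) :=
  [set K | Kspace n K /\ continuum n K].

(* Covering dimension. [ord_le K m]: every finite open cover of K has a
   finite open refinement covering K in which every point of K lies in at most
   m members. Then dim K <= d  iff  ord_le K d.+1. *)
Definition ord_le (n : nat) (K : set (pt n)) (m : nat) : Prop :=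
  forall (k : nat) (U : 'I_k -> set (pt n)),
    (forall i, open (U i)) -> K `<=` \bigcup_i U i ->
    exists (l : nat) (V : 'I_l -> set (pt n)),
      [/\ (forall j, open (V j)),
          (forall j, exists i, V j `<=` U i),
          K `<=` \bigcup_j V j &
          forall x, K x -> forall s : 'I_m.+1 -> 'I_l, injective s ->
            ~ (forall t, V (s t) x)].

(* covering dimension exactly d (for d = 0 this means K nonempty, dim <= 0) *)
Definition covdim_eq (n : nat) (K : set (pt n)) (d : nat) : Prop :=
  ord_le n K d.+1 /\ ~ ord_le n K d.

Definition Cdim_space (n d : nat) : set (set (pt n)) :=
  [set K | Cspace n K /\ covdim_eq n K d].

(* E ≤_B F, for homeomorphism on Borel subsets A ⊆ K([0,1]^n), B ⊆ K([0,1]^m) *)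
Definition homeo_borel_reducible (n m : nat) (A : set (set (pt n)))
    (B : set (set (pt m))) : Prop :=
  exists f : set (pt n) -> set (pt m),
    [/\ borel_map n m f, (forall K, A K -> B (f K)) &
        forall K L, A K -> A L -> (homeomorphic n n K L <-> homeomorphic m m (f K) (f L))].

End Hyperspace.

(* Main.v *)
(* For a compact [K] in R^n let bnd K be its boundary and choose a discrete set [D]
   off [K] whose limit points are exactly bnd K. In R^n x R put [K] at height 1, take
   the cone with apex 0 over bnd K and [D], and add the cube [0,1]^n at height 0.
   Every component of [K] meets bnd K, so the result X_K is a continuum; it is compact
   with empty interior in R^(n+1), hence of dimension at most n, and it contains an
   n-cube. By invariance of domain a homeomorphism K -> L maps bnd K onto bnd L, and a
   Schroeder-Bernstein matching of the discrete sets extends it to them, hence to the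
   cones.
   Conversely, the points of X_K that are not interior to an arc are those of [D], up
   to finitely many points and points of bnd K; so bnd K is their set of limit points,
   and the interior of [K] is what remains of X_K minus bnd K outside the connected
   part containing [D]. Finally X_K depends on [K] in a Borel way because bnd K lies in
   the closure of [D], which is drawn from a fixed countable set.

   The topological input is the Poincare-Miranda theorem, obtained from the cup product
   of n cubical coboundaries mod 2 on a grid. *)
Require Import Defs.
From HB Require Import structures.
From mathcomp Require Import all_boot all_order all_algebra.
From mathcomp Require Import all_classical all_reals all_analysis.
From mathcomp Require Import ring lra zify.
Set Implicit Arguments. Unset Strict Implicit. Unset Printing Implicit Defensive.
Import Order.TTheory GRing.Theory Num.Theory.
Import numFieldNormedType.Exports.
Local Open Scope classical_set_scope.
Local Open Scope ring_scope.

(** * Metric preliminaries *)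

(** Coning all of [K] would raise the dimension wherever [K] has interior, so only a nowhere dense
    set is coned and the interior of [K] is kept at height 1 alone. A homeomorphism of the resulting
    continua need not respect heights, so [bnd K] has to be visible intrinsically; the discrete set
    serves for this, since each of its rays has a free end. It is no invariant of [K], however: a
    homeomorphism [K -> L] knows nothing about it. What helps is that, for nonempty [K], both
    discrete sets are infinite and cluster at every boundary point, so that a bijection between them
    that is asymptotically compatible with the given map extends it continuously. Poincare-Miranda
    enters twice: it bounds the dimension of a cube from below and, together with the upper bound
    for nowhere dense compacta applied to spheres, it gives invariance of domain. The empty [K] is
    allowed; its image is the cube at height 0 alone. *)

Section NormedSpace.
Variable R : realType.

Section General.
Variables V W : normedModType R.
Implicit Types (K A : set V) (x y : V).

Lemma openE_norm A : open A <->
  forall x, A x -> exists2 e, 0 < e & forall y, `|x - y| < e -> A y.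
Proof.
rewrite openE; split=> h x /h.
  by move=> /nbhs_ballP[e e0 eA]; exists e => // y xy; apply: eA; rewrite -ball_normE.
by move=> [e e0 eA]; apply/nbhs_ballP; exists e => //; rewrite -ball_normE.
Qed.

Lemma closed_norm_sep A x : closed A -> ~ A x ->
  exists2 e, 0 < e & forall y, `|x - y| < e -> ~ A y.
Proof. by rewrite -openC => /openE_norm h /h. Qed.

Lemma interior_normP A x :
  A° x <-> exists2 e, 0 < e & forall y, `|x - y| < e -> A y.
Proof.
split=> [/nbhs_ballP[e e0 eA]|[e e0 eA]].
  by exists e => // y xy; apply: eA; rewrite -ball_normE.
by apply/nbhs_ballP; exists e => //; rewrite -ball_normE.
Qed.

Lemma within_normP K (f : V -> W) : {within K, continuous f} <->
  forall x, K x -> forall e, 0 < e -> exists2 d, 0 < d &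
    forall y, K y -> `|x - y| < d -> `|f x - f y| < e.
Proof.
split=> [/subspace_continuousP h x /h /cvgrPdist_lt fx e /fx|h].
  rewrite /prop_near1 /within/= => /nbhs_ballP[d d0 dK]; exists d => // y Ky xy.
  by apply: dK; rewrite -?ball_normE.
apply/subspace_continuousP => x Kx; apply/cvgrPdist_lt => e /(h _ Kx)[d d0 dK].
rewrite /prop_near1 /within/=; apply/nbhs_ballP; exists d => // y.
by rewrite -ball_normE /= => xy Ky; apply: dK.
Qed.

Lemma continuous_normP (f : V -> W) : continuous f <->
  forall x e, 0 < e -> exists2 d, 0 < d &
    forall y, `|x - y| < d -> `|f x - f y| < e.
Proof.
apply: iff_trans (continuous_subspace_setT f) _.
apply: iff_trans (within_normP setT f) _; split=> h x.
  by move=> e /(h x I)[d d0 dK]; exists d => // y xy; exact: dK.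
by move=> _ e e0; have [d d0 dK] := h x e e0; exists d => // y _ xy; exact: dK.
Qed.

(** A hereditary property [Q] replaces the open cover, so that the same statement serves for
    containment in a member of a cover, for a constant sign and for small oscillation. *)
Lemma lebesgue_number K (Q : set V -> Prop) : compact K ->
  (forall A B : set V, A `<=` B -> Q B -> Q A) ->
  (forall x, K x -> exists2 e, 0 < e & Q (ball x e)) ->
  exists2 l, 0 < l & forall x, K x -> Q (ball x l).
Proof.
move=> /compact_near_coveringP cK Qm h.
have : \forall l \near (0 : R)^'+, K `<=` (fun x => Q (ball x l)).
  apply: (cK _ _ (fun l x => Q (ball x l))) => x /h[e e0 Qe].
  exists (ball x (e / 2), [set l | l < e / 2]); first split => /=.
  - by apply: nbhsx_ballx; rewrite divr_gt0.
  - by near=> l; near: l; apply: nbhs_right_lt; rewrite divr_gt0.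
  case=> x' l [/= xx' le]; apply: Qm Qe => y x'y.
  by rewrite (splitr e); apply: ball_triangle xx' _; apply: le_ball x'y; exact: ltW.
move=> [e /= e0 eK]; exists (e / 2); first by rewrite divr_gt0.
have /eK : ball (0 : R) e (e / 2).
  by rewrite -ball_normE /= sub0r normrN gtr0_norm ?divr_gt0 // ltr_pdivrMr//; lra.
by move=> /(_ _); apply; rewrite ?divr_gt0.
Unshelve. all: by end_near. Qed.

End General.

Section Rows.
Variable n : nat.
Implicit Types x y : 'rV[R]_n.

Lemma row_norm_ltP x e : 0 < e -> `|x| < e <-> forall i, `|x ord0 i| < e.
Proof.
move=> e0; rewrite {1}/Num.Def.normr /= mx_normrE; split=> [h i|h].
  by have /bigmax_ltP[_ /(_ (ord0, i) isT)] := h.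
by apply/bigmax_ltP; split=> // -[a i] _ /=; rewrite ord1.
Qed.

Lemma row_norm_leP x e : 0 <= e -> `|x| <= e <-> forall i, `|x ord0 i| <= e.
Proof.
move=> e0; rewrite {1}/Num.Def.normr /= mx_normrE; split=> [h i|h].
  by have /bigmax_leP[_ /(_ (ord0, i) isT)] := h.
by apply/bigmax_leP; split=> // -[a i] _ /=; rewrite ord1.
Qed.

Lemma row_norm_coord x i : `|x ord0 i| <= `|x|.
Proof. by apply: (row_norm_leP x (normr_ge0 x)).1. Qed.

End Rows.

Lemma within_rowP (V : normedModType R) n (K : set V) (f : V -> 'rV[R]_n) :
  (forall i, {within K, continuous (fun x => f x ord0 i : R^o)}) ->
  {within K, continuous f}.
Proof.
move=> h; apply/within_normP => x Kx e e0.
have /choice[d dP] : forall i, exists d, 0 < d /\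
    forall y, K y -> `|x - y| < d -> `|f x ord0 i - f y ord0 i| < e.
  by move=> i; have /within_normP/(_ x Kx e e0)[d d0 dK] := h i; exists d.
exists (\big[Num.min/1]_i d i).
  by apply/bigmin_gtP; split=> // i _; have [] := dP i.
move=> y Ky /bigmin_gtP[_ xy]; apply/row_norm_ltP => // i.
by rewrite !mxE; apply (dP i).2 => //; apply: xy.
Qed.

End NormedSpace.

(** * Sign changes on a grid *)

Section GridCochains.
Variable I : finType.
Implicit Types (z w : I -> nat) (J : {set I}) (i j k : I) (ks js : seq I).

Definition upd z j (t : nat) : I -> nat := fun i => if i == j then t else z i.
Definition up j z := upd z j (z j).+1.

Lemma upd_comm z i j s t : i != j -> upd (upd z i s) j t = upd (upd z j t) i s.
Proof.
move=> ij; apply/funext => k; rewrite /upd.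
by case: eqP => // ->; rewrite eq_sym (negPf ij).
Qed.

Lemma up_comm z i j : up i (up j z) = up j (up i z).
Proof.
have [->//|ij] := eqVneq i j; apply/funext => k.
rewrite /up /upd /= (negPf ij) [j == i]eq_sym (negPf ij).
by case: (eqVneq k i) => // ->; rewrite (negPf ij).
Qed.

Lemma addF2 (x : 'F_2) : x + x = 0.
Proof. by apply: addrr_pchar2; rewrite pchar_Fp. Qed.

Variable A : I -> (I -> nat) -> 'F_2.

(* The value on the cube [z + {0,1}^J] of the cup product over F_2 of the coboundaries of
   the [A k], [k] in [ks], written as the coboundary of [A k] times the remaining product. *)
Fixpoint cup ks J z : 'F_2 :=
  if ks is k :: ks' then
    \sum_(j in J) (A k (up j z) * cup ks' (J :\ j) (up j z)
                   + A k z * cup ks' (J :\ j) z)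
  else (J == finset.set0)%:R.

(** The terms for [(i, j)] and [(j, i)] are equal and cancel in characteristic 2. *)
Lemma sum_offdiag_sym J (F : I -> I -> 'F_2) : (forall i j, F i j = F j i) ->
  \sum_(i in J) \sum_(j in J :\ i) F i j = 0.
Proof.
move=> FC; pose lt i j := (enum_rank i < enum_rank j)%N.
have E : \sum_(i in J) \sum_(j in J :\ i) F i j =
   \sum_(i in J) \sum_(j in J | lt i j) F i j
   + \sum_(i in J) \sum_(j in J | lt j i) F i j.
  rewrite -big_split/=; apply: eq_bigr => i iJ.
  rewrite (bigID (fun j => lt i j))/=; congr (_ + _); apply: eq_bigl => j.
    rewrite !inE /lt; case: (eqVneq j i) => [->|]; rewrite ?ltnn ?andbF//.
  rewrite !inE /lt -leqNgt leq_eqVlt.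
  case: (eqVneq j i) => [->|ji]; first by rewrite ltnn andbF.
  rewrite (inj_eq val_inj) (inj_eq enum_rank_inj) (negPf ji) /=.
  by [].
rewrite E [X in _ + X](exchange_big_dep (fun j => j \in J)); last by move=> i j _ /andP[].
rewrite [X in _ + X](_ : _ = \sum_(i in J) \sum_(j in J | lt i j) F i j) ?addF2//.
apply: eq_bigr => i iJ; apply: eq_big => [j|j _]; last by rewrite FC.
by rewrite iJ.
Qed.

(** A product of coboundaries is a cocycle: every face of codimension two is reached through two
    faces of codimension one, and the two contributions cancel. *)
Lemma cup_cocycle ks J z :
  \sum_(j in J) (cup ks (J :\ j) (up j z) + cup ks (J :\ j) z) = 0.
Proof.
case: ks => [|k ks] /=; first by apply: big1 => j _; rewrite addF2.
pose G w i j := A k w * cup ks ((J :\ i) :\ j) w.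
pose F i j := G (up j (up i z)) i j + G (up i z) i j + (G (up j z) i j + G z i j).
rewrite (eq_bigr (fun i => \sum_(j in J :\ i) F i j)).
  apply: sum_offdiag_sym => i j; rewrite /F /G up_comm.
  have -> : (J :\ j) :\ i = (J :\ i) :\ j.
    by apply/setP => x; rewrite !inE andbCA.
  by rewrite addrACA.
by move=> i _; rewrite -big_split.
Qed.

(** A constant [A k] has zero coboundary. At the head of the list the constant factors out and
    leaves the sum of [cup_cocycle]; further down every face inherits the hypothesis. *)
Lemma cup_vanish ks J z k c : k \in ks ->
  (forall w, (forall i, (z i <= w i <= z i + (i \in J))%N) -> A k w = c) ->
  cup ks J z = 0.
Proof.
elim: ks J z => //= k0 ks IH J z; rewrite inE.
have zJ w : w = z -> (forall i, (z i <= w i <= z i + (i \in J))%N).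
  by move=> -> i; rewrite leqnn leq_addr.
have upJ j : j \in J -> (forall i, (z i <= up j z i <= z i + (i \in J))%N).
  move=> jJ i; rewrite /up /upd; case: eqP => [->|_]; last by rewrite leqnn leq_addr.
  by rewrite jJ addn1 leqnSn leqnn.
case: eqVneq => [<- _ Ac|_ /= kks Ac].
  rewrite (eq_bigr (fun j => c * (cup ks (J :\ j) (up j z) + cup ks (J :\ j) z))).
    by rewrite -big_distrr/= cup_cocycle mulr0.
  by move=> j jJ; rewrite !Ac ?mulrDr//; [exact: zJ|exact: upJ].
apply: big1 => j jJ; rewrite !IH ?mulr0 ?addr0//.
  move=> w wJ; apply: Ac => i; have := wJ i; rewrite !inE.
  by case: (i == j); case: (i \in J); lia.
move=> w wJ; apply: Ac => i; have := wJ i; rewrite /up /upd !inE.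
by case: eqP => [->|_] /=; rewrite ?jJ; lia.
Qed.

Variable N : nat.

Fixpoint boxsum js (f : (I -> nat) -> 'F_2) z : 'F_2 :=
  if js is j :: js' then \sum_(t < N) boxsum js' f (upd z j t) else f z.

Lemma boxsum_ext js f g z : uniq js ->
  (forall w, (forall i, i \notin js -> w i = z i) -> f w = g w) ->
  boxsum js f z = boxsum js g z.
Proof.
elim: js z => [|j js IH] z /=; first by move=> _; apply.
move=> /andP[jjs ujs] fg; apply: eq_bigr => t _; apply: IH => // w wz.
apply: fg => i; rewrite inE negb_or => /andP[ij ijs].
by rewrite wz// /upd (negPf ij).
Qed.

Lemma boxsum_sum js (J : {set I}) F z :
  boxsum js (fun w => \sum_(i in J) F i w) z = \sum_(i in J) boxsum js (F i) z.
Proof.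
elim: js z => [//|j js IH] z /=; rewrite exchange_big/=.
by apply: eq_bigr => t _; rewrite IH.
Qed.

Lemma boxsumD js f g z :
  boxsum js (fun w => f w + g w) z = boxsum js f z + boxsum js g z.
Proof.
by elim: js z => [//|j js IH] z /=; rewrite -big_split; apply: eq_bigr.
Qed.

Lemma boxsum_up js j f z : j \notin js ->
  boxsum js (fun w => f (up j w)) z = boxsum js f (up j z).
Proof.
elim: js z => [//|i js IH] z /=; rewrite inE negb_or => /andP[ji jjs].
apply: eq_bigr => t _; rewrite IH//; congr (boxsum _ _ _).
by rewrite /up upd_comm 1?eq_sym//; congr (upd _ _ _); rewrite /upd (negPf ji).
Qed.

(** Discrete Stokes formula: the differences in direction [i] telescope to the two opposite faces,
    without signs in characteristic 2. *)
Lemma boxsum_stokes js i f z : uniq js -> i \in js ->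
  boxsum js (fun w => f (up i w) + f w) z =
  boxsum (rem i js) f (upd z i N) + boxsum (rem i js) f (upd z i 0).
Proof.
elim: js z => [//|j js IH] z /= /andP[jjs ujs]; rewrite inE.
have [ij _|ij /= ijs] := eqVneq i j.
  subst i; rewrite ?eqxx.
  under eq_bigr => t _ do rewrite boxsumD boxsum_up//.
  have uu t : up j (upd z j t) = upd z j t.+1.
    by apply/funext => k; rewrite /up /upd eqxx; case: eqP.
  under eq_bigr => t _ do rewrite uu.
  elim: N => [|M IHM]; first by rewrite big_ord0 addF2.
  rewrite big_ord_recr/= IHM.
  set a := boxsum js f (upd z j M); set b := boxsum _ _ _; set c := boxsum _ _ _.
  by rewrite addrC -addrA [a + (a + b)]addrA addF2 add0r.
rewrite /= -big_split; apply: eq_bigr => t _.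
by rewrite IH// ![upd (upd z j t) i _]upd_comm 1?eq_sym.
Qed.

Lemma boxsum_neq0 js f z : boxsum js f z != 0 ->
  exists w, [/\ forall i, i \in js -> (w i < N)%N,
                forall i, i \notin js -> w i = z i & f w != 0].
Proof.
elim: js z => [|j js IH] z /=; first by move=> fz; exists z.
move=> S; have [t tS] : exists t : 'I_N, boxsum js f (upd z j t) != 0.
  apply: contrapT => nt; move/eqP: S; apply; apply: big1 => t _.
  by apply/eqP; apply: contrapT => /negP h; apply: nt; exists t.
have [w [w1 w2 w3]] := IH _ tS; exists w; split => // i; rewrite inE.
  case: (boolP (i \in js)) => [/w1//|ijs]; rewrite orbF => /eqP ij.
  by rewrite w2// ij /upd eqxx.
by rewrite negb_or => /andP[ij ijs]; rewrite w2// /upd (negPf ij).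
Qed.

Hypothesis A0 : forall k z, z k = 0%N -> A k z = 0.
Hypothesis AN : forall k z, z k = N -> A k z = 1.

(** By Stokes only the outer faces of the grid contribute. Across a direction [i] other than the
    head [j], the label [A i] is constant on each face and the product vanishes. Across [j], the
    factor [A j] is 0 on one face and 1 on the other, which leaves the same sum for the shorter
    list. *)
Lemma boxsum_cup js z : uniq js ->
  boxsum js (cup js [set x in js]) z = 1.
Proof.
elim: js z => [|j js IH] z.
  by move=> _ /=; rewrite (_ : _ == _)//; apply/eqP/setP => x; rewrite !inE.
move=> ujjs; have /andP[jjs ujs] := ujjs.
set J := [set x in j :: js]%SET.
rewrite [cup _ _](_ : _ = fun w => \sum_(i in J) (A j (up i w) *
   cup js (J :\ i) (up i w) + A j w * cup js (J :\ i) w))//.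
rewrite boxsum_sum.
pose f i w := A j w * cup js (J :\ i) w.
have E i : i \in J -> boxsum (j :: js) (fun w => A j (up i w) *
   cup js (J :\ i) (up i w) + A j w * cup js (J :\ i) w) z =
   boxsum (rem i (j :: js)) (f i) (upd z i N)
   + boxsum (rem i (j :: js)) (f i) (upd z i 0).
  by rewrite inE => iJ; rewrite -(@boxsum_stokes _ _ (f i)).
rewrite (eq_bigr _ E) (bigD1 j)/=; last by rewrite !inE eqxx.
rewrite [X in _ + X]big1 ?addr0.
  have Jj : J :\ j = [set x in js]%SET.
    apply/setP => x; rewrite !inE; case: eqP => //= ->; apply/esym/negbTE/jjs.
  rewrite /= eqxx (@boxsum_ext _ _ (cup js [set x in js]%SET) (upd z j N))//.
    rewrite IH// (@boxsum_ext _ _ (fun=> 0) (upd z j 0))//.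
      by rewrite (_ : boxsum _ _ _ = 0) ?addr0//;
        elim: (js) (upd _ _ _) => //= *; rewrite big1.
    by move=> w wz; rewrite /f A0 ?mul0r// wz// /upd eqxx.
  by move=> w wz; rewrite /f Jj AN ?mul1r// wz// /upd eqxx.
move=> i /andP[]; rewrite !inE => /orP[->//|ijs] ij.
(* Direction [i] is no longer summed, so the integrand may assume that coordinate [i] equals [t]. *)
have i_rem t : boxsum (rem i (j :: js)) (f i) (upd z i t) =
    boxsum (rem i (j :: js)) (fun w => if w i == t then f i w else 0) (upd z i t).
  apply: boxsum_ext; first exact: rem_uniq.
  by move=> w wz; rewrite wz ?rem_filter ?mem_filter//= /upd !eqxx.
have z0 t c : (forall w, w i = t -> A i w = c) ->
    boxsum (rem i (j :: js)) (f i) (upd z i t) = 0.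
  move=> At; rewrite i_rem.
  transitivity (boxsum (rem i (j :: js)) (fun=> 0) (upd z i t)); last first.
    by elim: (rem _ _) (upd _ _ _) => //= *; rewrite big1.
  congr (boxsum _ _ _); apply/funext => w; case: eqP => // wt.
  rewrite /f (@cup_vanish _ _ _ i c) ?mulr0// => w' ww'; apply: At.
  by have := ww' i; rewrite !inE eqxx /= addn0 -eqn_leq => /eqP <-.
by rewrite (z0 N 1) ?(z0 0%N 0) ?addr0// => w wi; [exact: A0|exact: AN].
Qed.

(** The total over the grid is 1, so the product is nonzero on some cell, and there [cup_vanish]
    forbids a constant label. *)
Lemma grid_sign_change : exists z, (forall i, (z i < N)%N) /\
  forall k c, ~ (forall w, (forall i, (z i <= w i <= (z i).+1)%N) -> A k w = c).
Proof.
have E : [set x in enum I]%SET = [set: I]%SET by apply/setP => x; rewrite !inE mem_enum.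
have := @boxsum_cup (enum I) (fun=> 0%N) (enum_uniq _); rewrite E => B1.
have [|z [z1 _ z2]] := @boxsum_neq0 (enum I) (cup (enum I) [set: I]%SET) (fun=> 0%N).
  by rewrite B1 oner_eq0.
exists z; split=> [i|k c kc]; first by rewrite z1// mem_enum.
move/eqP: z2; apply; apply: (@cup_vanish _ _ _ k c); first by rewrite mem_enum.
move=> w wz; apply: kc => i; move: (wz i); by rewrite finset.in_setT addn1.
Qed.

End GridCochains.

(** * The Poincare-Miranda theorem *)

Section Miranda.
Variable R : realType.

Lemma compact_cball n (c : 'rV[R]_n) r : compact [set x : 'rV[R]_n | `|c - x| <= r].
Proof.
apply: bounded_closed_compact.
  exists (`|c| + r); split; first exact: num_real.
  move=> M ltM x /= cx; apply: le_trans (ltW ltM).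
  by rewrite -[x](subrKC c) addrC (le_trans (ler_normD _ _))// addrC lerD// distrC.
rewrite -openC openE_norm => x /= /negP; rewrite -ltNge => rcx.
exists (`|c - x| - r); first by rewrite subr_gt0.
move=> y xy; apply/negP; rewrite -ltNge.
have := ler_distD y c x; rewrite [`|y - x|]distrC; lra.
Qed.

(** The second alternative is [<= 0], the exact complement of positivity, to match the two-valued
    labels on the grid. *)
Lemma sign_locally_constant n (K : set 'rV[R]_n) (F : 'rV[R]_n -> 'rV[R]_n) x :
  {within K, continuous F} -> K x -> F x != 0 ->
  exists2 e, 0 < e & exists i,
    (forall y, (K `&` ball x e) y -> 0 < F y ord0 i) \/
    (forall y, (K `&` ball x e) y -> F y ord0 i <= 0).
Proof.
move=> /within_normP Fc Kx Fx0.
have [i Fxi] : exists i, F x ord0 i != 0.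
  apply: contrapT => h; move/eqP: Fx0; apply; apply/rowP => i; rewrite mxE.
  by apply/eqP; apply: contrapT => /negP Fi; apply: h; exists i.
have Fxi0 : 0 < `|F x ord0 i| by rewrite normr_gt0.
have [d d0 dF] := Fc x Kx _ Fxi0; exists d => //; exists i.
have {}dF y : (K `&` ball x d) y -> `|F x ord0 i - F y ord0 i| < `|F x ord0 i|.
  move=> [Ky]; rewrite -ball_normE /= => xy.
  apply: le_lt_trans (dF y Ky xy).
  by have := row_norm_coord (F x - F y) i; rewrite !mxE.
have [Fi|Fi|E] := ltrgtP (F x ord0 i) 0; [right|left|by rewrite E eqxx in Fxi].
  by move=> y /dF; rewrite (ltr0_norm Fi) ltr_norml; lra.
by move=> y /dF; rewrite (gtr0_norm Fi) ltr_norml; lra.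
Qed.

(** Without a zero, some coordinate of [F] would keep its sign on each cell of a fine grid; the
    labels recording positivity then contradict [grid_sign_change]. *)
Theorem poincare_miranda n (c : 'rV[R]_n) r (F : 'rV[R]_n -> 'rV[R]_n) :
  0 < r -> {within [set x | `|c - x| <= r], continuous F} ->
  (forall x i, `|c - x| <= r -> x ord0 i = c ord0 i - r -> F x ord0 i <= 0) ->
  (forall x i, `|c - x| <= r -> x ord0 i = c ord0 i + r -> 0 < F x ord0 i) ->
  exists2 x, `|c - x| <= r & F x = 0.
Proof.
move=> r0 Fc Fneg Fpos; apply: contrapT => noz.
pose K := [set x : 'rV[R]_n | `|c - x| <= r].
pose Q A := exists i, (forall y, (K `&` A) y -> 0 < F y ord0 i) \/
                      (forall y, (K `&` A) y -> F y ord0 i <= 0).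
have [||l l0 lQ] := @lebesgue_number _ _ K Q (compact_cball (c := c) (r := r)).
- move=> A B AB [i [h|h]]; exists i; [left|right] => y [Ky Ay]; apply: h;
    by split=> //; exact: AB.
- move=> x Kx; have Fx0 : F x != 0.
    by apply/eqP => Fx0; apply: noz; exists x.
  exact: sign_locally_constant Fx0.
have [N Nl] : exists N : nat, 2 * r / N.+1%:R < l.
  exists (Num.truncn (2 * r / l)).
  by rewrite ltr_pdivrMr ?ltr0n// [l * _]mulrC -ltr_pdivrMr// truncnS_gt.
(* Clamping with [minn] keeps [p z] in the cube for every [z], since the hypotheses of the grid
   lemma range over all of [I -> nat]. *)
pose p (z : 'I_n -> nat) : 'rV[R]_n :=
  \row_i (c ord0 i - r + 2 * r * (minn (z i) N.+1)%:R / N.+1%:R).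
have N0 : 0 < N.+1%:R :> R by rewrite ltr0n.
have pK z : `|c - p z| <= r.
  apply/row_norm_leP => [|i]; first exact: ltW.
  rewrite !mxE ler_norml.
  have le1 : (minn (z i) N.+1)%:R / N.+1%:R <= 1 :> R.
    by rewrite ler_pdivrMr// mul1r ler_nat geq_minr.
  have ge0 : 0 <= (minn (z i) N.+1)%:R / N.+1%:R :> R by rewrite divr_ge0 ?ler0n.
  rewrite -mulrA; set t := _ / _ in le1 ge0 *.
  have rt0 : 0 <= r * t by apply: mulr_ge0 => //; exact: ltW.
  have rt1 : r * t <= r by apply: ler_piMr => //; exact: ltW.
  lra.
pose A k z : 'F_2 := (0 < F (p z) ord0 k)%R%:R.
have [||z [zN zc]] := @grid_sign_change 'I_n A N.+1.
- move=> k z zk; rewrite /A ltNge Fneg//.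
  by rewrite mxE zk min0n mulr0 mul0r addr0.
- move=> k z zk; rewrite /A Fpos//.
  by rewrite mxE zk minnn -mulrA divff ?gt_eqF// mulr1; ring.
have cell w : (forall i, (z i <= w i <= (z i).+1)%N) -> (K `&` ball (p z) l) (p w).
  move=> zw; split; first exact: pK.
  rewrite -ball_normE /=; apply: le_lt_trans Nl.
  apply/row_norm_leP => [|i].
    by rewrite divr_ge0 ?ler0n// mulr_ge0 ?ler0n// ltW.
  rewrite !mxE (_ : _ - _ = 2 * r / N.+1%:R *
    ((minn (z i) N.+1)%:R - (minn (w i) N.+1)%:R)); last by ring.
  rewrite normrM ger0_norm; last by rewrite divr_ge0 ?ler0n// mulr_ge0 ?ler0n// ltW.
  rewrite ler_piMr//; first by rewrite divr_ge0 ?ler0n// mulr_ge0 ?ler0n// ltW.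
  have := zw i; have := zN i; set a := z i; set b := w i => aN /andP[ab ba].
  rewrite (minn_idPl _) ?(ltnW aN)// (minn_idPl _) ?(leq_trans ba)//.
  rewrite distrC ger0_norm ?subr_ge0 ?ler_nat// lerBlDr.
  by rewrite -[1]/(1%:R) -natrD ler_nat add1n.
have [i [h|h]] := lQ _ (pK z).
  by apply: (zc i 1) => w /cell /h; rewrite /A => ->.
by apply: (zc i 0) => w /cell /h; rewrite /A leNgt => /negbTE ->.
Qed.

End Miranda.

(** * Dimension theory *)

Section Avoidance.
Variable R : realType.

Section Baire.
Variable V : normedModType R.

(* The last clause gives a whole ball, which makes the induction go through. *)
Lemma finite_union_nowhere_dense (I : eqType) (A : I -> set V) (s : seq I) (p : V) e :
  (forall i, i \in s -> closed (A i) /\ (A i)° = set0) -> 0 < e ->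
  exists q, `|p - q| < e /\ exists2 d, 0 < d &
    forall i, i \in s -> forall y, `|q - y| < d -> ~ A i y.
Proof.
elim: s p e => [|i s IH] p e sA e0.
  by exists p; rewrite subrr normr0; split=> //; exists 1.
have [j js|q [pq [d d0 dq]]] := IH p e _ e0.
  by apply: sA; rewrite inE js orbT.
have [cA iA] := sA i (mem_head i s).
pose r := Num.min d (e - `|p - q|).
have r0 : 0 < r by rewrite lt_min d0 subr_gt0.
have [q' qq' Aq'] : exists2 q', `|q - q'| < r & ~ A i q'.
  apply: contrapT => h; have : (A i)° q.
    apply/interior_normP; exists r => // y qy.
    by apply: contrapT => Ay; apply: h; exists y.
  by rewrite iA.
have [d' d'0 d'A] := closed_norm_sep cA Aq'.
move: qq'; rewrite lt_min => /andP[qq'd qq'e].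
exists q'; split.
  by have := ler_distD q p q'; lra.
exists (Num.min d' (d - `|q - q'|)); first by rewrite lt_min d'0 subr_gt0.
move=> j; rewrite inE => /predU1P[->|/dq Bq] y; rewrite lt_min => /andP[y1 y2].
  exact: d'A.
by apply: Bq; have := ler_distD q' q y; lra.
Qed.

End Baire.

Section Distance.
Variables (V : normedModType R) (A : set V).
Implicit Types x y : V.

(* Capped at 1, so that an empty [A] is harmless. *)
Definition dist1 x : R := inf ([set `|x - y| | y in A] `|` [set 1]).

Lemma dist1_has_inf x : has_inf ([set `|x - y| | y in A] `|` [set 1]).
Proof.
split; first by exists 1; right.
by exists 0 => _ [[y _ <-]|->]; rewrite ?normr_ge0.
Qed.

Lemma dist1_ge x e : e <= 1 -> (forall y, A y -> e <= `|x - y|) -> e <= dist1 x.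
Proof.
move=> e1 eA; apply: lb_le_inf; first by exists 1; right.
by move=> _ [[y Ay <-]|->]//; exact: eA.
Qed.

Lemma dist1_le x y : A y -> dist1 x <= `|x - y|.
Proof.
by move=> Ay; apply: ge_inf; [exact: (dist1_has_inf x).2|left; exists y].
Qed.

Lemma dist1_ge0 x : 0 <= dist1 x. Proof. exact: dist1_ge. Qed.

Lemma dist1_lip x y : `|dist1 x - dist1 y| <= `|x - y|.
Proof.
suff h a b : dist1 a - `|a - b| <= dist1 b.
  by rewrite ler_norml; have := h x y; have := h y x; rewrite distrC; lra.
apply: dist1_ge => [|z Az].
  suff : dist1 a <= 1 by have := normr_ge0 (a - b); lra.
  by apply: ge_inf; [exact: (dist1_has_inf a).2|right].
by have := dist1_le a Az; have := ler_distD b a z; lra.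
Qed.

Lemma dist1_gt0 x : closed A -> ~ A x -> 0 < dist1 x.
Proof.
move=> cA /(closed_norm_sep cA)[e e0 eA].
apply: (@lt_le_trans _ _ (Num.min e 1)); first by rewrite lt_min e0 ltr01.
apply: dist1_ge => [|y Ay]; first by rewrite ge_min lexx orbT.
by rewrite ge_min leNgt; apply/orP; left; apply/negP => /eA.
Qed.

Lemma dist1_eq0 x : A x -> dist1 x = 0.
Proof.
move=> Ax; apply/eqP; rewrite eq_le dist1_ge0 andbT.
by have := dist1_le x Ax; rewrite subrr normr0.
Qed.

Lemma dist1_continuous : continuous (dist1 : V -> R^o).
Proof.
apply/continuous_normP => x e e0; exists e => // y.
exact/le_lt_trans/dist1_lip.
Qed.

End Distance.

Lemma finite_ball_cover (V : normedModType R) (X : set V) e :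
  compact X -> 0 < e -> exists k (c : 'I_k -> V), (forall i, X (c i)) /\
    forall x, X x -> exists i, `|c i - x| < e.
Proof.
move=> cX e0; have := cX; rewrite compact_cover => /(_ V X (fun c => ball c e)).
case=> [c _|x Xx|D DX Dc]; [exact: ball_open|by exists x => //; exact: ballxx|].
exists (size (finmap.enum_fset D)), (fun i => nth 0 (finmap.enum_fset D) i); split.
  by move=> i; have := mem_nth 0 (ltn_ord i); move=> /DX/set_mem.
move=> x /Dc [c /= cD]; rewrite -ball_normE /= => xc.
have ci : (index c (finmap.enum_fset D) < size (finmap.enum_fset D))%N by rewrite index_mem.
by exists (Ordinal ci); rewrite /= nth_index.
Qed.

Definition affine_form k (a : R) (b : 'I_k -> R) (p : 'rV[R]_k) : R :=
  a + \sum_i p ord0 i * b i.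

Lemma affine_form_continuous k a (b : 'I_k -> R) :
  continuous (affine_form a b : 'rV[R]_k -> R^o).
Proof.
apply/continuous_normP => p e e0; pose C := \sum_i `|b i| + 1.
have C0 : 0 < C by rewrite ltr_wpDl// sumr_ge0.
exists (e / C) => [|q pq]; first by rewrite divr_gt0.
rewrite /affine_form opprD addrACA subrr add0r -sumrB.
have pqC : `|p - q| * C < e by rewrite -ltr_pdivlMr.
apply: le_lt_trans pqC; apply: le_trans (ler_norm_sum _ _ _) _.
rewrite /C mulrDr mulr_sumr mulr1 ler_wpDr// ler_sum// => i _.
rewrite -mulrBl normrM ler_wpM2r//.
by have := row_norm_coord (p - q) i; rewrite !mxE.
Qed.

(** The zero set is a hyperplane, or empty when only the constant term is nonzero. *)
Lemma affine_form_zeros k a (b : 'I_k -> R) : (a != 0) || [exists i, b i != 0] ->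
  closed [set p | affine_form a b p = 0] /\ [set p | affine_form a b p = 0]° = set0.
Proof.
move=> ab0; split.
  apply: (@closed_comp _ _ (affine_form a b) [set 0 : R^o]).
    by move=> p _; apply: affine_form_continuous.
  exact: (@accessible_closed_set1 _ (hausdorff_accessible (@Rhausdorff R))).
rewrite -subset0 => p /interior_normP[e e0 ez].
have [/existsP[i bi0]|/existsPn b0] := boolP [exists i, b i != 0].
  pose q := p + (e / 2) *: delta_mx ord0 i.
  have pz : affine_form a b p = 0 by apply: ez; rewrite subrr normr0.
  have : affine_form a b q = 0.
    apply: ez; rewrite /q opprD addNKr normrN.
    apply/row_norm_ltP => // j; rewrite !mxE eqxx /=; case: eqP => _ /=.
      by rewrite mulr1 gtr0_norm ?divr_gt0// ltr_pdivrMr//; lra.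
    by rewrite mulr0 normr0.
  rewrite /affine_form (eq_bigr (fun j => p ord0 j * b j + (e / 2) * (j == i)%:R * b j)).
    rewrite big_split/= addrA -/(affine_form a b p) pz add0r (bigD1 i)//= eqxx mulr1.
    rewrite big1 ?addr0 => [|j /negPf ->]; last by rewrite mulr0 mul0r.
    by move/eqP; rewrite mulf_eq0 (negPf bi0) orbF mulf_eq0 gt_eqF//= invr_eq0 pnatr_eq0.
  by move=> j _; rewrite !mxE eqxx/= mulrDl eq_sym.
have : affine_form a b p = 0 by apply: ez; rewrite subrr normr0.
rewrite /affine_form big1 ?addr0 => [a0|i _].
  by move: ab0; rewrite a0 eqxx /= => /existsP[i]; rewrite (negPf (b0 i)).
by have /negPn/eqP -> := b0 i; rewrite mulr0.
Qed.

(** Vanishing at [m] points imposes [m] linear equations on [k + 1] coefficients, so [m <= k] leaves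
    a nonzero solution. *)
Lemma common_affine_form k (m : nat) (v : 'I_m -> 'rV[R]_k) : (m <= k)%N ->
  exists a b, (a != 0) || [exists i, b i != 0] /\
    forall j, affine_form a b (v j) = 0.
Proof.
move=> mk.
pose M := \matrix_(j < m, i < k.+1) (if unlift ord0 i is Some i' then v j ord0 i' else 1).
have : cokermx M != 0.
  rewrite -mxrank_eq0 mxrank_coker -lt0n subn_gt0.
  exact: leq_ltn_trans (rank_leq_row M) _.
move=> /matrix0Pn[i0 [c0 Mc]]; pose u := col c0 (cokermx M).
have Mu : M *m u = 0.
  apply/matrixP => j i; have /matrixP/(_ j c0) := mulmx_coker M.
  rewrite !mxE => Mc0; apply: etrans Mc0; apply: eq_bigr => l _.
  by rewrite [u _ _]mxE.
exists (u ord0 ord0), (fun i => u (lift ord0 i) ord0); split.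
  have ui : u i0 ord0 != 0 by rewrite mxE.
  case: (unliftP ord0 i0) ui => [i ->|->] ui; apply/orP; [right|by left].
  by apply/existsP; exists i.
move=> j; have /matrixP/(_ j ord0) := Mu; rewrite !mxE big_ord_recl => Mj.
apply: etrans Mj; rewrite !mxE unlift_none mul1r; congr (_ + _); apply: eq_bigr => i _.
by rewrite [M _ _]mxE liftK.
Qed.

End Avoidance.

(** * Nerve maps and the lower bound on dimension *)

Section Dimension.
Variable R : realType.

Lemma affine_form_comb k a (b : 'I_k -> R) (I : finType) (w : I -> R) v :
  \sum_j w j = 1 ->
  affine_form a b (\sum_j w j *: v j) = \sum_j w j * affine_form a b (v j).
Proof.
move=> w1; rewrite /affine_form; under [RHS]eq_bigr => j _ do rewrite mulrDr.
rewrite big_split/= -mulr_suml w1 mul1r; congr (_ + _).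
under [RHS]eq_bigr => j _ do rewrite mulr_sumr.
rewrite [RHS]exchange_big/=; apply: eq_bigr => i _.
rewrite summxE mulr_suml; apply: eq_bigr => j _.
by rewrite mxE mulrA.
Qed.

Lemma sum_cvg (T : topologicalType) (x : T) (I : finType) (f : I -> T -> R^o) :
  (forall j, f j y @[y --> x] --> f j x) ->
  (\sum_j f j y : R^o) @[y --> x] --> (\sum_j f j x : R^o).
Proof.
move=> fx; elim: (index_enum I) => [|j s IH].
  by under eq_fun do rewrite big_nil; rewrite big_nil; exact: cvg_cst.
under eq_fun do rewrite big_cons; rewrite big_cons.
exact: cvgD.
Qed.

Lemma within_uniform (V W : normedModType R) (X : set V) (G : V -> W) e :
  compact X -> {within X, continuous G} -> 0 < e ->
  exists2 l, 0 < l &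
    forall c x y, X c -> X x -> X y -> `|c - x| < l -> `|c - y| < l -> `|G x - G y| < e.
Proof.
move=> cX /within_normP Gc e0.
pose Q (A : set V) := forall x y, (X `&` A) x -> (X `&` A) y -> `|G x - G y| < e.
have [||l l0 lQ] := @lebesgue_number _ _ X Q cX.
- move=> A B AB QB x y [Xx Ax] [Xy Ay].
  by apply: QB; split=> //; exact: AB.
- move=> x Xx; have [d d0 dG] := Gc x Xx _ (divr_gt0 e0 (ltr0n _ 2)); exists d => //.
  move=> y z [Xy]; rewrite -ball_normE /= => xy [Xz xz].
  have := ler_distD (G x) (G y) (G z); rewrite [`|G y - G x|]distrC.
  by have := dG y Xy xy; have := dG z Xz xz; lra.
exists l => // c x y Xc Xx Xy cx cy.
by apply: (lQ c Xc); split=> //; rewrite -ball_normE.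
Qed.

(* The map into the nerve of a cover of order at most [k] lands in finitely many
   affine spans of [k] points, hence misses points arbitrarily close to [c]. *)
Lemma avoid_point p k (X : set 'rV[R]_p) (G : 'rV[R]_p -> 'rV[R]_k) (e h : R) c :
  compact X -> ord_le R p X k -> {within X, continuous G} -> 0 < e -> 0 < h ->
  exists (g : 'rV[R]_p -> 'rV[R]_k) (c' : 'rV[R]_k),
    [/\ {within X, continuous g}, forall x, X x -> `|G x - g x| <= e,
    `|c - c'| < h & forall x, X x -> g x <> c'].
Proof.
move=> cX oX Gc e0 h0.
have [r r0 rG] := within_uniform cX Gc e0.
have [K [u [uX Xu]]] := finite_ball_cover cX r0.
have [||l [V [Vop VU XV Vord]]] := oX K (fun i => ball (u i) r).
- by move=> i; apply: ball_open.
- by move=> x /Xu[i xi]; exists i => //; rewrite -ball_normE.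
(* The vertex for [V j] is a value of [G] on it; it defaults to 0 when [V j] misses [X]. *)
have /choice[v vP] : forall j, exists v, forall x, X x -> V j x -> `|G x - v| <= e.
  move=> j; have [[y [Xy Vy]]|noy] := pselect (exists y, X y /\ V j y); last first.
    by exists 0 => x Xx Vx; exfalso; apply: noy; exists x.
  exists (G y) => x Xx Vx; have [i Vi] := VU j.
  by apply/ltW/(rG (u i)) => //; move: (Vi _ Vx) (Vi _ Vy); rewrite -ball_normE.
(* Distances to the complements; divided by their sum they form a partition of unity subordinate to
   [V]. *)
pose d j := dist1 (~` V j).
have d_gt0 j x : V j x -> 0 < d j x.
  by move=> Vx; apply: dist1_gt0; [rewrite closedC; exact: Vop|move/(_ Vx)].
have d_eq0 j x : ~ V j x -> d j x = 0 by move=> Vx; apply: dist1_eq0.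
pose S x := \sum_j d j x.
have S0 x : X x -> 0 < S x.
  move=> /XV[j _ Vj]; rewrite /S (bigD1 j)//= ltr_pwDl ?d_gt0//.
  by apply: sumr_ge0 => i _; exact: dist1_ge0.
pose w j x := d j x / S x.
have w1 x : X x -> \sum_j w j x = 1.
  by move=> /S0 Sx; rewrite -mulr_suml divff// gt_eqF.
have w0 j x : X x -> 0 <= w j x.
  by move=> /S0 Sx; rewrite divr_ge0 ?dist1_ge0// ltW.
pose g x := \sum_j w j x *: v j.
(* Every set of at most [k] vertices gets a form vanishing on it; larger sets get a dummy, which
   [ss] filters out. *)
have /choice[ab abP] : forall s : {set 'I_l}, exists ab : R * ('I_k -> R), (#|s| <= k)%N ->
    (ab.1 != 0) || [exists i, ab.2 i != 0] /\
    forall j, j \in s -> affine_form ab.1 ab.2 (v j) = 0.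
  move=> s; have [sk|_] := leqP #|s| k; last by exists (0, fun=> 0).
  have [a [b [ab0 abz]]] := common_affine_form (fun j : 'I_#|s| => v (enum_val j)) sk.
  exists (a, b) => _; split=> // j js.
  by have := abz (enum_rank_in js j); rewrite enum_rankK_in.
pose ss := [seq s : {set 'I_l} <- enum {set 'I_l} | (#|s| <= k)%N].
have [|c' [cc' [dd dd0 c'P]]] := @finite_union_nowhere_dense _ _ _
    (fun s => [set q | affine_form (ab s).1 (ab s).2 q = 0]) ss c h _ h0.
  by move=> s; rewrite mem_filter => /andP[sk _]; apply: affine_form_zeros; exact: (abP s sk).1.
exists g, c'; split=> //.
- apply: within_rowP => i; apply: continuous_in_subspaceT => x /set_mem Xx.
  rewrite (_ : (fun x => _) = (fun x => (\sum_j d j x * v j ord0 i) * (S x)^-1)); last first.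
    apply/funext => y; rewrite /g summxE mulr_suml; apply: eq_bigr => j _.
    by rewrite mxE mulrAC.
  have FF := nbhs_filter x.
  have dc j : d j y @[y --> x] --> (d j x : R^o) by exact: dist1_continuous.
  apply: (@cvgM _ _ _ FF); last first.
    apply: (@cvgV _ _ _ FF); last by apply: sum_cvg => j; exact: dc.
    by apply/eqP => Sx; have := S0 x Xx; rewrite Sx ltxx.
  apply: (sum_cvg (f := fun j y => d j y * v j ord0 i)) => j.
  by apply: (@cvgM _ _ _ FF); [exact: dc|apply: (@cvg_cst _ _ _ _ FF)].
- move=> x Xx; have -> : G x - g x = \sum_j w j x *: (G x - v j).
    under eq_bigr => j _ do rewrite scalerBr.
    by rewrite sumrB -scaler_suml w1// scale1r.
  apply: le_trans (ler_norm_sum _ _ _) _.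
  rewrite -[leRHS]mul1r -(w1 x Xx) mulr_suml; apply: ler_sum => j _.
  rewrite normrZ (ger0_norm (w0 j x Xx)).
  have [Vx|Vx] := pselect (V j x); first by rewrite ler_wpM2l ?w0// vP.
  by rewrite /w d_eq0// !mul0r.
(* The vertices with positive weight at [x] number at most [k] by the order of the cover, so [g x]
   is a zero of their form, while [c'] is a zero of none. *)
- move=> x Xx gx; pose s := [set j | d j x != 0]%SET.
  have sk : (#|s| <= k)%N.
    rewrite leqNgt; apply/negP => ks.
    apply: (Vord x Xx (fun t => enum_val (widen_ord ks t))).
      by move=> t t' /enum_val_inj /(congr1 val)/= /val_inj.
    move=> t; have := enum_valP (widen_ord ks t); rewrite inE => /eqP dx.
    by apply: contrapT => Vx; apply: dx; rewrite d_eq0.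
  have sss : s \in ss by rewrite mem_filter sk mem_enum.
  apply: (c'P s sss c'); first by rewrite subrr normr0.
  rewrite /= -gx affine_form_comb ?w1// big1// => j _.
  have [js|] := boolP (j \in s); first by rewrite (abP s sk).2 ?mulr0.
  by rewrite inE negbK /w => /eqP ->; rewrite !mul0r.
Qed.

(** Otherwise [avoid_point] moves the identity of the cube by at most [1/4] so as to miss a point
    within [1/8] of the centre. Since [1/4 + 1/8 < 1/2], the sign conditions of Poincare-Miranda
    survive around that point and it is hit after all. *)
Lemma not_ord_le_cube n p (X : set 'rV[R]_p) (i : 'rV[R]_n -> 'rV[R]_p)
    (pr : 'rV[R]_p -> 'rV[R]_n) :
  compact X -> continuous i -> continuous pr -> (forall x, pr (i x) = x) ->
  (forall x, cube R n x -> X (i x)) -> ~ ord_le R p X n.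
Proof.
move=> cX ic prc pri iX oX; pose c : 'rV[R]_n := const_mx (2^-1).
have [|||g [c' [gc gpr cc' gc']]] := @avoid_point _ _ X pr (4^-1) (8^-1) c cX oX.
- exact: continuous_subspaceT.
- by rewrite invr_gt0.
- by rewrite invr_gt0.
have c'P j : `|2^-1 - c' ord0 j| < 8^-1.
  by apply: le_lt_trans cc'; have := row_norm_coord (c - c') j; rewrite !mxE.
have Kcube x : `|c - x| <= 2^-1 <-> cube R n x.
  have h2 : 0 <= 2^-1 :> R by rewrite invr_ge0.
  apply: iff_trans (row_norm_leP _ h2) _; split=> h j.
    by have := h j; rewrite !mxE ler_norml; lra.
  by have := h j; rewrite !mxE ler_norml; lra.
have bd x j : `|c - x| <= 2^-1 -> `|x ord0 j - g (i x) ord0 j| <= 4^-1.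
  move=> /Kcube /iX Xx; apply: le_trans (gpr _ Xx).
  by have := row_norm_coord (pr (i x) - g (i x)) j; rewrite !mxE pri.
have [||||x /Kcube/iX Xx /eqP] := @poincare_miranda _ _ c (2^-1) (fun x => g (i x) - c').
- by rewrite invr_gt0.
- apply/within_normP => x /Kcube/iX Xx e e0.
  have /within_normP/(_ _ Xx e e0)[d d0 dg] := gc.
  have /continuous_normP/(_ x d d0)[d' d'0 d'i] := ic.
  exists d' => // y /Kcube/iX Xy /d'i xy.
  by rewrite opprB addrA subrK; exact: dg.
- move=> x j Kx xj; have := bd x j Kx; have := c'P j; rewrite !mxE xj mxE.
  by rewrite ltr_norml ler_norml; lra.
- move=> x j Kx xj; have := bd x j Kx; have := c'P j; rewrite !mxE xj mxE.
  by rewrite ltr_norml ler_norml; lra.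
by rewrite subr_eq0 => /eqP; exact: gc'.
Qed.

End Dimension.

(** * The upper bound on dimension for nowhere dense compacta *)

Section NowhereDense.
Variable R : realType.

Lemma open_forall_ord (V : normedModType R) m (A : 'I_m -> set V) :
  (forall i, open (A i)) -> open [set x | forall i, A i x].
Proof.
move=> Aop; apply/openE_norm => x Ax.
have /choice[d dP] : forall i, exists d, 0 < d /\ forall y, `|x - y| < d -> A i y.
  by move=> i; have /openE_norm/(_ x (Ax i))[d d0 dA] := Aop i; exists d.
exists (\big[Num.min/1]_i d i).
  by apply/bigmin_gtP; split=> // i _; exact: (dP i).1.
by move=> y /bigmin_gtP[_ xy] i; apply: (dP i).2; exact: xy.
Qed.

(** Otherwise, going down from [k = m] to [k = 0], the number of [i] with [d i <= r k] would always
    exceed [m - k], hence exceed [m] at the end. The level found is the dimension of the cell to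
    which a point is assigned. *)
Lemma level_exists m (d : 'I_m -> R) (r : nat -> R) : (forall k, r k.+1 < r k) ->
  exists k, [/\ (k <= m)%N, forall i, d i != r k &
    #|[set i | d i < r k]%SET| = (m - k)%N].
Proof.
move=> rdec; apply: contrapT => nok.
pose a k := [set i | d i < r k]%SET; pose b k := [set i | d i <= r k]%SET.
have ab k : (a k \subset b k)%SET by apply/fintype.subsetP => i; rewrite !inE => /ltW.
have step k : (k <= m)%N -> (m - k <= #|a k|)%N -> (m - k < #|b k|)%N.
  move=> km ak; rewrite ltnNge; apply/negP => bk; apply: nok.
  have abk : a k = b k by apply/eqP; rewrite eqEcard ab (leq_trans bk).
  exists k; split=> // [i|].
    apply/eqP => di; have : i \in b k by rewrite inE di.
    by rewrite -abk inE di ltxx.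
  by apply/eqP; rewrite eqn_leq ak andbT -/(a k) abk.
have bl e : (e <= m)%N -> (e < #|b (m - e)|)%N.
  elim: e => [_|e IH em].
    by have := step m (leqnn m); rewrite subnn subn0; apply.
  have {}IH := IH (ltnW em).
  have := step (m - e.+1)%N (leq_subr _ _); rewrite subKn//; apply.
  apply: leq_trans IH _; apply: subset_leq_card; apply/fintype.subsetP => i; rewrite !inE.
  by move=> /le_lt_trans; apply; rewrite -(subnSK em).
have := bl m (leqnn m); rewrite ltnNge => /negP; apply.
by rewrite -[X in (_ <= X)%N]card_ord max_card.
Qed.

Lemma closed_translate (V : normedModType R) (X : set V) a : closed X ->
  closed [set q | X (q + a)].
Proof.
move=> cX; rewrite -openC openE_norm => q /= Xq.
have [e e0 eX] := closed_norm_sep cX Xq; exists e => // y qy.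
by apply: eX; rewrite opprD addrACA subrr addr0.
Qed.

Lemma interior_translate (V : normedModType R) (X : set V) a : X° = set0 ->
  [set q | X (q + a)]° = set0.
Proof.
move=> X0; rewrite -subset0 => q /interior_normP[e e0 eX].
have : X° (q + a).
  apply/interior_normP; exists e => // y qy.
  rewrite -[y](subrK a); apply: eX; by rewrite opprB addrA.
by rewrite X0.
Qed.

(* The cells of the shifted grid of mesh [h], thickened with radii decreasing in the
   dimension of the cell, cover with one colour per dimension; the vertices of the
   grid can be moved away from [X], so that the colour [0] is not needed. *)
Lemma ord_le_nowhere_dense m (X : set 'rV[R]_m) :
  compact X -> X° = set0 -> ord_le R m X m.
Proof.
move=> cX X0 K U Uop XU.
have clX : closed X by apply: compact_closed => //; exact: norm_hausdorff.
have [||l l0 lU] := @lebesgue_number _ _ X (fun A => exists i, A `<=` U i) cX.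
- by move=> A B AB [i BU]; exists i; exact: subset_trans BU.
- move=> x /XU[i _ Ui]; have /openE_norm/(_ x Ui)[e e0 eU] := Uop i.
  by exists e => //; exists i => y; rewrite -ball_normE; exact: eU.
pose h := l / 2; have h0 : 0 < h by rewrite divr_gt0.
have [B XB] : exists B, forall x, X x -> `|x| <= B.
  have [M [_ XM]] := compact_bounded cX; exists (M + 1) => x Xx.
  by apply: XM Xx; rewrite ltrDl.
(* Enough steps of length [h] to cross the ball containing [X] from a corner outside it, with one
   spare for rounding up. *)
pose M := (Num.truncn ((2 * `|B| + 2) / h)).+2.
pose vtx (J : {ffun 'I_m -> 'I_M}) : 'rV[R]_m := \row_i (h * (J i)%:R).
(* Finitely many translates of [X] leave a gap, so the origin [v] can be placed with every grid
   vertex at distance at least [n] from [X]. *)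
have [|v [vB [n n0 vX]]] := @finite_union_nowhere_dense _ _ _
    (fun J => [set q | X (q + vtx J)]) (enum {ffun 'I_m -> 'I_M})
    (const_mx (- (`|B| + 1))) 1 _ ltr01.
  by move=> J _; split; [exact: closed_translate|exact: interior_translate].
(* The bound [1/2] keeps a thickened lattice coordinate from meeting the next one; [n / (2 * h)]
   keeps the thickened vertices off [X]. *)
pose r (k : nat) := Num.min (2^-1) (n / (2 * h)) / k.+1%:R.
have rmin0 : 0 < Num.min (2^-1) (n / (2 * h)) by rewrite lt_min invr_gt0 ltr0n divr_gt0// mulr_gt0.
have r0 k : 0 < r k by rewrite divr_gt0// ltr0n.
have rdec k : r k.+1 < r k by rewrite ltr_pM2l// ltf_pV2 ?posrE ?ltr0n// ltr_nat.
have rle k : r k <= Num.min (2^-1) (n / (2 * h)).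
  by rewrite ler_pdivrMr ?ltr0n// ler_peMr ?ler1n// ltW.
have r2 k : r k <= 2^-1 by apply: le_trans (rle k) _; rewrite ge_min lexx.
have rn k : r k * h < n.
  rewrite -ltr_pdivlMr//; apply: le_lt_trans (rle k) _.
  rewrite gt_min; apply/orP; right.
  by rewrite ltr_pM2l// ltf_pV2 ?posrE ?mulr_gt0//; lra.
pose Y (x : 'rV[R]_m) i := (x ord0 i - v ord0 i) / h.
have XY x i : X x -> 0 < Y x i < M.-1%:R.
  move=> Xx; have xB : `|x ord0 i| <= `|B|.
    apply: le_trans (row_norm_coord x i) _; apply: le_trans (XB x Xx) _.
    exact: ler_norm.
  have : `|- (`|B| + 1) - v ord0 i| < 1.
    apply: le_lt_trans vB; have := row_norm_coord (const_mx (- (`|B| + 1)) - v) i.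
    by rewrite !mxE.
  rewrite ltr_norml => /andP[v1 v2].
  move: xB; rewrite ler_norml => /andP[x1 x2].
  rewrite divr_gt0//=; last by lra.
  apply: lt_trans (truncnS_gt _); rewrite ltr_pM2r ?invr_gt0//; lra.
(* A code is a cell: [(true, a)] pins a coordinate at [a], [(false, a)] lets it run between [a] and
   [a + 1]. Thus [nf] is the dimension of the cell. *)
pose code := {ffun 'I_m -> bool * 'I_M}.
pose nf (c : code) := #|[set i | ~~ (c i).1]%SET|.
pose lo (c : code) i : R := (c i).2%:R + (if (c i).1 then - r (nf c) else r (nf c)).
pose hi (c : code) i : R := (c i).2%:R + (if (c i).1 then r (nf c) else 1 - r (nf c)).
pose W c := [set x | forall i, lo c i < Y x i < hi c i].
have Wop c : open (W c).
  apply: (open_forall_ord (A := fun i => [set x | lo c i < Y x i < hi c i])) => i.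
  apply/openE_norm => x /= /andP[x1 x2].
  exists (Num.min (Y x i - lo c i) (hi c i - Y x i) * h).
    by rewrite mulr_gt0// lt_min !subr_gt0 x1.
  move=> y; rewrite -ltr_pdivrMr// lt_min => xy.
  have : `|Y x i - Y y i| <= `|x - y| / h.
    rewrite /Y -mulrBl opprB addrA subrK normrM [`|h^-1|]gtr0_norm ?invr_gt0//.
    rewrite ler_pM2r ?invr_gt0//.
    by have := row_norm_coord (x - y) i; rewrite !mxE.
  by rewrite ler_norml; lra.
(* At a common radius no coordinate is both closer to an integer than the radius and farther from
   all integers, so two cells of equal dimension have the same free directions. *)
have Wdisj c c' x : nf c = nf c' -> W c x -> W c' x -> c = c'.
  move=> cc' Wx W'x.
  have nat_eq (a b : nat) : (a%:R < b%:R + 1 :> R) -> (b%:R < a%:R + 1 :> R) -> a = b.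
    by rewrite !natr1 !ltr_nat !ltnS => ab ba; apply/eqP; rewrite eqn_leq ab.
  have fx i : (c i).1 = (c' i).1.
    have sub c1 c2 : nf c1 = nf c2 -> W c1 x -> W c2 x ->
       ([set i | ~~ (c1 i).1] \subset [set i | ~~ (c2 i).1])%SET.
      move=> c12 W1 W2; apply/fintype.subsetP => j; rewrite !inE => c1j.
      apply/negP => c2j; have := W1 j; have := W2 j.
      rewrite /lo /hi c2j (negPf c1j) c12; set s := r _; set a := (c2 j).2; set b := (c1 j).2.
      move=> /andP[y1 y2] /andP[y3 y4].
      have ab : (a%:R < b%:R + 1 :> R) by lra.
      have ba : (b%:R < a%:R :> R) by lra.
      by move: ab ba; rewrite natr1 !ltr_nat ltnS leqNgt => /negP.
    have /setP/(_ i) : [set i | ~~ (c i).1]%SET = [set i | ~~ (c' i).1]%SET.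
      by apply/eqP; rewrite finset.eqEsubset (sub c c')// (sub c' c).
    by rewrite !inE; exact: negb_inj.
  apply/ffunP => i; have := Wx i; have := W'x i; rewrite /lo /hi cc' (fx i).
  have := r2 (nf c'); have := r0 (nf c').
  move: (fx i); case: (c i) (c' i) => [b j] [b' j'] /= ->.
  set s := r _ => s0 s2 y1 y2; congr (_, _); apply/val_inj/nat_eq; by case: (b') y1 y2; lra.
have Wcover x : X x -> exists2 c, W c x & (0 < nf c)%N.
  move=> Xx; pose f i := Num.truncn (Y x i).
  have fY i : (f i)%:R <= Y x i < (f i).+1%:R.
    by apply: truncn_itv; have /andP[/ltW] := XY x i Xx.
  have fM i : ((f i).+1 < M)%N.
    have /andP[_ YM] := XY x i Xx; have /andP[fY1 _] := fY i.
    by have := le_lt_trans fY1 YM; rewrite ltr_nat.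
  pose up i := Y x i - (f i)%:R > 2^-1.
  pose near i : 'I_M := if up i then Ordinal (fM i) else Ordinal (ltnW (fM i)).
  pose d i := `|Y x i - (near i)%:R|.
  (* Exactly [m - k] coordinates are closer than [r k] to their nearest integer, and the other [k]
     are strictly farther. *)
  have [k [km dk ck]] := level_exists d rdec.
  pose c : code := [ffun i => if d i < r k then (true, near i) else (false, Ordinal (ltnW (fM i)))].
  have nfc : nf c = k.
    have -> : nf c = #|~: [set i | d i < r k]%SET|.
      by apply: eq_card => i; rewrite !inE ffunE; case: (d i < r k).
    by rewrite cardsCs finset.setCK card_ord ck subKn.
  exists c => [i|].
    rewrite /lo /hi ffunE nfc; case: ifPn => /=.
      by rewrite /d ltr_norml; lra.
    rewrite -leNgt le_eqVlt eq_sym (negPf (dk i)) /= /d /near /up.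
    have := fY i; have := r2 k; rewrite -[(f i).+1%:R]natr1.
    case: ifPn => /= [u rk /andP[f1 f2]|].
      by rewrite -[(f i).+1%:R]natr1 ler0_norm; lra.
    by rewrite -leNgt => u rk /andP[f1 f2]; rewrite ger0_norm; lra.
  (* Colour 0 would put the point [x] of [X] within [n] of a grid vertex, against the choice of
     [v]. *)
  rewrite nfc lt0n; apply/negP => /eqP k0.
  have alln i : d i < r k.
    have : [set i | d i < r k]%SET = [set: 'I_m]%SET.
      by apply/eqP; rewrite eqEcard finset.subsetT cardsT card_ord ck k0 subn0/=.
    by move/setP/(_ i); rewrite !inE.
  pose J := [ffun i => near i].
  have Xv : [set q | X (q + vtx J)] (x - vtx J) by rewrite /= subrK.
  apply: (vX J _ _ _ Xv); first by rewrite mem_enum.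
  apply/row_norm_ltP => // i; rewrite !mxE ffunE.
  apply: le_lt_trans (rn k); rewrite -ler_pdivrMr//.
  rewrite -[X in _ / X](gtr0_norm h0) -normf_div; apply: ltW.
  apply: le_lt_trans (alln i); rewrite /d /Y -normrN le_eqVlt; apply/orP; left.
  apply/eqP; congr (`|_|); field; exact: lt0r_neq0.
pose cs := [seq c <- enum {: code} | (0 < nf c)%N && `[< (W c `&` X) !=set0 >]].
exists (size cs), (fun j => W (tnth (in_tuple cs) j)); split => //.
- move=> j; have := mem_tnth j (in_tuple cs).
  rewrite mem_filter => /andP[/andP[_ /asboolP[x [Wx Xx]]] _].
  have [i Ui] := lU x Xx; exists i => y Wy; apply: Ui; rewrite -ball_normE /=.
  apply: (@le_lt_trans _ _ h); last by rewrite ltr_pdivrMr//; lra.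
  apply/row_norm_leP => [|t]; first exact: ltW.
  have := Wx t; have := Wy t; rewrite /lo /hi; set c := tnth _ _.
  have := r2 (nf c); have := r0 (nf c); set s := r _ => s0 s2.
  rewrite !mxE /Y => y1 x1.
  have : `|(x ord0 t - v ord0 t) / h - (y ord0 t - v ord0 t) / h| <= 1.
    by rewrite ler_norml; case: ((c t).1) y1 x1; lra.
  rewrite -mulrBl opprB addrA subrK normrM [`|h^-1|]gtr0_norm ?invr_gt0//.
  by rewrite ler_pdivrMr// mul1r.
- move=> x Xx; have [c Wc nfc] := Wcover x Xx.
  have : c \in cs.
    by rewrite mem_filter nfc mem_enum andbT; apply/asboolP; exists x.
  by move=> /(tnthP (in_tuple cs))[j cj]; exists j => //; rewrite -cj.
- move=> x Xx s sinj sW.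
  have nfs t : (0 < nf (tnth (in_tuple cs) (s t)) <= m)%N.
    have := mem_tnth (s t) (in_tuple cs); rewrite mem_filter => /andP[/andP[-> _] _] /=.
    by rewrite -[X in (_ <= X)%N]card_ord max_card.
  (* The colours [1] to [m] are shifted to ['I_m]: among [m + 1] members two share a colour, and
     [Wdisj] identifies them. *)
  have nfm t : ((nf (tnth (in_tuple cs) (s t))).-1 < m)%N.
    by have /andP[/prednK -> ->] := nfs t.
  pose col t := Ordinal (nfm t).
  have /injectivePn[t [t' tt' ctt']] : ~~ injectiveb col.
    by apply/negP => /injectiveP/leq_card; rewrite !card_ord ltnn.
  have ucs : uniq cs by rewrite filter_uniq// enum_uniq.
  have : tnth (in_tuple cs) (s t) = tnth (in_tuple cs) (s t').
    apply: (Wdisj _ _ x) => //; move/(congr1 val): ctt' => /= E.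
    have /andP[/prednK <- _] := nfs t; have /andP[/prednK <- _] := nfs t'.
    by rewrite E.
  have /tuple_uniqP tinj : uniq (in_tuple cs) by [].
  move/tinj/sinj => E; by rewrite E eqxx in tt'.
Qed.

End NowhereDense.

(** * Invariance of domain *)

Section InvarianceOfDomain.
Variable R : realType.

(** Coordinatewise Tietze extension; the sup norm preserves the bound [M]. *)
Lemma tietze_row (V : normedModType R) n (X : set V) (f : V -> 'rV[R]_n) M :
  closed X -> 0 < M -> {within X, continuous f} -> (forall x, X x -> `|f x| <= M) ->
  exists E : V -> 'rV[R]_n, [/\ continuous E, forall x, X x -> E x = f x &
    forall x, `|E x| <= M].
Proof.
move=> clX M0 fc fM.
have /choice[e eP] : forall i, exists e : V -> R^o, [/\ continuous e,
    forall x, X x -> e x = f x ord0 i & forall x, `|e x| <= M].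
  move=> i; have fic : {within X, continuous (fun x => f x ord0 i : R^o)}.
    apply/within_normP => x Xx d d0; have /within_normP/(_ x Xx d d0)[d' d'0 df] := fc.
    exists d' => // y Xy /(df y Xy); apply: le_lt_trans.
    by have := row_norm_coord (f x - f y) i; rewrite !mxE.
  have [||x Xx|e [e1 e2 e3]] := continuous_bounded_extension _ _ M0 fic.
  - exact: pseudometric_normal.
  - exact: clX.
  - by apply: le_trans (fM x Xx); exact: row_norm_coord.
  by exists e; split=> // x Xx; rewrite -(e1 x)// inE.
exists (fun x => \row_i e i x); split.
- apply/continuous_subspace_setT/within_rowP => i; apply: continuous_subspaceT.
  rewrite (_ : (fun x => _) = e i); first by have [] := eP i.
  by apply/funext => x; rewrite mxE.
- by move=> x Xx; apply/rowP => i; rewrite mxE; have [_ -> //] := eP i.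
- by move=> x; apply/row_norm_leP => [|i]; [exact: ltW|rewrite mxE; have [_ _] := eP i].
Qed.

Lemma row_compact_closed n (X : set 'rV[R]_n) : compact X -> closed X.
Proof. by apply: compact_closed; exact: norm_hausdorff. Qed.

Lemma closed_ball_compl n (c : 'rV[R]_n) s : closed [set z | s <= `|c - z|].
Proof.
rewrite -openC openE_norm => z /= /negP; rewrite -ltNge => zs.
exists (s - `|c - z|) => [|w zw]; first by rewrite subr_gt0.
by apply/negP; rewrite -ltNge; have := ler_distD z c w; lra.
Qed.

Lemma compact_sphere n (c : 'rV[R]_n) s : compact [set z | `|c - z| = s].
Proof.
rewrite (_ : mkset _ = [set z | s <= `|c - z|] `&` [set z | `|c - z| <= s]).
  rewrite setIC; apply: compact_closedI; first exact: compact_cball.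
  exact: closed_ball_compl.
apply/seteqP; split=> z /=; first by move=> ->.
by move=> [? ?]; apply/eqP; rewrite eq_le; apply/andP.
Qed.

Lemma sphere_nowhere_dense n (c : 'rV[R]_n) s : 0 < s ->
  [set z | `|c - z| = s]° = set0.
Proof.
move=> s0; rewrite -subset0 => z /interior_normP[e e0 es].
have cz : `|c - z| = s by apply: es; rewrite subrr normr0.
pose t := e / (2 * s); have t0 : 0 < t by rewrite divr_gt0// mulr_gt0.
have : `|c - (z + t *: (z - c))| = s.
  apply: es; rewrite opprD addNKr normrN normrZ distrC cz gtr0_norm//.
  by rewrite /t invfM mulrA mulfVK ?gt_eqF// ltr_pdivrMr//; lra.
rewrite opprD addrA -[c - z]opprB -opprD -[X in X + _]scale1r -scalerDl.
by rewrite normrN normrZ distrC cz gtr0_norm ?addr_gt0// => E; nra.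
Qed.

(** Radial projection from [c] of the punctured ball onto its sphere, the identity outside;
    continuous away from [c]. *)
Definition push n (c : 'rV[R]_n) s z : 'rV[R]_n :=
  c + Num.max 1 (s / `|c - z|) *: (z - c).

Lemma push_out n (c : 'rV[R]_n) s z : 0 < s -> s <= `|c - z| -> push c s z = z.
Proof.
move=> s0 sz; rewrite /push max_l ?scale1r ?subrKC//.
by rewrite ler_pdivrMr ?mul1r// (lt_le_trans s0).
Qed.

Lemma push_in n (c : 'rV[R]_n) s z : 0 < s -> z <> c -> `|c - z| <= s ->
  `|c - push c s z| = s.
Proof.
move=> s0 zc zs; have cz0 : 0 < `|c - z|.
  by rewrite normr_gt0 subr_eq0; apply/eqP => E; apply: zc.
rewrite /push opprD addNKr normrN normrZ [`|z - c|]distrC max_r ?ler_pdivlMr ?mul1r//.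
by rewrite [`|s / _|]gtr0_norm ?divr_gt0// mulfVK// gt_eqF.
Qed.

Lemma push_continuous n (c : 'rV[R]_n) s z : z <> c -> {for z, continuous (push c s)}.
Proof.
move=> zc; have FF := nbhs_filter z.
have cz : `|c - w| @[w --> z] --> `|c - z|.
  apply: (@cvg_norm _ _ _ _ FF).
  by apply: (@cvgB _ _ _ _ FF); [exact: (@cvg_cst _ _ _ _ FF)|exact: cvg_id].
have scz : (s / `|c - w|) @[w --> z] --> (s / `|c - z|).
  apply: (@cvgM _ _ _ FF); first exact: (@cvg_cst _ _ _ _ FF).
  apply: (@cvgV _ _ _ FF) => //.
  by rewrite normr_eq0 subr_eq0; apply/eqP => E; apply: zc.
have mz : Num.max 1 (s / `|c - w|) @[w --> z] --> Num.max 1 (s / `|c - z|).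
  rewrite maxr_absE; under eq_fun do rewrite maxr_absE.
  apply: (@cvgM _ _ _ FF); last exact: (@cvg_cst _ _ _ _ FF).
  apply: (@cvgD _ _ _ _ FF).
    by apply: (@cvgD _ _ _ _ FF); [exact: (@cvg_cst _ _ _ _ FF)|].
  apply: (@cvg_norm _ _ _ _ FF).
  by apply: (@cvgB _ _ _ _ FF); [exact: (@cvg_cst _ _ _ _ FF)|].
apply: (@cvgD _ _ _ _ FF); first exact: (@cvg_cst _ _ _ _ FF).
apply: (@cvgZ _ _ _ _ FF) => //.
by apply: (@cvgB _ _ _ _ FF); [exact: cvg_id|exact: (@cvg_cst _ _ _ _ FF)].
Qed.

(* If [f x] were a boundary point, some [c] outside [L] would be close to it, and [f]
   could be pushed out of a small cube around [c] into its boundary, which has dimension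
   less than [n]; a map there can avoid [x], contradicting Poincare-Miranda around [x]. *)
Theorem homeo_interior n (K L : set 'rV[R]_n) (f g : 'rV[R]_n -> 'rV[R]_n) x :
  compact K -> compact L -> {within K, continuous f} -> {within L, continuous g} ->
  (forall z, K z -> L (f z)) -> (forall z, K z -> g (f z) = z) ->
  K° x -> L° (f x).
Proof.
move=> cK cL fc gc fL gf Kx; apply: contrapT => Lfx.
have [r r0 rK] : exists2 r, 0 < r & forall y, `|x - y| <= r -> K y.
  have /interior_normP[e e0 eK] := Kx; exists (e / 2); first by rewrite divr_gt0.
  move=> y xy; apply: eK; apply: le_lt_trans xy _.
  by rewrite ltr_pdivrMr//; lra.
pose Q := [set y | `|x - y| <= r].
have cQ : compact Q by exact: compact_cball.
have QK : Q `<=` K by move=> y /rK.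
have Kxx : K x by apply: interior_subset.
have fQ : {within Q, continuous f} by exact: continuous_subspaceW QK fc.
pose P := [set y | `|x - y| = r].
have cP : compact P := compact_sphere (c := x) (s := r).
have PQ : P `<=` Q by move=> y; rewrite /P /Q /= => ->.
have [e1 e10 e1P] : exists2 e, 0 < e & forall y, P y -> e <= `|f x - f y|.
  have cfP : closed (f @` P).
    apply: row_compact_closed; apply: continuous_compact => //.
    exact: continuous_subspaceW PQ fQ.
  have [|e e0 eP] := closed_norm_sep cfP (x := f x).
    move=> [y Py fyx]; have := gf y (QK _ (PQ _ Py)); rewrite fyx gf// => yx.
    by move: Py r0; rewrite /P /= -yx subrr normr0 => <-; rewrite ltxx.
  exists e => // y Py; rewrite leNgt; apply/negP => /eP; apply.
  by exists y.
have [c Lc xc] : exists2 c, ~ L c & `|f x - c| < e1 / 2.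
  apply: contrapT => h; apply: Lfx; apply/interior_normP; exists (e1 / 2).
    by rewrite divr_gt0.
  by move=> y xy; apply: contrapT => Ly; apply: h; exists y.
pose s := e1 / 2; have s0 : 0 < s by rewrite divr_gt0.
have Ps y : P y -> s <= `|c - f y|.
  by move=> /e1P; have := ler_distD c (f x) (f y); rewrite /s; lra.
(* The part of the image that [push] leaves fixed. It misses [f x], so [g] keeps it at a distance
   [e2] from [x]. *)
pose A := [set z | s <= `|c - z|] `&` (f @` Q).
have cfQ : compact (f @` Q) by exact: continuous_compact.
have fQL : f @` Q `<=` L by move=> _ [y /QK Ky <-]; exact: fL.
have clA : closed [set z | s <= `|c - z|] := closed_ball_compl (c := c) (s := s).
have cA : compact A by rewrite /A setIC; exact: compact_closedI.
have gA : {within A, continuous g}.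
  by apply: continuous_subspaceW gc => z [_ /fQL].
have [e2 e20 e2A] : exists2 e, 0 < e & forall z, A z -> e <= `|x - g z|.
  have cgA : closed (g @` A).
    by apply: row_compact_closed; apply: continuous_compact.
  have [|e e0 eA] := closed_norm_sep cgA (x := x).
    move=> [z [sz [y Qy yz]] gzx].
    have := gf y (QK _ Qy); rewrite yz gzx => xy.
    by move: sz; rewrite /= -yz -xy distrC leNgt => /negP; apply.
  by exists e => // z Az; rewrite leNgt; apply/negP => /eA; apply; exists z.
have [M [M0 gM]] : exists M, 0 < M /\ forall z, L z -> `|g z| <= M.
  have /compact_bounded[M [_ MgL]] : compact (g @` L) by exact: continuous_compact.
  exists (`|M| + 1); split; first by rewrite ltr_wpDl.
  move=> z Lz; apply: (MgL (`|M| + 1)); last by exists z.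
  by apply: le_lt_trans (ler_norm M) _; rewrite ltrDl.
(* Pushed points may leave [L], so [g] has to be defined on the whole space. *)
have [G [Gc GL _]] := tietze_row (row_compact_closed cL) M0 gc gM.
pose S := [set z | `|c - z| = s].
(* The bound [e2 / 4] excludes a zero over [A], and [r / 4] preserves the signs on the boundary of
   [Q]. *)
pose e := Num.min (e2 / 4) (r / 4).
have e0 : 0 < e by rewrite lt_min !divr_gt0.
have cS : compact S := compact_sphere (c := c) (s := s).
have clS := row_compact_closed cS.
have [|||g1 [x' [g1c g1G xx' g1x']]] := @avoid_point _ _ _ S G e e x cS
    (ord_le_nowhere_dense cS (sphere_nowhere_dense c s0)) => //.
  exact: continuous_subspaceT.
(* The correction from [G] to [g1] on the sphere is extended to the whole space at the same size. *)
have [E [Ec ES Ee]] : exists E : 'rV[R]_n -> 'rV[R]_n, [/\ continuous E,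
    forall z, S z -> E z = g1 z - G z & forall z, `|E z| <= e].
  apply: tietze_row => //; last by move=> z /g1G; rewrite distrC.
  move=> z; apply: cvgB; first exact: g1c.
  exact: (continuous_subspaceT Gc).
pose F y := G (push c s (f y)) + E (push c s (f y)) - x'.
have fyc y : Q y -> f y <> c by move=> /QK/fL Lfy E1; apply: Lc; rewrite -E1.
have FP y : P y -> `|F y - (y - x)| <= r / 2.
  move=> Py; rewrite /F push_out//; last exact: Ps.
  rewrite GL ?gf//; last 2 first.
  - exact/QK/PQ.
  - exact/fL/QK/PQ.
  have -> : y + E (f y) - x' - (y - x) = E (f y) + (x - x').
    by apply/rowP => j; rewrite !mxE; ring.
  apply: le_trans (ler_normD _ _) _; have := Ee (f y).
  have : e <= r / 4 by rewrite ge_min lexx orbT.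
  lra.
have PQr y i (sg : R) : `|sg| = 1 -> Q y -> y ord0 i = x ord0 i + sg * r -> P y.
  move=> sg1 Qy yi; apply/eqP; rewrite eq_le Qy /=.
  have := row_norm_coord (x - y) i; rewrite !mxE yi opprD addrA subrr add0r normrN.
  by rewrite normrM sg1 mul1r gtr0_norm.
have [|||y Qy /eqP] := @poincare_miranda _ _ x r F r0.
- move=> y; apply: cvgB; last exact: cvg_cst.
  have pc : {within Q, continuous (push c s \o f)}.
    apply/within_normP => z Qz d d0.
    have [d1 d10 pd1] : exists2 d1, 0 < d1 & forall w, `|f z - w| < d1 ->
        `|push c s (f z) - push c s w| < d.
      have /cvgrPdist_lt/(_ d d0)/nbhs_ballP[d1 d10 pd1] := push_continuous (s := s) (fyc z Qz).
      by exists d1 => // w zw; apply: pd1; rewrite -ball_normE.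
    have /within_normP/(_ z Qz d1 d10)[d2 d20 fd2] := fQ.
    by exists d2 => // w Qw /(fd2 w Qw); exact: pd1.
  apply: cvgD.
    apply: (@continuous_comp _ _ _ (push c s \o f : subspace Q -> _) G); last exact: Gc.
    exact: pc.
  apply: (@continuous_comp _ _ _ (push c s \o f : subspace Q -> _) E); last exact: Ec.
  exact: pc.
- move=> y i Qy yi; have Py : P y.
    by apply: (PQr y i (- 1)) => //; rewrite ?normrN ?normr1// yi mulN1r.
  have := FP y Py; have := row_norm_coord (F y - (y - x)) i.
  rewrite !mxE yi => h1 h2; have := le_trans h1 h2.
  rewrite ler_norml; lra.
- move=> y i Qy yi; have Py : P y.
    by apply: (PQr y i 1) => //; rewrite ?normr1// yi mul1r.
  have := FP y Py; have := row_norm_coord (F y - (y - x)) i.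
  rewrite !mxE yi => h1 h2; have := le_trans h1 h2.
  rewrite ler_norml; lra.
rewrite subr_eq0 => /eqP; have [sy|/ltW ys] := leP s `|c - f y|; last first.
  have Sy : S (push c s (f y)) by apply: push_in => //; exact: fyc.
  by rewrite ES// subrKC; exact: g1x'.
have Ay : A (f y) by split=> //; exists y.
rewrite push_out// => GE; have := e2A _ Ay.
have e24 : e <= e2 / 4 by rewrite ge_min lexx.
have := Ee (f y); rewrite (_ : x - g (f y) = (x - x') + E (f y)); last first.
  rewrite -GE GL; last exact/fL/QK.
  by rewrite opprD addrA subrK.
by have := ler_normD (x - x') (E (f y)); lra.
Qed.

End InvarianceOfDomain.

(** * Extending homeomorphisms to the satellites *)

Section Matching.

(** The usual proof, recording that every pair [(k, s k)] comes from [u] or from [v], so that a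
    relation holding along both injections passes to the bijection. *)
Lemma nat_schroeder_bernstein (u v : nat -> nat) : injective u -> injective v ->
  exists s t : nat -> nat, [/\ cancel s t, cancel t s &
    forall k, s k = u k \/ v (s k) = k].
Proof.
move=> uI vI.
(* Points whose backward chain stops outside the range of [v]; on them [u] is used, elsewhere the
   inverse of [v]. *)
pose A k := exists i x, k = iter i (v \o u) x /\ forall j, v j <> x.
have Avu k : A k -> A (v (u k)).
  by move=> [i [x [-> xv]]]; exists i.+1, x.
have nA k : ~ A k -> exists j, v j = k.
  move=> Ak; apply: contrapT => h; apply: Ak; exists 0%N, k; split=> // j vj.
  by apply: h; exists j.
have /choice[s sP] : forall k, exists j, (A k /\ j = u k) \/ (~ A k /\ v j = k).
  move=> k; have [Ak|Ak] := pselect (A k); first by exists (u k); left.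
  by have [j vj] := nA k Ak; exists j; right.
have sI : injective s.
  move=> k k' E; have := sP k; have := sP k'; rewrite -E => - [[Ak' e']|[Ak' e']] [[Ak e]|[Ak e]].
  - by apply: uI; rewrite -e -e'.
  - by exfalso; apply: Ak; rewrite -e e'; exact: Avu.
  - by exfalso; apply: Ak'; rewrite -e' e; exact: Avu.
  - by rewrite -e -e'.
have /choice[t tP] : forall j, exists k, s k = j.
  move=> j; have [[[|i] [x [vj xv]]]|Aj] := pselect (A (v j)).
  - by exfalso; apply: (xv j).
  - exists (iter i (v \o u) x).
    have [[_ ->]|[h _]] := sP (iter i (v \o u) x); first by apply: vI; rewrite vj.
    by exfalso; apply: h; exists i, x.
  - by exists (v j); have [[]//|[_ /vI]] := sP (v j).
exists s, t; split=> // [k|k]; first by apply: sI; rewrite tP.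
by have [[_ ->]|[_ e]] := sP k; [left|right].
Qed.

Lemma increasing_choice (P : nat -> nat -> Prop) :
  (forall k N, exists2 j, (N <= j)%N & P k j) ->
  exists u : nat -> nat, injective u /\ forall k, P k (u k).
Proof.
move=> h; have /choice[F FP] : forall kN : nat * nat, exists j, (kN.2 <= j)%N /\ P kN.1 j.
  by move=> [k N]; have [j] := h k N; exists j.
pose u := fix u k := if k is k'.+1 then F (k, (u k').+1) else F (0%N, 0%N).
exists u; split; last by case=> [|k]; [have [] := FP (0%N, 0%N)|have [] := FP (k.+1, (u k).+1)].
have uS k : (u k < u k.+1)%N by have [] := FP (k.+1, (u k).+1).
have uh : {homo u : i j / (i < j)%N}.
  by apply: (homo_ltn (r := fun a b => (a < b)%N)) => // y x z; exact: ltn_trans.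
move=> i j E; have [/uh|/uh|//] := ltngtP i j; by rewrite E ltnn.
Qed.

Lemma injective_eventually_ge (s : nat -> nat) N : injective s ->
  exists M, forall k, (M <= k)%N -> (N <= s k)%N.
Proof.
move=> sI; elim: N => [|N [M MP]]; first by exists 0%N.
have [[k0 k0N]|no] := pselect (exists k, s k = N); last first.
  exists M => k /MP; rewrite leq_eqVlt => /predU1P[E|//].
  by exfalso; apply: no; exists k.
exists (maxn M k0.+1) => k; rewrite geq_max => /andP[/MP + kk0].
rewrite leq_eqVlt => /predU1P[E|//]; move: kk0; rewrite (sI k0 k) ?ltnn//.
by rewrite k0N.
Qed.

(** Here [C N] is closeness to precision [N]. Both injections are chosen with their own argument as
    precision. A bijection of the naturals leaves every finite set, so late pairs are precise
    whichever injection they come from. *)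
Lemma matching (C : nat -> nat -> nat -> Prop) :
  (forall N N' k j, (N <= N')%N -> C N' k j -> C N k j) ->
  (forall k N, exists2 j, (N <= j)%N & C N k j) ->
  (forall j N, exists2 k, (N <= k)%N & C N k j) ->
  exists s t : nat -> nat, [/\ cancel s t, cancel t s &
    forall N, exists M, forall k, (M <= k)%N -> C N k (s k)].
Proof.
move=> Cm C1 C2.
have [k N|u [uI uC]] := @increasing_choice (fun k j => C k k j).
  have [j] := C1 k (maxn k N); rewrite geq_max => /andP[_ Nj] Cj; exists j => //.
  by apply: Cm Cj; rewrite leq_maxl.
have [j N|v [vI vC]] := @increasing_choice (fun j k => C j k j).
  have [k] := C2 j (maxn j N); rewrite geq_max => /andP[_ Nj] Ck; exists k => //.
  by apply: Cm Ck; rewrite leq_maxl.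
have [s [t [st ts suv]]] := nat_schroeder_bernstein uI vI.
exists s, t; split=> // N.
have [M MP] := injective_eventually_ge N (can_inj st).
exists (maxn M N) => k; rewrite geq_max => /andP[/MP Nsk Nk].
have [E|E] := suv k; first by rewrite E; exact: Cm (uC k).
by apply: Cm Nsk _; rewrite -{2}E; exact: vC.
Qed.

End Matching.

(** * The discrete set around a compact set *)

Section Satellites.
Variables (R : realType) (n : nat).
Notation V := ('rV[R]_n).
Implicit Types (K L : set V) (x y z p q : V) (e : R).

Definition bnd K : set V := K `\` K°.

Definition grid (m : nat) : set V := [set z | exists J : {ffun 'I_n -> 'I_m.+2},
  z = \row_i ((J i)%:R / m.+1%:R)].

(* A discrete set clustering exactly at [bnd K]. *)
Definition satellites K : set V := [set z | ~ K z /\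
  exists m, grid m z /\ exists x, K x /\ `|x - z| < 5 / m.+1%:R].

(* Leaves room inside the unit cube for the satellites. *)
Definition middle K := forall x, K x -> forall i, 3^-1 <= x ord0 i <= 2 / 3.

(** [t] is the supremum of the times up to which the segment has stayed in [K]. The last clause
    serves connectedness: it joins [p] to [bnd K] inside [K]. *)
Lemma exit_point K p q : closed K -> K p -> ~ K q ->
  exists t, [/\ 0 <= t <= 1, bnd K (p + t *: (q - p)) &
    forall s, 0 <= s <= t -> K (p + s *: (q - p))].
Proof.
move=> cK Kp Kq; pose c s := p + s *: (q - p).
have c_dist s t : `|c s - c t| = `|s - t| * `|q - p|.
  by rewrite /c opprD addrACA subrr add0r -scalerBl normrZ.
pose E := [set t | 0 <= t <= 1 /\ forall s, 0 <= s <= t -> K (c s)].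
have E0 : E 0.
  split; first by rewrite lexx ler01.
  by move=> s s0; rewrite /c (_ : s = 0) ?scale0r ?addr0//; lra.
have E1 : ubound E 1 by move=> t [/andP[]].
have supE : has_sup E by split; [exists 0|exists 1].
pose t := sup E.
have t0 : 0 <= t by apply: ub_le_sup => //; exists 1.
have t1 : t <= 1 by apply: ge_sup => //; exists 0.
have qp0 : 0 < `|q - p| by rewrite normr_gt0 subr_eq0; apply/eqP => E2; apply: Kq; rewrite E2.
have below s : 0 <= s -> s < t -> K (c s).
  move=> s0 st; have [u [_ Eu] su] := sup_gt (ex_intro _ 0 E0) st.
  by apply: Eu; rewrite s0/= ltW.
have Kt : K (c t).
  apply: contrapT => Kct; have [e e0 eK] := closed_norm_sep cK Kct.
  have [t00|tn0] := eqVneq t 0.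
    by apply: Kct; rewrite /c t00 scale0r addr0.
  have tgt0 : 0 < t by rewrite lt_neqAle eq_sym tn0.
  pose s := Num.max 0 (t - e / (2 * `|q - p|)).
  have d0 : 0 < e / (2 * `|q - p|) by rewrite divr_gt0// mulr_gt0.
  have s0 : 0 <= s by rewrite le_max lexx.
  have st : s < t by rewrite gt_max tgt0/=; lra.
  apply: (eK (c s)); last exact: below.
  rewrite c_dist gtr0_norm ?subr_gt0//.
  have : t - s <= e / (2 * `|q - p|).
    have : t - e / (2 * `|q - p|) <= s by rewrite le_max lexx orbT.
    lra.
  rewrite -(ler_pM2r qp0) invfM mulrA mulfVK ?gt_eqF//; lra.
exists t; rewrite t0 t1; split=> //; last first.
  move=> s /andP[s0]; rewrite le_eqVlt => /predU1P[->//|]; exact: below.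
split=> //; rewrite interior_normP => - [e e0 eK].
have t_lt1 : t < 1.
  rewrite lt_neqAle t1 andbT; apply/eqP => t1E; apply: Kq.
  by move: Kt; rewrite /c t1E scale1r subrKC.
pose d := Num.min (1 - t) (e / (2 * `|q - p|)).
have d0 : 0 < d by rewrite lt_min subr_gt0 t_lt1 divr_gt0// mulr_gt0.
have d1 : d <= 1 - t by rewrite ge_min lexx.
have de : d * `|q - p| < e.
  have : d <= e / (2 * `|q - p|) by rewrite ge_min lexx orbT.
  rewrite -(ler_pM2r qp0) invfM mulrA mulfVK ?gt_eqF//; lra.
have : t + d <= t.
  apply: ub_le_sup; first by exists 1.
  split; first by apply/andP; split; lra.
  move=> s /andP[s0 std]; have [st|ts] := ltP s t; first exact: below.
  apply: eK; rewrite c_dist distrC ger0_norm ?subr_ge0//.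
  by apply: le_lt_trans de; rewrite ler_pM2r//; lra.
lra.
Qed.

Lemma bnd_near K p q : closed K -> K p -> ~ K q ->
  exists2 b, bnd K b & `|b - q| <= `|p - q|.
Proof.
move=> cK Kp Kq; have [t [/andP[t0 t1] bt _]] := exit_point cK Kp Kq.
exists (p + t *: (q - p)) => //.
rewrite (_ : _ - q = (1 - t) *: (p - q)); last first.
  by apply/rowP => i; rewrite !mxE; ring.
by rewrite normrZ ler_piMl// ger0_norm; lra.
Qed.

Lemma satellite_near K d : closed K -> satellites K d ->
  exists p m, [/\ bnd K p, `|p - d| < 5 / m.+1%:R & grid m d].
Proof.
move=> cK [Kd [m [gd [x [Kx xd]]]]]; have [p bp pd] := bnd_near cK Kx Kd.
by exists p, m; split=> //; exact: le_lt_trans xd.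
Qed.

Lemma finite_grid m : finite_set (grid m).
Proof.
apply: (@sub_finite_set _ _
  ((fun J : {ffun 'I_n -> 'I_m.+2} => \row_i ((J i)%:R / m.+1%:R) : V) @` setT)).
  by move=> z [J ->]; exists J.
exact/finite_image/finite_finset.
Qed.

Lemma finite_coarse_grid M : finite_set [set z | exists2 m, (m < M)%N & grid m z].
Proof.
apply: (@sub_finite_set _ _ (\bigcup_(m in `I_M) grid m)).
  by move=> z [m mM gz]; exists m.
by apply: bigcup_finite => [|m _]; [exact: finite_II|exact: finite_grid].
Qed.

Lemma small_mesh (e : R) : 0 < e -> exists M, forall m, (M <= m)%N -> 5 / m.+1%:R < e.
Proof.
move=> e0; exists (Num.truncn (5 / e)) => m Mm.
rewrite ltr_pdivrMr ?ltr0n// [e * _]mulrC -ltr_pdivrMr//.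
by apply: lt_le_trans (truncnS_gt _) _; rewrite ler_nat.
Qed.

(** A satellite far from [K] can only come from a coarse grid, and the coarse grids have finitely
    many points. *)
Lemma finite_far_satellites K e : closed K -> 0 < e ->
  finite_set [set z | satellites K z /\ forall p, K p -> e <= `|p - z|].
Proof.
move=> cK e0; have [M MP] := small_mesh e0.
apply: sub_finite_set (finite_coarse_grid M) => z [Dz far].
have [p [m [[Kp _] pz gz]]] := satellite_near cK Dz.
exists m => //; rewrite ltnNge; apply/negP => /MP me.
by have := lt_trans pz me; rewrite ltNge far.
Qed.

Lemma finite_set_sep (A : set V) x : finite_set A ->
  exists2 e, 0 < e & forall y, A y -> `|x - y| < e -> y = x.
Proof.
move=> fA; pose B := A `\ x.
have cB : closed B.
  apply: row_compact_closed; apply: finite_compact.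
  by apply: sub_finite_set fA => y [].
have [|e e0 eB] := closed_norm_sep (x := x) cB; first by case=> _; apply.
exists e => // y Ay /eB; apply: contra_notP => yx; by split.
Qed.

(** As [x] is any point off [K], this gives both the isolation of satellites and the closedness of
    [K] with its satellites. *)
Lemma satellites_discrete K x : closed K -> ~ K x ->
  exists2 e, 0 < e & forall y, (K `|` satellites K) y -> `|x - y| < e -> y = x.
Proof.
move=> cK Kx; have [e1 e10 e1K] := closed_norm_sep cK Kx.
have e20 : 0 < e1 / 2 by rewrite divr_gt0.
have [e2 e2gt0 e2P] := finite_set_sep x (finite_far_satellites cK e20).
exists (Num.min (e1 / 2) e2); first by rewrite lt_min e20.
move=> y Yy; rewrite lt_min => /andP[xy1 xy2]; case: Yy => [Ky|Dy].
  by exfalso; apply: (e1K y) => //; apply: lt_trans xy1 _; lra.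
apply: e2P => //; split=> // p Kp; rewrite leNgt; apply/negP => py.
by apply: (e1K p) => //; have := ler_distD y x p; rewrite [`|y - p|]distrC; lra.
Qed.

Lemma compact_satellites K : compact K -> compact (K `|` satellites K).
Proof.
move=> cK; have clK := row_compact_closed cK.
have [B KB] : exists B : R, forall x, K x -> `|x| <= B.
  by have [M [_ KM]] := compact_bounded cK; exists (M + 1) => x; apply: KM; rewrite ltrDl.
have YB x : (K `|` satellites K) x -> `|x| <= B + 6.
  case=> [/KB xB|[_ [m [_ [y [/KB yB yx]]]]]]; first by rewrite (le_trans xB)// lerDl.
  have m5 : 5 / m.+1%:R <= 5 :> R by rewrite ler_pdivrMr ?ltr0n// ler_peMr// ler1n.
  have := ler_normB y (y - x); rewrite opprB subrKC => /le_trans; apply.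
  by apply: le_trans (lerD yB (ltW (lt_le_trans yx m5))) _; rewrite lerD2l ler_nat.
apply: bounded_closed_compact.
  exists (B + 6); split; first exact: num_real.
  by move=> r rB x /YB xB; apply: le_trans xB (ltW rB).
rewrite -openC openE_norm => x Yx.
have [|e e0 eY] := satellites_discrete (x := x) clK; first by move=> Kx; apply: Yx; left.
exists e => // y xy Yy; apply: Yx; by rewrite -(eY y Yy xy).
Qed.

Lemma compact_bnd_satellites K : compact K -> compact (bnd K `|` satellites K).
Proof.
move=> cK; rewrite (_ : _ `|` _ = (K `|` satellites K) `&` ~` K°).
  apply: compact_closedI; first exact: compact_satellites.
  by rewrite closedC; exact: open_interior.
apply/seteqP; split=> x.
  case=> [[Kx Kox]|Dx]; first by split=> //; left.
  by split; [right|move=> /interior_subset; exact: Dx.1].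
by case=> -[Kx|Dx] Kox; [left; exact: conj Kx Kox|right].
Qed.

(** Take [x] off [K] near [p] and the least [m] for which [x] is at distance at least [2/(m+1)] from
    [K]. A grid point within [1/(m+1)] of [x] is then off [K]. By minimality [K] has a point within
    [2/m <= 4/(m+1)] of [x], which explains the 5 in [satellites]. *)
Lemma satellites_limit K p (e : R) : closed K -> middle K -> bnd K p -> 0 < e ->
  exists2 d, satellites K d & `|p - d| < e.
Proof.
(* The bound [1/12] keeps [x] in the unit cube, because [p] lies in the middle third, and it forces
   [m] to be positive. *)
move=> cK mK [Kp Kop] e0; pose e' := Num.min (e / 4) (12^-1).
have e'0 : 0 < e'.
  by rewrite lt_min; apply/andP; split; [rewrite divr_gt0|rewrite invr_gt0].
have e'e : e' <= e / 4 by rewrite ge_min lexx.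
have e'12 : e' <= 12^-1 by rewrite ge_min lexx orbT.
have [x px Kx] : exists2 x, `|p - x| < e' & ~ K x.
  apply: contrapT => h; apply: Kop; apply/interior_normP; exists e' => // y py.
  by apply: contrapT => Ky; apply: h; exists y.
have xi i : 0 <= x ord0 i <= 1.
  have := row_norm_coord (p - x) i; rewrite !mxE => xp.
  by have := le_lt_trans xp px; have := mK p Kp i; rewrite ltr_norml; lra.
pose P m := `[< forall y, K y -> 2 / m.+1%:R <= `|x - y| >].
have exP : exists m, P m.
  have [e2 e20 e2K] := closed_norm_sep cK Kx; have [M MP] := small_mesh e20.
  exists M; apply/asboolP => y Ky; rewrite leNgt; apply/negP => xy.
  apply: (e2K y) => //; apply: lt_trans xy (le_lt_trans _ (MP M (leqnn M))).
  by rewrite ler_pM2r ?invr_gt0 ?ltr0n//; lra.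
have [m /asboolP Pm mmin] := ex_minnP exP.
have pm := Pm p Kp.
have m1 : (0 < m)%N.
  rewrite lt0n; apply/negP => /eqP m0; move: pm; rewrite m0 divr1 distrC; lra.
have [y Ky xy] : exists2 y, K y & `|x - y| < 2 / m%:R.
  apply: contrapT => h; suff /mmin : P m.-1 by rewrite leqNgt prednK// leqnn.
  apply/asboolP => y Ky; rewrite prednK// leNgt; apply/negP => xy.
  by apply: h; exists y.
have m0 : 0 < m.+1%:R :> R by rewrite ltr0n.
have Jlt i : (Num.truncn (x ord0 i * m.+1%:R) < m.+2)%N.
  rewrite ltnS truncn_le_nat; have /andP[_ x1] := xi i.
  apply: le_lt_trans (_ : m.+1%:R < _); first by rewrite ler_piMl// ltW.
  by rewrite ltr_nat.
pose z : V := \row_i ((Ordinal (Jlt i))%:R / m.+1%:R).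
have xz : `|x - z| < m.+1%:R^-1.
  apply/row_norm_ltP => [|i]; first by rewrite invr_gt0.
  rewrite !mxE /=; have /andP[x0 _] := xi i.
  have /andP[t1 t2] := truncn_itv (mulr_ge0 x0 (ltW m0)).
  rewrite -[x ord0 i](mulfK (lt0r_neq0 m0)) -mulrBl normrM.
  rewrite [`|_^-1|]gtr0_norm ?invr_gt0// gtr_pMl ?invr_gt0// mulfK ?lt0r_neq0//.
  by rewrite ger0_norm ?subr_ge0// ltrBlDl natr1.
exists z; last first.
  apply: le_lt_trans (ler_distD x p z) _; apply: lt_trans (ltrD px xz) _.
  have me : 2 * m.+1%:R^-1 < e' by apply: le_lt_trans px; rewrite distrC.
  by move: me; set u := m.+1%:R^-1 => me; lra.
split.
  move=> /Pm m2; have : 0 < m.+1%:R^-1 :> R by rewrite invr_gt0.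
  have : 2 * m.+1%:R^-1 < m.+1%:R^-1 :> R by exact: le_lt_trans m2 xz.
  by set u := m.+1%:R^-1; lra.
exists m; split; first by exists [ffun i => Ordinal (Jlt i)]; apply/rowP => i; rewrite !mxE ffunE.
exists y; split=> //; apply: le_lt_trans (ler_distD x y z) _.
rewrite distrC in xy; apply: lt_le_trans (ltrD xy xz) _.
suff : 2 / m%:R <= 4 / m.+1%:R :> R.
  have -> : 5 / m.+1%:R = 4 / m.+1%:R + m.+1%:R^-1 :> R by field; rewrite lt0r_neq0.
  by rewrite lerD2r.
rewrite ler_pdivrMr ?ltr0n// mulrAC ler_pdivlMr// -!natrM ler_nat; lia.
Qed.

End Satellites.

(** * Continuous extension over the satellites *)

Section ExtendHomeo.
Variables (R : realType) (n : nat).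
Notation V := ('rV[R]_n).
Implicit Types (K L : set V) (x y z p q : V) (e : R).

Lemma injective_escapes (A : set V) (d : nat -> V) : finite_set A -> injective d ->
  exists N, forall k, (N <= k)%N -> ~ A (d k).
Proof.
move=> /finite_seqP[s ->] dI; elim: s => [|a s [N NP]]; first by exists 0%N.
have [[k0 k0a]|no] := pselect (exists k, d k = a).
  exists (maxn N k0.+1) => k; rewrite geq_max => /andP[/NP + kk0].
  move=> nk; rewrite /= inE => /predU1P[E|//]; move: kk0.
  by rewrite (dI k k0) ?ltnn// E.
exists N => k /NP nk; rewrite /= inE => /predU1P[E|//].
by apply: no; exists k.
Qed.

(** Each satellite [d k] is shadowed by a boundary point [p k]. The distances tend to 0 because an
    injective sequence eventually leaves every coarse grid. *)
Lemma satellites_enum K : compact K -> middle K -> bnd K !=set0 ->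
  exists d p : nat -> V, [/\ injective d, forall k, satellites K (d k),
    forall z, satellites K z -> exists k, d k = z, forall k, bnd K (p k) &
    forall e, 0 < e -> exists N, forall k, (N <= k)%N -> `|p k - d k| < e].
Proof.
move=> cK mK [b Kb]; have clK := row_compact_closed cK.
have inf : infinite_set (satellites K).
  move=> /(finite_set_sep b)[e e0 eP].
  have [z Dz bz] := satellites_limit clK mK Kb e0.
  by have := eP z Dz bz => zb; have := Dz.1; rewrite zb; apply; exact: Kb.1.
have cnt : countable (satellites K).
  apply: (@sub_countable _ _ _ (\bigcup_m (@grid R n m))).
    by apply: subset_card_le => z [_ [m [gz _]]]; exists m.
  by apply: bigcup_countable => // m _; apply: finite_set_countable; exact: finite_grid.
have : ([set: nat] #= satellites K)%card.
  by rewrite card_eq_le; apply/andP; split; [exact/infiniteP|exact: cnt].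
move=> /card_set_bijP[d [dD dI dS]].
have {}dI : injective d by move=> i j E; apply: dI; rewrite ?inE.
have {}dD k : satellites K (d k) by exact: dD.
have /choice[p pP] : forall k, exists p, exists m,
    [/\ bnd K p, `|p - d k| < 5 / m.+1%:R & grid m (d k)].
  by move=> k; exact: satellite_near.
exists d, p; split=> //.
- by move=> z /dS[k _ <-]; exists k.
- by move=> k; have [m []] := pP k.
move=> e e0; have [M MP] := small_mesh e0.
have [N NP] := injective_escapes (finite_coarse_grid R n M) dI.
exists N => k /NP nk; have [m [_ pd gd]] := pP k; apply: lt_trans pd (MP m _).
by rewrite leqNgt; apply/negP => mM; apply: nk; exists m.
Qed.

(** The finitely many early satellites keep away from [b], so those close to [b] come late. This
    supplies the choices that [matching] asks for. *)
Lemma enum_limit K (d p : nat -> V) b e N : compact K -> middle K -> bnd K b ->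
  (forall k, satellites K (d k)) -> (forall z, satellites K z -> exists k, d k = z) ->
  (forall e, 0 < e -> exists N, forall k, (N <= k)%N -> `|p k - d k| < e) -> 0 < e ->
  exists2 k, (N <= k)%N & `|b - p k| < e.
Proof.
move=> cK mK Kb dD dS pd e0; have clK := row_compact_closed cK.
have e20 : 0 < e / 2 by rewrite divr_gt0.
have [N1 N1P] := pd _ e20; pose N2 := maxn N N1.
have fA : finite_set (d @` `I_N2) by apply/finite_image/finite_II.
have [e1 e10 e1P] := finite_set_sep b fA.
have [|z Dz] := satellites_limit clK mK Kb (_ : 0 < Num.min e1 (e / 2)).
  by rewrite lt_min e10.
rewrite lt_min => /andP[bz1 bz2]; have [k dk] := dS z Dz.
have Nk : (N2 <= k)%N.
  rewrite leqNgt; apply/negP => kN; have := e1P z _ bz1.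
  have Az : (d @` `I_N2) z by exists k.
  by move=> /(_ Az) zb; have := Dz.1; rewrite zb; apply; exact: Kb.1.
move: Nk; rewrite geq_max => /andP[Nk /N1P pk]; exists k => //.
apply: le_lt_trans (ler_distD z b (p k)) _.
rewrite dk distrC in pk; have := ltrD bz2 pk; rewrite -splitr; exact.
Qed.

(** Satellites are isolated, so only points of [K] matter; the satellites near such a point have
    large index, where [F (d k)] is close to [f (p k)]. *)
Lemma extension_continuous K (d p : nat -> V) (f F : V -> V) : compact K ->
  {within K, continuous f} -> injective d ->
  (forall k, satellites K (d k)) -> (forall z, satellites K z -> exists k, d k = z) ->
  (forall k, bnd K (p k)) ->
  (forall e, 0 < e -> exists N, forall k, (N <= k)%N -> `|p k - d k| < e) ->
  (forall x, K x -> F x = f x) ->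
  (forall e, 0 < e -> exists N, forall k, (N <= k)%N -> `|f (p k) - F (d k)| < e) ->
  {within K `|` satellites K, continuous F}.
Proof.
move=> cK /within_normP fc dI dD dS pb pd FK Fd; apply/within_normP => x Yx e e0.
have clK := row_compact_closed cK.
case: Yx => [Kx|Dx]; last first.
  have [r r0 rP] := satellites_discrete clK Dx.1.
  by exists r => // y Yy xy; rewrite (rP y Yy xy) subrr normr0.
have e20 : 0 < e / 2 by rewrite divr_gt0.
have [r r0 rP] := fc x Kx _ e20; have r20 : 0 < r / 2 by rewrite divr_gt0.
have [N1 N1P] := pd _ r20; have [N2 N2P] := Fd _ e20.
pose N := maxn N1 N2.
have fA : finite_set (d @` `I_N) by apply/finite_image/finite_II.
have [r1 r10 r1P] := finite_set_sep x fA.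
exists (Num.min (r / 2) r1); first by rewrite lt_min r20.
move=> y Yy; rewrite lt_min => /andP[xy1 xy2]; rewrite FK//.
have half (a b : R) : a < b / 2 -> 0 < b -> a < b by lra.
case: Yy => [Ky|Dy].
  by rewrite FK//; apply: (half _ _ (rP y Ky (half _ _ xy1 r0)) e0).
have [k dk] := dS y Dy; have Nk : (N <= k)%N.
  rewrite leqNgt; apply/negP => kN; have Ay : (d @` `I_N) y by exists k.
  by have yx := r1P y Ay xy2; have := Dy.1; rewrite yx.
move: Nk; rewrite geq_max => /andP[/N1P pk /N2P Fk].
apply: le_lt_trans (ler_distD (f (p k)) _ _) _; rewrite (splitr e).
rewrite dk in pk Fk; apply: ltrD => //; apply: rP; first exact: (pb k).1.
apply: le_lt_trans (ler_distD y _ _) _; rewrite (splitr r).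
by apply: ltrD => //; rewrite distrC.
Qed.

Theorem extend_homeo K L (f g : V -> V) : compact K -> compact L ->
  middle K -> middle L -> (bnd K = set0 -> K = set0) ->
  {within K, continuous f} -> {within L, continuous g} ->
  (forall x, K x -> L (f x)) -> (forall y, L y -> K (g y)) ->
  (forall x, K x -> g (f x) = x) -> (forall y, L y -> f (g y) = y) ->
  exists F G : V -> V,
    [/\ {within K `|` satellites K, continuous F},
        {within L `|` satellites L, continuous G},
        (forall x, satellites K x -> satellites L (F x) /\ G (F x) = x),
        (forall y, satellites L y -> satellites K (G y) /\ F (G y) = y) &
        (forall x, K x -> F x = f x) /\ (forall y, L y -> G y = g y)].
Proof.
move=> cK cL mK mL bK fc gc fL gK gf fg.
have fbnd x : bnd K x -> bnd L (f x).
  move=> [Kx Kox]; split; first exact: fL.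
  by move=> /(homeo_interior cL cK gc fc gK fg); rewrite gf.
have gbnd y : bnd L y -> bnd K (g y).
  move=> [Ly Loy]; split; first exact: gK.
  by move=> /(homeo_interior cK cL fc gc fL gf); rewrite fg.
have [bK0|/set0P bKn0] := eqVneq (bnd K) set0.
  have K0 := bK bK0.
  have L0 : L = set0 by rewrite -subset0 => y /gK; rewrite K0.
  have D0 (A : set V) : A = set0 -> satellites A = set0.
    by move=> A0; rewrite -subset0 => z [_ [m [_ [x []]]]]; rewrite A0.
  exists f, g; rewrite !D0// K0 L0 !setU0; split=> //.
    exact: continuous_subspace0.
  exact: continuous_subspace0.
have bLn0 : bnd L !=set0 by have [x Kx] := bKn0; exists (f x); exact: fbnd.
have [d [p [dI dD dS pb pd]]] := satellites_enum cK mK bKn0.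
have [e [q [eI eD eS qb qe]]] := satellites_enum cL mL bLn0.
(* The first inequality makes the extension of [f] continuous, the second that of [g]. *)
pose C (N k j : nat) := `|f (p k) - q j| < N.+1%:R^-1 /\ `|p k - g (q j)| < N.+1%:R^-1.
have inv0 N : 0 < N.+1%:R^-1 :> R by rewrite invr_gt0.
have invle N N' : (N <= N')%N -> N'.+1%:R^-1 <= N.+1%:R^-1 :> R.
  by move=> NN; rewrite lef_pV2 ?posrE// ler_nat.
have [|||s [t [st ts sC]]] := @matching C.
- move=> N N' k j NN [c1 c2]; split.
    exact: lt_le_trans c1 (invle _ _ NN).
  exact: lt_le_trans c2 (invle _ _ NN).
- move=> k N; have Lfp := fbnd _ (pb k).
  have /within_normP/(_ _ Lfp.1 _ (inv0 N))[r r0 rP] := gc.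
  have [|j Nj] := @enum_limit L e q _ (Num.min r N.+1%:R^-1) N cL mL Lfp eD eS qe.
    by rewrite lt_min r0/=.
  rewrite lt_min => /andP[j1 j2]; exists j => //; split=> //.
  by have := rP (q j) (qb j).1 j1; rewrite gf//; exact: (pb k).1.
- move=> j N; have Kgq := gbnd _ (qb j).
  have /within_normP/(_ _ Kgq.1 _ (inv0 N))[r r0 rP] := fc.
  have [|k Nk] := @enum_limit K d p _ (Num.min r N.+1%:R^-1) N cK mK Kgq dD dS pd.
    by rewrite lt_min r0/=.
  rewrite lt_min => /andP[k1 k2]; exists k => //; split; last by rewrite distrC.
  by have := rP (p k) (pb k).1 k1; rewrite fg ?[`|q j - _|]distrC//; exact: (qb j).1.
have small eps : 0 < eps -> exists N, N.+1%:R^-1 < eps :> R.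
  move=> eps0; have [M MP] := small_mesh (mulr_gt0 (ltr0n R 5) eps0).
  by exists M; have := MP M (leqnn M); rewrite ltr_pM2l.
have sC' eps : 0 < eps -> exists M, forall k, (M <= k)%N ->
    `|f (p k) - q (s k)| < eps /\ `|p k - g (q (s k))| < eps.
  move=> /small[N Ne]; have [M MP] := sC N; exists M => k /MP[c1 c2].
  by split; [exact: lt_trans c1 Ne|exact: lt_trans c2 Ne].
have /choice[F FP] : forall x, exists y, (K x -> y = f x) /\
    (forall k, x = d k -> y = e (s k)).
  move=> x; have [Kx|Kx] := pselect (K x).
    exists (f x); split=> // k xd; exfalso; by apply: (dD k).1; rewrite -xd.
  have [[k xd]|no] := pselect (exists k, x = d k); last first.
    by exists x; split=> // k xd; exfalso; apply: no; exists k.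
  by exists (e (s k)); split=> // k'; rewrite xd => /dI ->.
have /choice[G GP] : forall x, exists y, (L x -> y = g x) /\
    (forall k, x = e k -> y = d (t k)).
  move=> x; have [Lx|Lx] := pselect (L x).
    exists (g x); split=> // k xd; exfalso; by apply: (eD k).1; rewrite -xd.
  have [[k xd]|no] := pselect (exists k, x = e k); last first.
    by exists x; split=> // k xd; exfalso; apply: no; exists k.
  by exists (d (t k)); split=> // k'; rewrite xd => /eI ->.
have FK x : K x -> F x = f x by have [] := FP x.
have GL y : L y -> G y = g y by have [] := GP y.
have Fd k : F (d k) = e (s k) by have [_ h] := FP (d k); exact: h.
have Ge k : G (e k) = d (t k) by have [_ h] := GP (e k); exact: h.
exists F, G; split=> //.
- apply: (extension_continuous cK fc dI dD dS pb pd FK) => eps eps0.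
  have eps20 : 0 < eps / 2 by rewrite divr_gt0.
  have [M MP] := sC' _ eps20; have [M' M'P] := qe _ eps20.
  have [M'' M''P] := injective_eventually_ge M' (can_inj st).
  exists (maxn M M'') => k; rewrite geq_max => /andP[/MP[c1 _] /M''P/M'P c2].
  rewrite Fd; apply: le_lt_trans (ler_distD (q (s k)) _ _) _; rewrite (splitr eps).
  exact: ltrD.
- apply: (extension_continuous cL gc eI eD eS qb qe GL) => eps eps0.
  have eps20 : 0 < eps / 2 by rewrite divr_gt0.
  have [M MP] := sC' _ eps20; have [M' M'P] := pd _ eps20.
  have [M'' M''P] := injective_eventually_ge (maxn M M') (can_inj ts).
  exists M'' => k /M''P; rewrite geq_max => /andP[/MP[_ c1] /M'P c2].
  rewrite Ge; apply: le_lt_trans (ler_distD (p (t k)) _ _) _; rewrite (splitr eps).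
  by apply: ltrD => //; rewrite distrC; move: c1; rewrite ts.
- by move=> x /dS[k <-]; rewrite Fd Ge st; split.
- by move=> x /eS[k <-]; rewrite Ge Fd ts; split.
Qed.

End ExtendHomeo.

(** * The cone construction *)

Section ConeSpace.
Variables (R : realType) (n : nat).
Notation V := ('rV[R]_n).
Notation W := ('rV[R]_n.+1).
Implicit Types (K L : set V) (x y z : V) (p q : W) (u v e : R).

Definition emb u y : W := \row_i (if unlift ord0 i is Some j then y ord0 j else u).
Definition ht p : R := p ord0 ord0.
Definition base p : V := \row_j p ord0 (lift ord0 j).

Lemma ht_emb u y : ht (emb u y) = u.
Proof. by rewrite /ht mxE unlift_none. Qed.

Lemma base_emb u y : base (emb u y) = y.
Proof. by apply/rowP => j; rewrite !mxE liftK. Qed.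

Lemma embK p : emb (ht p) (base p) = p.
Proof.
apply/rowP => i; rewrite mxE; case: unliftP => [j ->|->] //.
by rewrite mxE.
Qed.

Lemma emb_inj u y u' y' : emb u y = emb u' y' -> u = u' /\ y = y'.
Proof.
by move=> E; have := congr1 ht E; have := congr1 base E; rewrite !ht_emb !base_emb.
Qed.

Lemma embD u y u' y' : emb (u + u') (y + y') = emb u y + emb u' y'.
Proof. by apply/rowP => i; rewrite !mxE; case: unliftP => [j _|_]; rewrite ?mxE. Qed.

Lemma embZ c u y : emb (c * u) (c *: y) = c *: emb u y.
Proof. by apply/rowP => i; rewrite !mxE; case: unliftP => [j _|_]; rewrite ?mxE. Qed.

Lemma embB u y u' y' : emb u y - emb u' y' = emb (u - u') (y - y').
Proof. by rewrite embD -[- u']mulN1r -[- y']scaleN1r embZ scaleN1r. Qed.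

Lemma emb00 : emb 0 0 = 0.
Proof. by apply/rowP => i; rewrite !mxE; case: unliftP => [j _|_]; rewrite ?mxE. Qed.

Lemma norm_ht p : `|ht p| <= `|p|. Proof. exact: row_norm_coord. Qed.

Lemma norm_base p : `|base p| <= `|p|.
Proof. by apply/row_norm_leP => // i; rewrite mxE; exact: row_norm_coord. Qed.

Lemma norm_emb_le u y e : `|u| <= e -> `|y| <= e -> `|emb u y| <= e.
Proof.
move=> ue ye; apply/row_norm_leP => [|i]; first exact: le_trans ue.
rewrite mxE; case: unliftP => [j _|_] //.
by apply: le_trans ye; exact: row_norm_coord.
Qed.

Lemma norm_emb_lt u y e : `|u| < e -> `|y| < e -> `|emb u y| < e.
Proof.
move=> ue ye; have e0 : 0 < e by apply: le_lt_trans ue.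
apply/row_norm_ltP => // i.
rewrite mxE; case: unliftP => [j _|_] //.
by apply: le_lt_trans ye; exact: row_norm_coord.
Qed.

Lemma htB p q : ht (p - q) = ht p - ht q. Proof. by rewrite /ht !mxE. Qed.
Lemma baseB p q : base (p - q) = base p - base q.
Proof. by apply/rowP => i; rewrite !mxE. Qed.

Lemma ht_continuous : continuous (ht : W -> R^o).
Proof. exact: coord_continuous. Qed.

Lemma base_continuous : continuous base.
Proof.
apply/continuous_normP => p e e0; exists e => // q; apply: le_lt_trans.
by rewrite -baseB; exact: norm_base.
Qed.

Lemma emb_continuous u : continuous (emb u).
Proof.
apply/continuous_normP => x e e0; exists e => // y xy.
by rewrite embB subrr; apply: norm_emb_lt => //; rewrite normr0.
Qed.

Lemma ray_map_continuous : continuous (fun a : R^o * V => emb a.1 (a.1 *: a.2)).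
Proof.
move=> [u z]; apply/cvgrPdist_lt => e e0.
have C0 : 0 < `|u| + `|z| + 2 by have := normr_ge0 u; have := normr_ge0 z; lra.
pose d := Num.min 1 (e / (`|u| + `|z| + 2)).
have d0 : 0 < d by rewrite lt_min ltr01 divr_gt0.
have d1 : d <= 1 by rewrite ge_min lexx.
have de : d * (`|u| + `|z| + 2) <= e.
  by rewrite -ler_pdivlMr// ge_min lexx orbT.
exists (ball (u : R^o) d, ball z d); first by split; exact: nbhsx_ballx.
case=> u' z' /= []; rewrite -!ball_normE /= => uu zz.
rewrite embB; apply: norm_emb_lt.
  have := normr_ge0 u; have := normr_ge0 z; nra.
rewrite (_ : u *: z - u' *: z' = u *: (z - z') + (u - u') *: z'); last first.
  by rewrite scalerBr scalerBl addrA subrK.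
apply: le_lt_trans (ler_normD _ _) _; rewrite !normrZ.
have z'z : `|z'| <= `|z| + d.
  by have := ler_distD z 0 z'; rewrite !sub0r !normrN; lra.
have h1 : `|u| * `|z - z'| <= `|u| * d by rewrite ler_wpM2l// ltW.
have h2 : `|u - u'| * `|z'| <= d * (`|z| + 1).
  by apply: ler_pM => //; [exact: ltW|lra].
nra.
Qed.

(* The part at height 0 ensures that the dimension is not less than [n]. *)
Definition coneX K : set W :=
  [set p | [\/ exists2 x, K x & p = emb 1 x,
    exists u z, [/\ 0 <= u <= 1, (bnd K `|` satellites K) z & p = emb u (u *: z)] |
    exists2 y, cube R n y & p = emb 0 y]].

Lemma compact_cube : compact (cube R n).
Proof.
rewrite (_ : cube R n = [set v : V | forall i, `[0, 1]%classic (v ord0 i)]).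
  by apply: (@rV_compact _ n (fun=> `[0 : R, 1]%classic)) => i; exact: segment_compact.
by apply/seteqP; split=> v h i; have := h i; rewrite /= in_itv.
Qed.

Lemma cone_lines_compact (Z : set V) : compact Z ->
  compact [set p | exists u z, [/\ 0 <= u <= 1, Z z & p = emb u (u *: z)]].
Proof.
move=> cZ; pose c (a : R^o * V) := emb a.1 (a.1 *: a.2).
rewrite (_ : mkset _ = c @` (`[0 : R^o, 1]%classic `*` Z)).
  apply: continuous_compact; last by apply: compact_setX => //; exact: segment_compact.
  by apply: continuous_subspaceT; exact: ray_map_continuous.
apply/seteqP; split=> p /=.
  by move=> [u [z [u01 Zz ->]]]; exists (u, z) => //; split=> //=; rewrite in_itv.
by move=> [[u z] [/=]]; rewrite in_itv/= => u01 Zz <-; exists u, z.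
Qed.

Lemma compact_coneX K : compact K -> compact (coneX K).
Proof.
move=> cK; rewrite (_ : coneX K = (emb 1 @` K) `|`
    [set p | exists u z, [/\ 0 <= u <= 1, (bnd K `|` satellites K) z & p = emb u (u *: z)]]
    `|` (emb 0 @` cube R n)).
  apply: compactU; first apply: compactU.
  - by apply: continuous_compact => //; apply: continuous_subspaceT; exact: emb_continuous.
  - by apply: cone_lines_compact; exact: compact_bnd_satellites.
  - apply: continuous_compact; last exact: compact_cube.
    by apply: continuous_subspaceT; exact: emb_continuous.
apply/seteqP; split=> p.
  by case=> [[x Kx ->]|h|[y Cy ->]]; [left; left; exists x|left; right|right; exists y].
by case=> [[[x Kx <-]|h]|[y Cy <-]]; [apply: Or31; exists x|apply: Or32|apply: Or33; exists y].
Qed.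

Lemma middle_cube K : middle K -> K `<=` cube R n.
Proof. by move=> mK x /mK h i; have := h i; lra. Qed.

Lemma satellites_cube K : satellites K `<=` cube R n.
Proof.
move=> z [_ [m [[J ->] _]]] i; rewrite mxE divr_ge0 ?ler0n//=.
by rewrite ler_pdivrMr ?ltr0n// mul1r ler_nat -ltnS ltn_ord.
Qed.

Lemma Y_cube K : middle K -> K `|` satellites K `<=` cube R n.
Proof. by move=> mK x [/middle_cube|/satellites_cube]; apply. Qed.

Lemma emb_cube u y : 0 <= u <= 1 -> cube R n y -> cube R n.+1 (emb u y).
Proof. by move=> u01 Cy i; rewrite mxE; case: unliftP. Qed.

Lemma scale_cube u y : 0 <= u <= 1 -> cube R n y -> cube R n (u *: y).
Proof.
move=> /andP[u0 u1] Cy i; have /andP[y0 y1] := Cy i.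
by rewrite mxE mulr_ge0//= mulr_ile1.
Qed.

Lemma bnd_satellites_sub K : bnd K `|` satellites K `<=` K `|` satellites K.
Proof. by move=> z [[Kz _]|Dz]; [left|right]. Qed.

Lemma coneX_cube K : middle K -> coneX K `<=` cube R n.+1.
Proof.
move=> mK p [[x /(middle_cube mK) Cx ->]|[u [z [u01 Zz ->]]]|[y Cy ->]].
- by apply: emb_cube => //; rewrite lexx ler01.
- by apply: emb_cube => //; apply: scale_cube => //; apply/(Y_cube mK)/bnd_satellites_sub.
- by apply: emb_cube => //; rewrite lexx ler01.
Qed.

Lemma norm_cube y : cube R n y -> `|y| <= 1.
Proof.
move=> Cy; apply/row_norm_leP => // i; have /andP[y0 y1] := Cy i.
by rewrite ger0_norm.
Qed.

Hypothesis n0 : (0 < n)%N.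
Let i0 : 'I_n := Ordinal n0.

(** The positive dimension matters: in [R^0] the single point is open and its boundary is empty. *)
Lemma bnd_empty K : closed K -> middle K -> bnd K = set0 -> K = set0.
Proof.
move=> cK mK b0; rewrite -subset0 => x Kx.
have nK : ~ K (const_mx 2) by move=> /mK/(_ i0); rewrite mxE; lra.
by have [t [_ bt _]] := exit_point cK Kx nK; move: bt; rewrite b0.
Qed.

Lemma bnd_satellites_nowhere_dense K : closed K -> (bnd K `|` satellites K)° = set0.
Proof.
move=> cK; rewrite -subset0 => x /interior_normP[e e0 eZ].
have noD y : `|x - y| < e -> ~ satellites K y.
  move=> xy Dy; have [r r0 rP] := satellites_discrete cK Dy.1.
  pose d := Num.min (r / 2) ((e - `|x - y|) / 2).
  have d0 : 0 < d by rewrite lt_min !divr_gt0// subr_gt0.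
  have dr : d < r.
    have : d <= r / 2 by rewrite ge_min lexx.
    lra.
  have de : d < e - `|x - y|.
    have : d <= (e - `|x - y|) / 2 by rewrite ge_min lexx orbT.
    have : 0 < e - `|x - y| by rewrite subr_gt0.
    lra.
  pose w := y + const_mx d.
  have yw : `|y - w| <= d.
    by rewrite opprD addNKr normrN; apply/row_norm_leP => [|i]; rewrite ?mxE ?gtr0_norm// ltW.
  have : w = y.
    apply: rP; last exact: le_lt_trans yw dr.
    apply/bnd_satellites_sub/eZ; apply: le_lt_trans (ler_distD y x w) _.
    by rewrite -ltrBrDl; exact: le_lt_trans yw de.
  move/rowP/(_ i0); rewrite !mxE => /eqP.
  by rewrite -subr_eq0 addrAC subrr add0r gt_eqF.
have xx : `|x - x| < e by rewrite subrr normr0.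
have [[_ nKx]|Dx] := eZ x xx; last exact: (noD x).
apply: nKx; apply/interior_normP; exists e => // y xy.
by have [[]|/(noD _ xy)] := eZ y xy.
Qed.

Lemma coneX_ht K p : coneX K p -> 0 <= ht p <= 1.
Proof.
by case=> [[x _ ->]|[u [z [u01 _ ->]]]|[y _ ->]]; rewrite ht_emb ?lexx ?ler01.
Qed.

Lemma coneX_interm K p : coneX K p -> ht p != 0 -> ht p != 1 ->
  exists2 z, (bnd K `|` satellites K) z & base p = ht p *: z.
Proof.
case=> [[x _ ->]|[u [z [u01 Zz ->]]]|[y _ ->]]; rewrite ht_emb ?eqxx// base_emb.
by exists z.
Qed.

(** A ball meets some height strictly between 0 and 1, and the slice there is a rescaled copy of a
    nowhere dense set. *)
Lemma coneX_nowhere_dense K : compact K -> (coneX K)° = set0.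
Proof.
move=> cK; have clK := row_compact_closed cK.
rewrite -subset0 => p /interior_normP[e e0 eX].
(* Three trial heights, of which at most two can be 0 or 1. *)
have [v [pv v0 v1]] : exists v, [/\ `|ht p - v| < e, v != 0 & v != 1].
  pose a (k : R) : R := ht p + e * k.
  have a_near k : 0 < k < 1 -> `|ht p - a k| < e.
    move=> /andP[k0 k1]; rewrite opprD addNKr normrN gtr0_norm ?mulr_gt0//.
    by rewrite gtr_pMr.
  have a_inj k k' : a k = a k' -> k = k'.
    by move/addrI/mulfI; apply; rewrite gt_eqF.
  have [A0|A0] := eqVneq (a (4^-1)) 0; last have [A1|A1] := eqVneq (a (4^-1)) 1.
  - have [B1|B1] := eqVneq (a (2^-1)) 1.
      exists (a (3 / 4)); split; first by apply: a_near; lra.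
        by apply/eqP => E; have /a_inj := etrans E (esym A0); lra.
      by apply/eqP => E; have /a_inj := etrans E (esym B1); lra.
    exists (a (2^-1)); split=> //; first by apply: a_near; lra.
    by apply/eqP => E; have /a_inj := etrans E (esym A0); lra.
  - have [B1|B1] := eqVneq (a (2^-1)) 0.
      exists (a (3 / 4)); split; first by apply: a_near; lra.
        by apply/eqP => E; have /a_inj := etrans E (esym B1); lra.
      by apply/eqP => E; have /a_inj := etrans E (esym A1); lra.
    exists (a (2^-1)); split=> //; first by apply: a_near; lra.
    by apply/eqP => E; have /a_inj := etrans E (esym A1); lra.
  - by exists (a (4^-1)); split=> //; apply: a_near; lra.
have bX y : `|base p - y| < e -> coneX K (emb v y).
  by move=> py; apply: eX; rewrite -[p]embK embB; exact: norm_emb_lt.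
have v01 : 0 < v < 1.
  have /bX/coneX_ht : `|base p - base p| < e by rewrite subrr normr0.
  rewrite ht_emb => /andP[h0 h1].
  by rewrite !lt_neqAle h0 h1 eq_sym v0 v1.
have vgt0 : 0 < v by have /andP[] := v01.
suff : (bnd K `|` satellites K)° (v^-1 *: base p).
  by rewrite bnd_satellites_nowhere_dense.
apply/interior_normP; exists (e / v); first by rewrite divr_gt0.
move=> z pz; have : `|base p - v *: z| < e.
  rewrite (_ : _ - _ = v *: (v^-1 *: base p - z)).
    by rewrite normrZ gtr0_norm// mulrC -ltr_pdivlMr.
  by rewrite scalerBr scalerA divff// scale1r.
move=> /bX/coneX_interm; rewrite ht_emb base_emb => /(_ v0 v1)[z' Zz'].
by move/(scalerI v0) => ->.
Qed.

Lemma coneX_covdim K : compact K -> covdim_eq R n.+1 (coneX K) n.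
Proof.
move=> cK; split.
  by apply: ord_le_nowhere_dense; [exact: compact_coneX|exact: coneX_nowhere_dense].
apply: (@not_ord_le_cube R n n.+1 (coneX K) (emb 0) base).
- exact: compact_coneX.
- exact: emb_continuous.
- exact: base_continuous.
- by move=> x; rewrite base_emb.
- by move=> x Cx; apply: Or33; exists x.
Qed.

Lemma connected_path (c : R -> W) a b : (forall s t, `|c s - c t| <= `|s - t|) ->
  connected (c @` `[a, b]).
Proof.
move=> cl; apply: connected_continuous_connected; first exact: segment_connected.
apply: continuous_subspaceT; apply/(continuous_normP (V := R^o)) => x e e0.
by exists e => // y; apply: le_lt_trans.
Qed.

Lemma connected_star (A : set W) p0 :
  (forall p, A p -> exists C, [/\ connected C, C p0, C p & C `<=` A]) -> connected A.
Proof.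
move=> h; have [[p Ap]|A0] := pselect (exists p, A p); last first.
  rewrite (_ : A = set0); first exact: connected0.
  by rewrite -subset0 => p Ap; apply: A0; exists p.
have /choice[C CP] : forall p, exists C, A p -> [/\ connected C, C p0, C p & C `<=` A].
  by move=> q; have [/h[C CP]|nA] := pselect (A q); [exists C|exists set0].
rewrite (_ : A = \bigcup_(q in A) C q).
  apply: bigcup_connected; last by move=> q /CP[].
  by exists p0 => q /CP[].
apply/seteqP; split=> q; first by move=> Aq; exists q => //; have [] := CP q Aq.
by move=> [r Ar]; have [_ _ _] := CP r Ar; apply.
Qed.

Lemma ray_lip z s t : cube R n z -> `|emb s (s *: z) - emb t (t *: z)| <= `|s - t|.
Proof.
move=> /norm_cube z1; rewrite embB -scalerBl; apply: norm_emb_le => //.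
by rewrite normrZ ler_piMr.
Qed.

Lemma floor_lip y s t : cube R n y -> `|emb 0 (s *: y) - emb 0 (t *: y)| <= `|s - t|.
Proof.
move=> /norm_cube y1; rewrite embB subrr -scalerBl; apply: norm_emb_le => //.
  by rewrite normr0.
by rewrite normrZ ler_piMr.
Qed.

Lemma connected_coneX K : compact K -> middle K -> connected (coneX K).
Proof.
move=> cK mK; have clK := row_compact_closed cK.
have ray z : (bnd K `|` satellites K) z ->
    let C := (fun u => emb u (u *: z)) @` `[0, 1] in
    [/\ connected C, C 0, C (emb 1 z) & C `<=` coneX K].
  move=> Zz; have Cz : cube R n z by apply/(Y_cube mK)/bnd_satellites_sub.
  split.
  - by apply: connected_path => s t; exact: ray_lip.
  - by exists 0; rewrite ?scale0r ?emb00//= in_itv/= lexx ler01.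
  - by exists 1; rewrite ?scale1r//= in_itv/= lexx ler01.
  - by move=> _ [u /= u01 <-]; apply: Or32; exists u, z; rewrite in_itv in u01.
apply: (@connected_star _ 0) => p [[x Kx ->]|[u [z [u01 Zz ->]]]|[y Cy ->]].
(* At height 1, walking towards the point over 0, which is off [K], reaches [bnd K]; from there a
   ray descends to the apex. *)
- have nK : ~ K 0 by move=> /mK/(_ i0); rewrite mxE; lra.
  have [t [/andP[t0 t1] bt Kt]] := exit_point clK Kx nK.
  have [C1 C2 C3 C4] := ray _ (or_introl bt : (bnd K `|` satellites K) _).
  pose c s := emb 1 (x + s *: (0 - x)).
  have Cx := norm_cube (middle_cube mK Kx).
  exists ((fun u => emb u (u *: (x + t *: (0 - x)))) @` `[0, 1] `|` c @` `[0, t]); split.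
  + apply: connectedU => //.
      exists (emb 1 (x + t *: (0 - x))); split=> //.
      by exists t => //=; rewrite in_itv/= t0 lexx.
    apply: connected_path => r s; rewrite embB subrr opprD addrACA subrr add0r -scalerBl.
    apply: norm_emb_le; rewrite ?normr0//.
    by rewrite normrZ sub0r normrN; apply: ler_piMr.
  + by left.
  + by right; exists 0 => /=; rewrite ?in_itv/= ?lexx// /c scale0r addr0.
  + move=> q [/C4//|[s /=]]; rewrite in_itv/= => /Kt Ks <-.
    by apply: Or31; eexists; first exact: Ks.
- have [C1 C2 C3 C4] := ray z Zz; exists ((fun v => emb v (v *: z)) @` `[0, 1]).
  by split=> //; exists u => //=; rewrite in_itv.
- exists ((fun s => emb 0 (s *: y)) @` `[0, 1]); split.
  + by apply: connected_path => r s; exact: floor_lip.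
  + by exists 0; rewrite ?scale0r ?emb00//= in_itv/= lexx ler01.
  + by exists 1; rewrite ?scale1r//= in_itv/= lexx ler01.
  + move=> q [s /=]; rewrite in_itv/= => s01 <-; apply: Or33; exists (s *: y) => //.
    exact: scale_cube.
Qed.

End ConeSpace.

(** * Homeomorphisms between cones *)

Section ConeFunctor.
Variables (R : realType) (n : nat).
Notation V := ('rV[R]_n).
Notation W := ('rV[R]_n.+1).
Implicit Types (K L : set V) (x y z : V) (p q : W) (u v e : R).

(** On the slice at a nonzero height [F] acts up to scaling by that height; at height 0, where the
    scaling degenerates, all points are fixed. *)
Definition coneF (F : V -> V) p : W :=
  if ht p == 0 then p else emb (ht p) (ht p *: F ((ht p)^-1 *: base p)).

Lemma coneX_base K p : coneX K p -> ht p != 0 ->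
  (K `|` satellites K) ((ht p)^-1 *: base p).
Proof.
case=> [[x Kx ->]|[u [z [u01 Zz ->]]]|[y _ ->]]; rewrite ht_emb base_emb ?eqxx//.
  by rewrite invr1 scale1r => _; left.
by move=> u0; rewrite scalerA mulVf// scale1r; exact: bnd_satellites_sub.
Qed.

Lemma coneF_scaled F K p : (forall x, (K `|` satellites K) x -> cube R n (F x)) ->
  coneX K p -> ht p != 0 -> `|ht p *: F ((ht p)^-1 *: base p)| <= ht p.
Proof.
move=> FC Xp p0; have /andP[h0 _] := coneX_ht Xp.
rewrite normrZ ger0_norm// ler_piMr//.
by apply: norm_cube; apply: FC; exact: coneX_base.
Qed.

(** Height 0 is the delicate place. Off the floor the norm of [base q] is at most [ht q], so near a
    floor point other than the apex there are only floor points; at the apex the same bound for the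
    images sends them to 0. *)
Lemma coneF_continuous F K : middle K -> {within K `|` satellites K, continuous F} ->
  (forall x, (K `|` satellites K) x -> cube R n (F x)) ->
  {within coneX K, continuous coneF F}.
Proof.
move=> mK Fc FC; apply/within_normP => p Xp e e0.
have [p0|p0] := eqVneq (ht p) 0; last first.
  have hp0 : 0 < `|ht p| by rewrite normr_gt0.
  pose g q : V := (ht q)^-1 *: base q.
  have FF := nbhs_filter p.
  have hc : ht q @[q --> p] --> (ht p : R^o) by exact: ht_continuous.
  have bc : base q @[q --> p] --> base p by exact: base_continuous.
  have gc : g q @[q --> p] --> g p.
    by apply: (@cvgZ _ _ _ _ FF) => //; apply: (@cvgV _ _ _ FF).
  have [FX [FFX FXE]] : exists FX : set_system W,
      Filter FX /\ FX = within (coneX K) (nbhs p).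
    by exists (within (coneX K) (nbhs p)); split=> //; exact: within_filter.
  have Fgc : F (g q) @[q --> FX] --> F (g p).
    apply/cvgrPdist_lt => d d0.
    have /within_normP/(_ _ (coneX_base Xp p0) d d0)[r r0 rP] := Fc.
    have /cvgrPdist_lt/(_ r r0) gr := gc.
    have /cvgrPdist_lt/(_ _ hp0) hr := hc.
    suff : \forall q \near p, coneX K q -> `|F (g p) - F (g q)| < d by rewrite FXE.
    near=> q => Xq; apply: rP; last by near: q.
    apply: coneX_base => //; apply/eqP => q0.
    have : `|ht p - ht q| < `|ht p| by near: q.
    by rewrite q0 subr0 ltxx.
  have hFX : ht q @[q --> FX] --> (ht p : R^o).
    by rewrite FXE; apply: cvg_trans hc; apply: cvg_app; exact: cvg_within.
  have sc : ht q *: F (g q) @[q --> FX] --> ht p *: F (g p).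
    exact: (@cvgZ _ _ _ _ FFX).
  have /cvgrPdist_lt/(_ e e0) s1 := sc; have /cvgrPdist_lt/(_ e e0) s2 := hFX.
  have /cvgrPdist_lt/(_ _ hp0) s3 := hFX.
  have : \forall q \near p, coneX K q -> `|coneF F p - coneF F q| < e.
    have : \forall q \near FX, `|coneF F p - coneF F q| < e; last by rewrite FXE.
    near=> q.
    have q0 : ht q != 0.
      apply/eqP => q0; have : `|ht p - ht q| < `|ht p| by near: q.
      by rewrite q0 subr0 ltxx.
    rewrite /coneF (negPf p0) (negPf q0) embB; apply: norm_emb_lt; first by near: q.
    by near: q.
  move=> /nbhs_ballP[d d0 dP]; exists d => // q Xq pq.
  by apply: dP => //; rewrite -ball_normE.
have bound q : coneX K q -> ht q != 0 -> `|base q| <= `|ht q|.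
  move=> Xq q0; have /andP[h0 _] := coneX_ht Xq.
  rewrite (_ : base q = ht q *: ((ht q)^-1 *: base q)); last first.
    by rewrite scalerA divff// scale1r.
  rewrite normrZ ler_piMr//; apply/norm_cube/(Y_cube mK); exact: coneX_base.
rewrite {1}/coneF p0 eqxx.
have [b0|bn0] := eqVneq (base p) 0.
  have pz : p = 0 by rewrite -[p]embK p0 b0 emb00.
  exists e => // q Xq; rewrite pz !sub0r !normrN; apply: le_lt_trans.
  rewrite /coneF; case: eqP => // /eqP q0; apply: norm_emb_le; first exact: norm_ht.
  apply: le_trans (coneF_scaled FC Xq q0) _.
  by apply: le_trans (norm_ht q); exact: ler_norm.
have b0 : 0 < `|base p| by rewrite normr_gt0.
exists (Num.min e (`|base p| / 2)); first by rewrite lt_min e0 divr_gt0.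
move=> q Xq; rewrite lt_min => /andP[pqe pqb]; rewrite /coneF; case: eqP => // /eqP q0.
exfalso; have h1 := bound q Xq q0.
have h2 : `|ht q| < `|base p| / 2.
  by apply: le_lt_trans pqb; have := norm_ht (p - q); rewrite htB p0 sub0r normrN.
have h3 : `|base p - base q| < `|base p| / 2.
  by apply: le_lt_trans pqb; have := norm_base (p - q); rewrite baseB.
have h4 : `|base p| <= `|base p - base q| + `|base q|.
  by have := ler_normD (base p - base q) (base q); rewrite subrK.
have h5 := le_lt_trans h1 h2.
by have := le_lt_trans h4 (ltrD h3 h5); rewrite -splitr ltxx.
Unshelve. all: by end_near. Qed.

Lemma coneF_coneX K L F : (forall x, K x -> L (F x)) -> (forall x, bnd K x -> bnd L (F x)) ->
  (forall x, satellites K x -> satellites L (F x)) ->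
  forall p, coneX K p -> coneX L (coneF F p).
Proof.
move=> FK Fb Fs p [[x Kx ->]|[u [z [u01 Zz ->]]]|[y Cy ->]]; rewrite /coneF ht_emb base_emb.
- rewrite oner_eq0 invr1 !scale1r; apply: Or31; exists (F x) => //; exact: FK.
- case: eqP => [->|/eqP u0].
    apply: Or32; exists 0, (F z); rewrite scale0r lexx ler01 scale0r; split=> //.
    by case: Zz => [/Fb|/Fs]; [left|right].
  apply: Or32; exists u, (F z); rewrite scalerA mulVf// scale1r; split=> //.
  by case: Zz => [/Fb|/Fs]; [left|right].
- by rewrite eqxx; apply: Or33; exists y.
Qed.

Lemma coneFK K F G : (forall x, (K `|` satellites K) x -> G (F x) = x) ->
  forall p, coneX K p -> coneF G (coneF F p) = p.
Proof.
move=> GF p Xp; rewrite {2}/coneF; case: eqP => [p0|/eqP p0].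
  by rewrite /coneF p0 eqxx.
rewrite /coneF ht_emb (negPf p0) base_emb scalerA mulVf// scale1r GF; last exact: coneX_base.
by rewrite scalerA divff// scale1r embK.
Qed.

Lemma homeo_bnd K L (f g : V -> V) : compact K -> compact L ->
  {within K, continuous f} -> {within L, continuous g} ->
  (forall x, K x -> L (f x)) -> (forall y, L y -> K (g y)) ->
  (forall x, K x -> g (f x) = x) -> (forall y, L y -> f (g y) = y) ->
  forall x, bnd K x -> bnd L (f x).
Proof.
move=> cK cL fc gc fL gK gf fg x [Kx Kox]; split; first exact: fL.
by move=> /(homeo_interior cL cK gc fc gK fg); rewrite gf.
Qed.

Theorem homeomorphic_coneX K L : (0 < n)%N -> compact K -> compact L ->
  middle K -> middle L ->
  homeomorphic R n n K L -> homeomorphic R n.+1 n.+1 (coneX K) (coneX L).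
Proof.
move=> n0 cK cL mK mL [f [g [fL gK gf fg [fc gc]]]].
have {}fL x : K x -> L (f x) by move=> Kx; apply: fL; exists x.
have {}gK y : L y -> K (g y) by move=> Ly; apply: gK; exists y.
have bK := bnd_empty n0 (row_compact_closed cK) mK.
have [F [G [Fc Gc FD GD [FK GL]]]] := extend_homeo cK cL mK mL bK fc gc fL gK gf fg.
have FY x : (K `|` satellites K) x -> (L `|` satellites L) (F x).
  by case=> [Kx|Dx]; [left; rewrite FK//; exact: fL|right; have [] := FD x Dx].
have GY y : (L `|` satellites L) y -> (K `|` satellites K) (G y).
  by case=> [Ly|Dy]; [left; rewrite GL//; exact: gK|right; have [] := GD y Dy].
have FX p : coneX K p -> coneX L (coneF F p).
  apply: coneF_coneX => x; last by move=> /FD[].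
    by move=> Kx; rewrite FK//; exact: fL.
  move=> bx; rewrite FK; last exact: bx.1.
  exact: (homeo_bnd cK cL fc gc fL gK gf fg).
have GX p : coneX L p -> coneX K (coneF G p).
  apply: coneF_coneX => x; last by move=> /GD[].
    by move=> Lx; rewrite GL//; exact: gK.
  move=> bx; rewrite GL; last exact: bx.1.
  exact: (homeo_bnd cL cK gc fc gK fL fg gf).
exists (coneF F), (coneF G); split.
- by move=> _ [p Xp <-]; exact: FX.
- by move=> _ [p Xp <-]; exact: GX.
- move=> p; apply: coneFK => x [Kx|/FD[]//].
  by rewrite FK// GL ?gf//; exact: fL.
- move=> p; apply: coneFK => x [Lx|/GD[]//].
  by rewrite GL// FK ?fg//; exact: gK.
split; apply: coneF_continuous => //.
  by move=> x /FY; exact: Y_cube.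
by move=> x /GY; exact: Y_cube.
Qed.

End ConeFunctor.

(** * Recovering the base of the cone *)

Section ConeRecovery.
Variables (R : realType) (n : nat).
Notation V := ('rV[R]_n).
Notation W := ('rV[R]_n.+1).
Implicit Types (K L : set V) (X : set W) (x y z : V) (p q : W).

Definition midpoint X p := exists c : R -> W,
  [/\ {within `[-1, 1], continuous c}, forall t : R, -1 <= t <= 1 -> X (c t),
      forall s t : R, -1 <= s <= 1 -> -1 <= t <= 1 -> c s = c t -> s = t & c 0 = p].

Definition ends X : set W := [set p | X p /\ ~ midpoint X p].

Definition limits_at (E : set W) p :=
  forall e : R, 0 < e -> exists2 q, E q & q <> p /\ `|p - q| < e.

Lemma midpoint_image X X' (f : W -> W) p : {within X, continuous f} ->
  (forall q, X q -> X' (f q)) -> (forall q q', X q -> X q' -> f q = f q' -> q = q') ->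
  midpoint X p -> midpoint X' (f p).
Proof.
move=> fc fX fI [c [cc cX cI <-]]; exists (f \o c); split=> //.
- apply/(within_normP (V := R^o)) => t t1 e e0; have t1' := t1; rewrite /= in_itv/= in t1'.
  have /within_normP/(_ _ (cX t t1') e e0)[r r0 rP] := fc.
  have /(within_normP (V := R^o))/(_ t t1 r r0)[d d0 dP] := cc.
  exists d => // s s1 ts; apply: rP; last exact: dP.
  by apply: cX; move: s1; rewrite /= in_itv.
- by move=> t t1; apply/fX/cX.
- by move=> s t s1 t1 /fI; move=> /(_ (cX s s1) (cX t t1)); exact: cI.
Qed.

Lemma segment_midpoint X p w : w != 0 ->
  (forall t : R, -1 <= t <= 1 -> X (p + t *: w)) -> midpoint X p.
Proof.
move=> w0 Xw; exists (fun t => p + t *: w); split=> //.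
- apply: continuous_subspaceT; apply/(continuous_normP (V := R^o)) => t e e0.
  have nw0 : 0 < `|w| by rewrite normr_gt0.
  exists (e / `|w|) => [|s ts]; first by rewrite divr_gt0.
  by rewrite opprD addrACA subrr add0r -scalerBl normrZ -ltr_pdivlMr.
- move=> s t _ _ /addrI /eqP; rewrite -subr_eq0 -scalerBl scaler_eq0 (negPf w0) orbF.
  by rewrite subr_eq0 => /eqP.
- by rewrite scale0r addr0.
Qed.

(** Projection from the apex to height 1 sends a point near [emb 1 z] to a point of [K] or a
    satellite near [z], hence to [z] itself by isolation. *)
Lemma coneX_near_satellite K z : compact K -> satellites K z ->
  exists2 r : R, 0 < r & forall p, coneX K p -> `|emb 1 z - p| < r ->
    p = emb (ht p) (ht p *: z) /\ ht p <= 1.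
Proof.
move=> cK Dz; have clK := row_compact_closed cK.
have [r r0 rP] := satellites_discrete clK Dz.1.
pose C : R := `|z| + 1; have C0 : 0 < C by rewrite ltr_wpDl.
(* Heights above [1/2] keep the projection factor below 2; the factor [C] accounts for the change of
   height along the ray. *)
pose d := Num.min (2^-1) (r / (2 * C)).
have d0 : 0 < d by rewrite lt_min; apply/andP; split; rewrite ?invr_gt0// divr_gt0// mulr_gt0.
have d2 : d <= 2^-1 by rewrite ge_min lexx.
have dr : d * (2 * C) <= r by rewrite -ler_pdivlMr ?mulr_gt0// ge_min lexx orbT.
exists d => // p Xp zp; have /andP[h0 h1] := coneX_ht Xp; split=> //.
have hp : `|1 - ht p| < d.
  by apply: le_lt_trans zp; have := norm_ht (emb 1 z - p); rewrite htB ht_emb.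
have bp : `|z - base p| < d.
  by apply: le_lt_trans zp; have := norm_base (emb 1 z - p); rewrite baseB base_emb.
have h2 : 2^-1 < ht p by move: hp; rewrite ltr_norml; lra.
have hgt0 : 0 < ht p by apply: lt_trans h2; rewrite invr_gt0.
have hn0 : ht p != 0 by rewrite gt_eqF.
have Yp := coneX_base Xp hn0.
rewrite -[LHS]embK; congr emb.
rewrite -(rP _ Yp) ?scalerA ?divff ?scale1r//.
have E : z - (ht p)^-1 *: base p = (ht p)^-1 *: ((z - base p) - (1 - ht p) *: z).
  by apply/rowP => j; rewrite !mxE; field.
rewrite E normrZ gtr0_norm ?invr_gt0// mulrC ltr_pdivrMr//.
apply: le_lt_trans (ler_normB _ _) _; rewrite normrZ.
have hz : `|1 - ht p| * `|z| <= d * `|z| by rewrite ler_wpM2r// ltW.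
have C1 : d * C = d * `|z| + d by rewrite /C mulrDr mulr1.
have h3 : r * 2^-1 < r * ht p by rewrite ltr_pM2l.
lra.
Qed.

(* Near [emb 1 z] the space is a segment of which [emb 1 z] is an end point, so an arc
   through it would have to turn back. *)
Lemma satellite_end K z : compact K -> satellites K z -> ends (coneX K) (emb 1 z).
Proof.
move=> cK Dz; split.
  apply: Or32; exists 1, z; rewrite scale1r ler01 lexx; split=> //; by right.
move=> [c [cc cX cI c0]]; have [r r0 rP] := coneX_near_satellite cK Dz.
have z1 : (`[-1, 1]%classic : set R) 0 by rewrite /= in_itv/=; lra.
have /(within_normP (V := R^o))/(_ 0 z1 r r0)[d d0 dP] := cc.
pose a := Num.min (d / 2) 1.
have a0 : 0 < a by rewrite lt_min divr_gt0// ltr01.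
have a1 : a <= 1 by rewrite ge_min lexx orbT.
have ad : a < d.
  have : a <= d / 2 by rewrite ge_min lexx.
  lra.
pose h t := ht (c t).
have near t : -a <= t <= a -> c t = emb (h t) (h t *: z) /\ h t <= 1.
  move=> ta; have t1 : -1 <= t <= 1 by lra.
  apply: rP; first exact: cX.
  rewrite -c0; apply: dP; first by rewrite /= in_itv.
  by rewrite sub0r normrN ltr_norml; lra.
have hI s t : -a <= s <= a -> -a <= t <= a -> h s = h t -> s = t.
  move=> sa ta E; apply: cI; [lra|lra|].
  by rewrite (near s sa).1 (near t ta).1 E.
have h0 : h 0 = 1 by rewrite /h c0 ht_emb.
have hlt t : -a <= t <= a -> t != 0 -> h t < 1.
  move=> ta t0; rewrite lt_neqAle (near t ta).2 andbT; apply/eqP => ht1.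
  by move/eqP: t0; apply; apply: hI => //; [lra|rewrite h0].
have hc (u v : R) : -1 <= u -> v <= 1 -> {within `[u, v], continuous (h : R -> R^o)}.
  move=> u1 v1; apply/(within_normP (V := R^o)) => t tuv e e0.
  have t1 : (`[-1, 1]%classic : set R) t by move: tuv; rewrite /= !in_itv/=; lra.
  have /(within_normP (V := R^o))/(_ t t1 e e0)[d' d'0 d'P] := cc.
  exists d' => // s suv ts; apply: le_lt_trans (d'P s _ ts).
    by rewrite /h -htB; exact: norm_ht.
  by move: suv; rewrite /= !in_itv/=; lra.
have l1 : h (- a) < 1 by apply: hlt; [lra|rewrite oppr_eq0 gt_eqF].
have l2 : h a < 1 by apply: hlt; [lra|rewrite gt_eqF].
(* The height takes the value [m < 1] on both sides of 0. Injectivity makes the two parameters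
   equal, hence 0, where the height is 1. *)
pose m := Num.max (h (- a)) (h a); have m1 : m < 1 by rewrite gt_max l1.
have mE1 : h (- a) <= m by rewrite le_max lexx.
have mE2 : h a <= m by rewrite le_max lexx orbT.
have [|||s1 s1a hs1] := @IVT R h (- a) 0 m.
- by rewrite oppr_le0 ltW.
- by apply: hc; lra.
- by rewrite h0 ge_min mE1 /= le_max (ltW m1) orbT.
have [|||s2 s2a hs2] := @IVT R h 0 a m.
- exact: ltW.
- by apply: hc; lra.
- by rewrite h0 ge_min mE2 orbT /= le_max (ltW m1).
rewrite in_itv/= in s1a; rewrite in_itv/= in s2a.
have s12 : s1 = s2 by apply: hI; [lra|lra|rewrite hs1].
have s0 : s1 = 0 by lra.
by move: m1; rewrite -hs1 s0 h0 ltxx.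
Qed.

Definition corner y := forall i, y ord0 i = 0 \/ y ord0 i = 1.

Lemma finite_corners : finite_set corner.
Proof.
apply: (@sub_finite_set _ _
  ((fun J : {ffun 'I_n -> bool} => \row_i (J i)%:R : V) @` setT)).
  move=> y Cy; exists [ffun i => y ord0 i == 1] => //.
  apply/rowP => i; rewrite mxE ffunE; case: (Cy i) => ->; last by rewrite eqxx.
  by rewrite eq_sym oner_eq0.
exact/finite_image/finite_finset.
Qed.

Hypothesis n0 : (0 < n)%N.
Let i0 : 'I_n := Ordinal n0.

Lemma emb_neq0 u y : (u != 0) || (y != 0) -> emb u y != 0.
Proof.
apply: contraTneq; rewrite -emb00 => /emb_inj[-> ->].
by rewrite !eqxx.
Qed.

Lemma delta_neq0 (i : 'I_n) (c : R) : c != 0 -> c *: (delta_mx ord0 i : V) != 0.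
Proof.
move=> c0; apply/eqP => /rowP/(_ i); rewrite !mxE !eqxx mulr1.
by apply/eqP.
Qed.

(** Any other point is the centre of a straight segment: horizontal over [K°], along the ray at
    intermediate heights, in a free coordinate direction on the floor. Corners are left undecided;
    being finitely many, they produce no limit points. *)
Lemma end_cases K p : ends (coneX K) p ->
  (exists2 z, (bnd K `|` satellites K) z & p = emb 1 z) \/
  (exists2 y, corner y & p = emb 0 y).
Proof.
move=> [Xp nm]; have Xp' := Xp; case: Xp => [[x Kx pE]|[u [z [u01 Zz pE]]]|[y Cy pE]].
- have [Kox|Kox] := pselect (K° x); last by left; exists x => //; left.
  exfalso; apply: nm; have /interior_normP[e e0 eK] := Kox.
  have e2 : 0 < e / 2 by rewrite divr_gt0.
  apply: (@segment_midpoint _ _ (emb 0 ((e / 2) *: delta_mx ord0 i0))).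
    by apply: emb_neq0; rewrite eqxx/=; apply: delta_neq0; rewrite gt_eqF.
  move=> t t1; rewrite pE -embZ -embD mulr0 addr0; apply: Or31.
  eexists; last reflexivity; apply: eK; rewrite opprD addNKr normrN.
  apply/row_norm_ltP => // j; rewrite !mxE eqxx/= normrM normrM.
  have tn : `|t| <= 1 by rewrite ler_norml.
  have dn : `|(j == i0)%:R : R| <= 1 by case: (j == i0); rewrite ?normr1 ?normr0 ?ler01.
  apply: le_lt_trans (_ : 1 * (`|e / 2| * 1) < e).
    by apply: ler_pM => //; rewrite ?mulr_ge0//; apply: ler_pM.
  by rewrite mul1r mulr1 gtr0_norm//; lra.
- have [u1|u1] := eqVneq u 1; first by left; exists z; rewrite // pE u1 scale1r.
  have [uz|u0] := eqVneq u 0.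
    right; exists 0; first by move=> i; left; rewrite mxE.
    by rewrite pE uz scale0r.
  exfalso; apply: nm; have /andP[ge0 le1] := u01.
  have gt0 : 0 < u by rewrite lt_neqAle eq_sym u0.
  have lt1 : u < 1 by rewrite lt_neqAle u1.
  pose c := Num.min u (1 - u).
  have c0 : 0 < c by rewrite lt_min gt0 subr_gt0.
  have cu : c <= u by rewrite ge_min lexx.
  have cu1 : c <= 1 - u by rewrite ge_min lexx orbT.
  apply: (@segment_midpoint _ _ (emb c (c *: z))).
    by apply: emb_neq0; rewrite gt_eqF.
  move=> t t1; rewrite pE -embZ -embD scalerA -scalerDl; apply: Or32.
  exists (u + t * c), z; split=> //; apply/andP; split; nra.
- have [Cor|nc] := pselect (corner y); first by right; exists y.
  exfalso; apply: nm; have [i yi] : exists i, ~ (y ord0 i = 0 \/ y ord0 i = 1).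
    by apply: contrapT => h; apply: nc => i; apply: contrapT => yi; apply: h; exists i.
  have /andP[ge0 le1] := Cy i.
  have gt0 : 0 < y ord0 i by rewrite lt_neqAle ge0 andbT; apply/eqP => E; apply: yi; left.
  have lt1 : y ord0 i < 1 by rewrite lt_neqAle le1 andbT; apply/eqP => E; apply: yi; right.
  pose c := Num.min (y ord0 i) (1 - y ord0 i).
  have c0 : 0 < c by rewrite lt_min gt0 subr_gt0.
  have cu : c <= y ord0 i by rewrite ge_min lexx.
  have cu1 : c <= 1 - y ord0 i by rewrite ge_min lexx orbT.
  apply: (@segment_midpoint _ _ (emb 0 (c *: delta_mx ord0 i))).
    by apply: emb_neq0; rewrite eqxx/=; apply: delta_neq0; rewrite gt_eqF.
  move=> t t1; rewrite pE -embZ -embD mulr0 addr0; apply: Or33.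
  eexists; last reflexivity; move=> j; rewrite !mxE eqxx/=.
  have [->|_] := eqVneq j i; last by rewrite !mulr0 addr0; exact: Cy.
  by rewrite mulr1; apply/andP; split; nra.
Qed.

(** Corners are finite in number and satellites are isolated, so ends cluster only over [bnd K], and
    they do so at each of its points. Whether boundary points are ends themselves is never
    decided. *)
Lemma limits_ends K p : compact K -> middle K ->
  limits_at (ends (coneX K)) p <-> exists2 b, bnd K b & p = emb 1 b.
Proof.
move=> cK mK; have clK := row_compact_closed cK; split; last first.
  move=> [b bb ->] e e0; have [d Dd bd] := satellites_limit clK mK bb e0.
  exists (emb 1 d); first exact: satellite_end.
  split; last by rewrite embB subrr; apply: norm_emb_lt; rewrite ?normr0.
  by move=> /emb_inj[_ db]; apply: Dd.1; rewrite db; exact: bb.1.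
move=> acc; pose Z := bnd K `|` satellites K.
have cZ : compact (emb 1 @` Z).
  apply: continuous_compact; last exact: compact_bnd_satellites.
  by apply: continuous_subspaceT; exact: emb_continuous.
have [e1 e10 e1P] := finite_set_sep p (finite_image (emb 0) finite_corners).
have accZ e : 0 < e -> exists2 z, Z z & emb 1 z <> p /\ `|p - emb 1 z| < e.
  move=> e0; have [|q Eq [qp]] := acc (Num.min e e1); first by rewrite lt_min e0.
  rewrite lt_min => /andP[pq1 pq2].
  have [[z Zz qE]|[y Cy qE]] := end_cases Eq; first by exists z; rewrite -?qE.
  by exfalso; apply: qp; apply: e1P => //; exists y.
have [z Zz pE] : exists2 z, Z z & p = emb 1 z.
  apply: contrapT => h; have [|e e0 eP] := closed_norm_sep (x := p) (row_compact_closed cZ).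
    by move=> [z Zz zE]; apply: h; exists z.
  have [z Zz [_ zp]] := accZ e e0; apply: (eP _ zp); by exists z.
case: (Zz) => [bz|Dz]; first by exists z.
have [r r0 rP] := satellites_discrete clK Dz.1.
have [z' Zz' [z'p zp]] := accZ r r0; exfalso; apply: z'p.
rewrite pE; congr emb; apply: rP; first exact: bnd_satellites_sub.
apply: le_lt_trans zp; rewrite pE; have := norm_base (emb 1 z - emb 1 z').
by rewrite baseB !base_emb.
Qed.

Lemma limits_image X X' (f : W -> W) p : {within X, continuous f} ->
  (forall q q', X q -> X q' -> f q = f q' -> q = q') ->
  (forall q, ends X q -> ends X' (f q)) -> X p ->
  limits_at (ends X) p -> limits_at (ends X') (f p).
Proof.
move=> fc fI fE Xp acc e e0; have /within_normP/(_ p Xp e e0)[d d0 dP] := fc.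
have [q Eq [qp pq]] := acc d d0; exists (f q); first exact: fE.
split; last by apply: dP => //; exact: Eq.1.
by move=> /fI E; apply: qp; apply: E => //; exact: Eq.1.
Qed.

Definition top K : set W := emb 1 @` K.

Lemma connected_cone_part K : compact K -> middle K -> connected (coneX K `\` top K).
Proof.
move=> cK mK; apply: (@connected_star _ _ _ 0) => p [[[x Kx pE]|[u [z [u01 Zz pE]]]|[y Cy pE]] nt].
- by exfalso; apply: nt; exists x.
- exists ((fun v => emb v (v *: z)) @` `[0, u]); have /andP[ge0 le1] := u01.
  have Cz : cube R n z by apply/(Y_cube mK)/bnd_satellites_sub.
  split.
  + by apply: connected_path => s t; exact: ray_lip.
  + by exists 0; rewrite ?scale0r ?emb00//= in_itv/= lexx.
  + by exists u => //=; rewrite in_itv/= lexx ge0.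
  + move=> q [v /=]; rewrite in_itv/= => /andP[v0 vu] vq; split.
      by apply: Or32; exists v, z; rewrite v0 (le_trans vu).
    move=> [x Kx]; rewrite -vq => /emb_inj[v1 xz]; apply: nt.
    have u1 : u = 1 by apply/eqP; rewrite eq_le le1 v1.
    by exists x => //; rewrite pE u1 scale1r xz -v1 scale1r.
- exists ((fun s => emb 0 (s *: y)) @` `[0, 1]); split.
  + by apply: connected_path => r s; exact: floor_lip.
  + by exists 0; rewrite ?scale0r ?emb00//= in_itv/= lexx ler01.
  + by exists 1; rewrite ?scale1r ?pE//= in_itv/= lexx ler01.
  + move=> q [s /=]; rewrite in_itv/= => s01 sq; split.
      by apply: Or33; exists (s *: y) => //; exact: scale_cube.
    move=> [x Kx]; rewrite -sq => /emb_inj[/eqP]; by rewrite oner_eq0.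
Qed.

(** Each side lies in a closed set missing the other: [top K] on one hand, the rays together with
    the floor on the other. *)
Lemma separated_top K : compact K ->
  separated (emb 1 @` K°) (coneX K `\` top K).
Proof.
move=> cK; split; rewrite -subset0 => p [].
  have cT : closed (top K).
    apply: row_compact_closed; apply: continuous_compact => //.
    by apply: continuous_subspaceT; exact: emb_continuous.
  move=> clp [_]; apply; rewrite (closure_id (top K)).1//.
  apply: closure_subset clp => _ [x Kx <-]; exists x => //; exact: interior_subset Kx.
move=> [x Kx <-]; set B := [set p | exists u z, [/\ 0 <= u <= 1, (bnd K `|` satellites K) z &
   p = emb u (u *: z)]] `|` (emb 0 @` cube R n).
have cB : closed B.
  apply: row_compact_closed; apply: compactU.
    by apply: cone_lines_compact; exact: compact_bnd_satellites.
  apply: continuous_compact; last exact: compact_cube.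
  by apply: continuous_subspaceT; exact: emb_continuous.
have CB : coneX K `\` top K `<=` B.
  move=> q [[[y Ky ->]|h|[y Cy ->]] nt]; [|by left|by right; exists y].
  by exfalso; apply: nt; exists y.
move=> /(closure_subset CB); rewrite -(closure_id B).1//.
case=> [[u [z [_ Zz /emb_inj[<-]]]]|[y _ /emb_inj[/eqP]]]; last by rewrite eq_sym oner_eq0.
rewrite scale1r => xz; move: Zz; rewrite -xz => -[[_]|[nK _]]; first by apply.
exact: (nK (interior_subset Kx)).
Qed.

(** Boundary points are settled by [limits_ends]. For the rest, [g] maps the connected set [CL] into
    the union of two separated pieces; the tip of a satellite is an end, and no end lies over [K°],
    so the image falls into [CK] and avoids [top K]. *)
Lemma homeo_top K L (f g : W -> W) : compact K -> compact L -> middle K -> middle L ->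
  {within coneX K, continuous f} -> {within coneX L, continuous g} ->
  (forall p, coneX K p -> coneX L (f p)) -> (forall q, coneX L q -> coneX K (g q)) ->
  (forall p, coneX K p -> g (f p) = p) -> (forall q, coneX L q -> f (g q) = q) ->
  forall x, K x -> top L (f (emb 1 x)).
Proof.
move=> cK cL mK mL fc gc fX gX gf fg x Kx.
have fI p q : coneX K p -> coneX K q -> f p = f q -> p = q.
  by move=> Xp Xq E; rewrite -(gf p Xp) -(gf q Xq) E.
have gI p q : coneX L p -> coneX L q -> g p = g q -> p = q.
  by move=> Xp Xq E; rewrite -(fg p Xp) -(fg q Xq) E.
have fE p : ends (coneX K) p -> ends (coneX L) (f p).
  move=> [Xp nm]; split; first exact: fX.
  by move=> /(midpoint_image gc gX gI); rewrite gf.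
have gE p : ends (coneX L) p -> ends (coneX K) (g p).
  move=> [Xp nm]; split; first exact: gX.
  by move=> /(midpoint_image fc fX fI); rewrite fg.
have topX A y : A y -> coneX A (emb 1 y) by move=> Ay; apply: Or31; exists y.
have fb y : bnd K y -> exists2 b, bnd L b & f (emb 1 y) = emb 1 b.
  move=> by_; apply/(limits_ends _ cL mL)/(limits_image fc fI fE).
    exact/topX/by_.1.
  by apply/(limits_ends _ cK mK); exists y.
have gb y : bnd L y -> exists2 b, bnd K b & g (emb 1 y) = emb 1 b.
  move=> by_; apply/(limits_ends _ cK mK)/(limits_image gc gI gE).
    exact/topX/by_.1.
  by apply/(limits_ends _ cL mL); exists y.
have [Kox|Kox] := pselect (K° x); last first.
  by have [b bb ->] := fb x (conj Kx Kox); exists b => //; exact: bb.1.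
have [l Dl] : exists l, satellites L l.
  have [b bb] : exists b, bnd K b.
    apply: contrapT => nb; have : K = set0.
      apply: bnd_empty => //; first exact: row_compact_closed.
      by rewrite -subset0 => b bb; apply: nb; exists b.
    by move=> K0; rewrite K0 in Kx.
  have [b' bb' _] := fb b bb.
  have [d Dd _] := satellites_limit (row_compact_closed cL) mL bb' ltr01.
  by exists d.
apply: contrapT => ntop.
pose CL := coneX L `\` top L; pose CK := coneX K `\` top K.
have gCL : connected (g @` CL).
  apply: connected_continuous_connected; first exact: connected_cone_part.
  by apply: continuous_subspaceW gc => q [].
have sub : g @` CL `<=` (emb 1 @` K°) `|` CK.
  move=> _ [q [Xq nq] <-]; have [[y Ky gq]|nt] := pselect (top K (g q)); last first.
    by right; split=> //; exact: gX.
  have [Koy|Koy] := pselect (K° y); first by left; exists y.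
  exfalso; apply: nq; have [b bb fyb] := fb y (conj Ky Koy).
  by exists b; [exact: bb.1|rewrite -fyb gq fg].
have El := satellite_end cL Dl.
have lCL : CL (emb 1 l).
  split; first exact: El.1.
  by move=> [y Ly /emb_inj[_ yl]]; apply: Dl.1; rewrite -yl.
have [h|h] := connected_subset (separated_top cK) sub gCL.
  have [y Koy gy] : (emb 1 @` K°) (g (emb 1 l)) by apply: h; exists (emb 1 l).
  have Eg := gE _ El; rewrite -gy in Eg.
  have [[z Zz /emb_inj[_ yz]]|[z _ /emb_inj[/eqP]]] := end_cases Eg; last by rewrite oner_eq0.
  move: Zz; rewrite -yz => -[[_]|[nK _]]; first by apply.
  exact: (nK (interior_subset Koy)).
have : CK (emb 1 x).
  rewrite -(gf _ (topX _ _ Kx)); apply: h; exists (f (emb 1 x)) => //.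
  by split=> //; exact/fX/topX.
by move=> [_]; apply; exists x.
Qed.

Theorem coneX_homeomorphic K L : compact K -> compact L -> middle K -> middle L ->
  homeomorphic R n.+1 n.+1 (coneX K) (coneX L) -> homeomorphic R n n K L.
Proof.
move=> cK cL mK mL [f [g [fX gX gf fg [fc gc]]]].
have {}fX p : coneX K p -> coneX L (f p) by move=> Xp; apply: fX; exists p.
have {}gX q : coneX L q -> coneX K (g q) by move=> Xq; apply: gX; exists q.
have ft := homeo_top cK cL mK mL fc gc fX gX gf fg.
have gt := homeo_top cL cK mL mK gc fc gX fX fg gf.
have topX A y : A y -> coneX A (emb 1 y) by move=> Ay; apply: Or31; exists y.
have topE A p : top A p -> emb 1 (base p) = p /\ A (base p).
  by move=> [y Ay <-]; rewrite base_emb.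
have cont A (h : W -> W) : {within coneX A, continuous h} ->
    {within A, continuous (fun x => base (h (emb 1 x)))}.
  move=> /within_normP hc; apply/within_normP => x Ax e e0.
  have [d d0 dP] := hc _ (topX _ _ Ax) e e0; exists d => // y Ay xy.
  rewrite -baseB; apply: le_lt_trans (norm_base _) _; apply: dP; first exact: topX.
  by rewrite embB subrr; apply: norm_emb_lt; rewrite ?normr0.
exists (fun x => base (f (emb 1 x))), (fun y => base (g (emb 1 y))); split.
- by move=> _ [x Kx <-]; have [] := topE _ _ (ft x Kx).
- by move=> _ [y Ly <-]; have [] := topE _ _ (gt y Ly).
- by move=> x Kx; rewrite (topE _ _ (ft x Kx)).1 gf ?base_emb//; exact: topX.
- by move=> y Ly; rewrite (topE _ _ (gt y Ly)).1 fg ?base_emb//; exact: topX.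
by split; exact: cont.
Qed.

End ConeRecovery.

(** * Borel measurability *)

Section VietorisBorel.
Variable R : realType.

Section Closure.
Variable n : nat.
Notation KS := (Kspace R n).
Notation VB := (vborel R n).
Implicit Types A B : set (set (pt R n)).

Lemma vborel_open A : vopen R n A -> VB A.
Proof. exact: sub_sigma_algebra. Qed.

Lemma vborel0 : VB set0.
Proof. by have [] := smallest_sigma_algebra KS (vopen R n). Qed.

Lemma vborelC A : VB A -> VB (KS `\` A).
Proof. by have [_ h _] := smallest_sigma_algebra KS (vopen R n); exact: h. Qed.

Lemma vborel_bigcup (F : nat -> set (set (pt R n))) :
  (forall i, VB (F i)) -> VB (\bigcup_i F i).
Proof. by have [_ _ h] := smallest_sigma_algebra KS (vopen R n); exact: h. Qed.

Lemma vborelT : VB KS.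
Proof. by rewrite -[KS]setD0; apply: vborelC; exact: vborel0. Qed.

Lemma vborel_countable (I : countType) (F : I -> set (set (pt R n))) :
  (forall i, VB (F i)) -> VB [set K | exists i, F i K].
Proof.
move=> FB; rewrite (_ : mkset _ =
    \bigcup_k (if @unpickle I k is Some i then F i else set0)).
  by apply: vborel_bigcup => k; case: unpickle => [i|]; [exact: FB|exact: vborel0].
apply/seteqP; split=> K.
  by move=> [i Fi]; exists (pickle i) => //; rewrite pickleK.
by move=> [k _]; case: unpickle => // i Fi; exists i.
Qed.

Lemma vborelU A B : VB A -> VB B -> VB (A `|` B).
Proof.
move=> hA hB; rewrite (_ : A `|` B = [set K | exists b : bool, (if b then A else B) K]).
  by apply: vborel_countable => -[].
apply/seteqP; split=> K; first by case=> h; [exists true|exists false].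
by case=> -[] h; [left|right].
Qed.

Lemma vborelI A B : A `<=` KS -> VB A -> VB B -> VB (A `&` B).
Proof.
move=> AK hA hB; rewrite (_ : A `&` B = KS `\` ((KS `\` A) `|` (KS `\` B))).
  by apply: vborelC; apply: vborelU; exact: vborelC.
apply/seteqP; split=> K.
  by move=> [AK' BK']; split; [exact: AK|case=> -[]].
move=> [KK h]; split; apply: contrapT => h'; apply: h; [left|right]; exact: conj KK h'.
Qed.

(** Admits conditions independent of [K] into countable unions, without any analysis of those
    conditions. *)
Lemma vborel_if (P : Prop) A : VB A -> VB [set K | P /\ A K].
Proof.
move=> hA; have [p|np] := pselect P.
  by rewrite (_ : mkset _ = A)//; apply/seteqP; split=> K; [case|split].
rewrite (_ : mkset _ = set0); first exact: vborel0.
by rewrite -subset0 => K [].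
Qed.

Lemma vborel_hit (U : set (pt R n)) : open U -> VB [set K | KS K /\ K `&` U !=set0].
Proof.
move=> Uo; apply: vborel_open; split=> [K []//|K [KK KU]].
exists setT, 1%N, (fun=> U); split=> //; first exact: openT.
by move=> L [KL [_ /(_ ord0)]].
Qed.

Lemma vborel_miss (x : pt R n) : VB [set K | KS K /\ ~ K x].
Proof.
apply: vborel_open; split=> [K []//|K [KK Kx]].
exists (~` [set x]), 0%N, (fun=> set0); split=> //.
- rewrite openC; apply: row_compact_closed; exact: compact_set1.
- by move=> _; exact: open0.
- by split=> //; split=> [y Ky yx|[]//]; apply: Kx; rewrite -yx.
- by move=> L [KL [Lx _]]; split=> // Lxx; exact: (Lx _ Lxx).
Qed.

End Closure.

Section Reduction.
Variables (n m : nat) (F : set (pt R n) -> set (pt R m)).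
Hypothesis FK : forall K, Kspace R n K -> Kspace R m (F K).
Hypothesis hitF : forall V, open V ->
  vborel R n [set K | Kspace R n K /\ F K `&` V !=set0].

(** A compact subset of [U] already misses some neighbourhood [W N] of the complement, so
    containment is a countable union of complements of hit sets. *)
Lemma vborel_sub (U : set (pt R m)) : open U ->
  vborel R n [set K | Kspace R n K /\ F K `<=` U].
Proof.
move=> Uo; pose W (N : nat) := [set x : pt R m | exists2 y, ~ U y & `|x - y| < N.+1%:R^-1].
have Wo N : open (W N).
  apply/openE_norm => x [y Uy xy]; exists (N.+1%:R^-1 - `|x - y|); first by rewrite subr_gt0.
  move=> z xz; exists y => //; apply: le_lt_trans (ler_distD x z y) _.
  by rewrite [`|z - x|]distrC -ltrBrDr.
rewrite (_ : mkset _ = \bigcup_N (Kspace R n `\` [set K | Kspace R n K /\ F K `&` W N !=set0])).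
  by apply: vborel_bigcup => N; apply: vborelC; exact: hitF.
apply/seteqP; split=> K.
  move=> [KK FU]; have [cF _] := FK KK.
  have [||l l0 lU] := @lebesgue_number _ _ (F K) (fun A => A `<=` U) cF.
  - by move=> A B AB; exact: subset_trans.
  - move=> x /FU Ux; have /openE_norm/(_ x Ux)[e e0 eU] := Uo.
    by exists e => // y; rewrite -ball_normE; exact: eU.
  exists (Num.truncn l^-1) => //; split=> // -[_ [x [Fx [y Uy xy]]]].
  apply: Uy; apply: (lU x Fx); rewrite -ball_normE /=; apply: lt_trans xy _.
  rewrite -[X in _ < X]invrK ltf_pV2 ?posrE ?invr_gt0//; exact: truncnS_gt.
move=> [N _ [KK h]]; split=> // x Fx; apply: contrapT => Ux; apply: h; split=> //.
by exists x; split=> //; exists x => //; rewrite subrr normr0 invr_gt0.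
Qed.

Let idx : countType := ('rV[rat]_m * nat)%type.
Let bs (i : idx) : set (pt R m) := ball (map_mx ratr i.1 : pt R m) (i.2.+1%:R^-1 : R).

Lemma rational_ball (U : set (pt R m)) x : open U -> U x ->
  exists i, bs i x /\ bs i `<=` U.
Proof.
move=> /openE_norm Uo /Uo[e e0 eU].
pose N := Num.truncn (2 / e).
have Ne : 2 * N.+1%:R^-1 < e.
  by rewrite ltr_pdivrMr ?ltr0n// [e * _]mulrC -ltr_pdivrMr//; exact: truncnS_gt.
have N0 : 0 < N.+1%:R^-1 :> R by rewrite invr_gt0.
have /choice[q qP] : forall j, exists q : rat, `|ratr q - x ord0 j| < N.+1%:R^-1.
  move=> j; have [|q] := @rat_in_itvoo R (x ord0 j - N.+1%:R^-1) (x ord0 j + N.+1%:R^-1).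
    by rewrite ltrBlDr -addrA ltrDl addr_gt0.
  rewrite in_itv/= => /andP[q1 q2]; exists q.
  by rewrite ltr_norml ltrBlDl q2 andbT ltrBrDl.
exists (\row_j q j, N); have dx : `|map_mx ratr (\row_j q j) - x : pt R m| < N.+1%:R^-1.
  by apply/row_norm_ltP => // j; rewrite !mxE.
split; first by rewrite /bs -ball_normE.
move=> y; rewrite /bs -ball_normE /= => dy; apply: eU; apply: lt_trans Ne.
apply: le_lt_trans (ler_distD (map_mx ratr (\row_j q j)) x y) _.
by rewrite mulr_natl mulr2n; apply: ltrD => //; rewrite distrC.
Qed.

Let unionb (s : seq idx) : set (pt R m) := [set x | exists2 i, i \in s & bs i x].

Let bs_open i : open (bs i).
Proof.
apply/openE_norm => x; rewrite /bs -ball_normE /= => cx.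
exists (i.2.+1%:R^-1 - `|(map_mx ratr i.1 : pt R m) - x|); first by rewrite subr_gt0.
move=> y xy; apply: le_lt_trans (ler_distD x _ _) _.
by rewrite addrC -ltrBrDr.
Qed.

Let unionb_open s : open (unionb s).
Proof.
apply/openE_norm => x [i si xi]; have /openE_norm/(_ x xi)[e e0 eP] := @bs_open i.
by exists e => // y xy; exists i => //; exact: eP.
Qed.

Let vborel_hits (s : seq idx) :
  vborel R n [set K | Kspace R n K /\ forall i, i \in s -> F K `&` bs i !=set0].
Proof.
elim: s => [|i s IH].
  rewrite (_ : mkset _ = Kspace R n); first exact: vborelT.
  by apply/seteqP; split=> K; [case|split].
rewrite (_ : mkset _ = [set K | Kspace R n K /\ F K `&` bs i !=set0] `&`
    [set K | Kspace R n K /\ forall i, i \in s -> F K `&` bs i !=set0]).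
  by apply: vborelI => //; [move=> K []|apply: hitF; exact: bs_open].
apply/seteqP; split=> K.
  move=> [KK h]; split; split=> //; first by apply: h; rewrite mem_head.
  by move=> j js; apply: h; rewrite inE js orbT.
by move=> [[KK h1] [_ h2]]; split=> // j; rewrite inE => /predU1P[->//|]; exact: h2.
Qed.

(** By compactness every Vietoris neighbourhood contains one given by two finite lists of rational
    balls. There are countably many such pairs, and being [good] does not depend on [K]. *)
Lemma vborel_preimage O : vopen R m O -> vborel R n (Kspace R n `&` F @^-1` O).
Proof.
move=> [OK Oo].
pose hits (s : seq idx) (L : set (pt R m)) := forall i, i \in s -> L `&` bs i !=set0.
pose good (c : seq idx * seq idx) := forall L, Kspace R m L -> L `<=` unionb c.1 ->
  hits c.2 L -> O L.
rewrite (_ : _ `&` _ = [set K | exists c : seq idx * seq idx, good c /\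
   ([set K | Kspace R n K /\ F K `<=` unionb c.1] `&`
    [set K | Kspace R n K /\ hits c.2 (F K)]) K]).
  apply: vborel_countable => c; apply: vborel_if; apply: vborelI.
  - by move=> K [].
  - exact: vborel_sub.
  - exact: vborel_hits.
apply/seteqP; split=> K; last first.
  by move=> [c [gc [[KK h1] [_ h2]]]]; split=> //; apply: gc => //; exact: FK.
move=> [KK /Oo [U [k [V [Uo Vo [FKK [FU FV]] VO]]]]].
have [cF _] := FKK; move: cF; rewrite compact_cover.
case/(_ idx [set i | bs i `<=` U] bs) => [i _|x /FU Ux|s sU Fs]; first exact: bs_open.
  by have [i [xi iU]] := rational_ball Uo Ux; exists i.
have /choice[v vP] : forall j, exists i, bs i `<=` V j /\ F K `&` bs i !=set0.
  move=> j; have [x [Fx Vx]] := FV j; have [i [xi iV]] := rational_ball (Vo j) Vx.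
  by exists i; split=> //; exists x.
exists (finmap.enum_fset s, [seq v j | j <- enum 'I_k]); split.
  move=> L LK Ls Lh; apply: VO; split=> //; split.
    by move=> x /Ls[i /sU/set_mem]; apply.
  move=> j; have [|x [Lx xv]] := Lh (v j); first by apply: map_f; rewrite mem_enum.
  by exists x; split=> //; exact: (vP j).1.
split; split=> //.
by move=> i /mapP[j _ ->]; exact: (vP j).2.
Qed.

Theorem borel_map_hit : borel_map R n m F.
Proof.
split=> // B; apply: (smallest_sub (X := [set B | vborel R n (Kspace R n `&` F @^-1` B)])).
  split=> [|A hA|A hA] /=.
  - by rewrite preimage_set0 setI0; exact: vborel0.
  - rewrite (_ : _ `&` _ = Kspace R n `\` (Kspace R n `&` F @^-1` A)); first exact: vborelC.
    apply/seteqP; split=> K; first by move=> [KK [_ nA]]; split=> // -[].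
    move=> [KK nA]; split=> //; split; first exact: FK.
    by move=> AK; apply: nA.
  - rewrite preimage_bigcup setI_bigcupr; exact: vborel_bigcup.
by move=> A; exact: vborel_preimage.
Qed.

End Reduction.
End VietorisBorel.

Section HomeomorphismRelation.
Variable R : realType.

Lemma homeomorphic_sym a b (A : set 'rV[R]_a) (B : set 'rV[R]_b) :
  homeomorphic R a b A B -> homeomorphic R b a B A.
Proof. by move=> [f [g [h1 h2 h3 h4 [h5 h6]]]]; exists g, f. Qed.

Lemma homeomorphic_trans a b c (A : set 'rV[R]_a) (B : set 'rV[R]_b) (C : set 'rV[R]_c) :
  homeomorphic R a b A B -> homeomorphic R b c B C -> homeomorphic R a c A C.
Proof.
have comp i j k (X : set 'rV[R]_i) (Y : set 'rV[R]_j) (f : 'rV[R]_i -> 'rV[R]_j)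
    (g : 'rV[R]_j -> 'rV[R]_k) : {within X, continuous f} -> {within Y, continuous g} ->
    (forall x, X x -> Y (f x)) -> {within X, continuous (g \o f)}.
  move=> /within_normP fc /within_normP gc fY; apply/within_normP => x Xx e e0.
  have [d d0 dP] := gc _ (fY x Xx) e e0; have [r r0 rP] := fc x Xx d d0.
  by exists r => // y Xy xy; apply: dP; [exact: fY|exact: rP].
move=> [f [g [fA gB gf fg [fc gc]]]] [f' [g' [fB gC gf' fg' [fc' gc']]]].
have fA' x : A x -> B (f x) by move=> ?; apply: fA; exists x.
have gB' x : B x -> A (g x) by move=> ?; apply: gB; exists x.
have fB' x : B x -> C (f' x) by move=> ?; apply: fB; exists x.
have gC' x : C x -> B (g' x) by move=> ?; apply: gC; exists x.
exists (f' \o f), (g \o g'); split.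
- by move=> _ [x Ax <-]; exact/fB'/fA'.
- by move=> _ [x Cx <-]; exact/gB'/gC'.
- by move=> x Ax /=; rewrite gf' ?gf//; exact: fA'.
- by move=> x Cx /=; rewrite fg ?fg'//; exact: gC'.
by split; [exact: comp fc fc' fA'|exact: comp gc' gc gC'].
Qed.

End HomeomorphismRelation.

(** * The reduction *)

Section MainReduction.
Variables (R : realType) (n : nat).
Notation V := ('rV[R]_n).
Notation W := ('rV[R]_n.+1).
Implicit Types (K L : set V) (x y z : V).

(** Squeezes the unit cube onto its middle third, so that satellites find room on every side. *)
Definition shrink x : V := 3^-1 *: (x + const_mx 1).
Definition unshrink y : V := 3 *: y - const_mx 1.

Lemma shrinkK : cancel shrink unshrink.
Proof. by move=> x; apply/rowP => i; rewrite !mxE; field. Qed.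

Lemma unshrinkK : cancel unshrink shrink.
Proof. by move=> x; apply/rowP => i; rewrite !mxE; field. Qed.

Lemma shrink_continuous : continuous shrink.
Proof.
apply/continuous_normP => x e e0; exists e => // y xy.
rewrite /shrink -scalerBr opprD addrACA subrr addr0 normrZ gtr0_norm ?invr_gt0//.
by apply: le_lt_trans xy; rewrite ler_piMl// invf_le1//; lra.
Qed.

Lemma unshrink_continuous : continuous unshrink.
Proof.
apply/continuous_normP => x e e0; exists (e / 3) => [|y xy]; first by rewrite divr_gt0.
rewrite /unshrink opprB addrA subrK -scalerBr normrZ gtr0_norm//.
by rewrite mulrC -ltr_pdivlMr.
Qed.

Lemma compact_shrink K : compact K -> compact (shrink @` K).
Proof.
move=> cK; apply: continuous_compact => //.
by apply: continuous_subspaceT; exact: shrink_continuous.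
Qed.

Lemma middle_shrink K : K `<=` cube R n -> middle (shrink @` K).
Proof.
by move=> KC _ [x /KC Cx <-] i; have := Cx i; rewrite !mxE; lra.
Qed.

Lemma homeomorphic_shrink K : homeomorphic R n n K (shrink @` K).
Proof.
exists shrink, unshrink; split=> //.
- by move=> _ [_ [x Kx <-] <-]; rewrite shrinkK.
- by move=> x _; rewrite shrinkK.
- by move=> x _; rewrite unshrinkK.
split; apply: continuous_subspaceT; [exact: shrink_continuous|exact: unshrink_continuous].
Qed.

Definition reduction K : set W := coneX (shrink @` K).

Lemma reduction_Kspace K : Kspace R n K -> Kspace R n.+1 (reduction K).
Proof.
move=> [cK KC]; split; first exact/compact_coneX/compact_shrink.
exact/coneX_cube/middle_shrink.
Qed.

(** For a fixed [z] the condition only asks [K] to miss one point and to hit one of countably many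
    open sets. *)
Lemma vborel_satellite z :
  vborel R n [set K | Kspace R n K /\ satellites (shrink @` K) z].
Proof.
pose near (m : nat) := [set x : pt R n | `|shrink x - z| < 5 / m.+1%:R].
rewrite (_ : mkset _ = [set K | Kspace R n K /\ ~ K (unshrink z)] `&`
   [set K | exists m : nat, grid m z /\ (Kspace R n K /\ K `&` near m !=set0)]).
  apply: vborelI; first by move=> K [].
    exact: vborel_miss.
  apply: vborel_countable => m; apply: vborel_if; apply: vborel_hit.
  apply/openE_norm => x xz.
  have /continuous_normP/(_ x (5 / m.+1%:R - `|shrink x - z|))[|d d0 dP] := shrink_continuous.
    by rewrite subr_gt0.
  exists d => // y /dP xy; apply: le_lt_trans (ler_distD (shrink x) _ _) _.
  by rewrite distrC -ltrBrDr.
apply/seteqP; split=> K.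
  move=> [KK [nz [m [gz [_ [[x Kx <-] xz]]]]]]; split.
    by split=> // Kz; apply: nz; exists (unshrink z); rewrite ?unshrinkK.
  by exists m; split=> //; split=> //; exists x.
move=> [[KK nz] [m [gz [_ [x [Kx xz]]]]]]; split=> //; split.
  by move=> [y Ky yz]; apply: nz; rewrite -yz shrinkK.
by exists m; split=> //; exists (shrink x); split=> //; exists x.
Qed.

Lemma vborel_reduction_hit (U : set W) : open U ->
  vborel R n [set K | Kspace R n K /\ reduction K `&` U !=set0].
Proof.
move=> Uo.
pose U1 := [set x : pt R n | U (emb 1 (shrink x))].
pose floor := exists y, cube R n y /\ U (emb 0 y).
pose ray z := exists u, 0 <= u <= 1 /\ U (emb u (u *: z)).
pose pnt (m : nat) (J : {ffun 'I_n -> 'I_m.+2}) : V := \row_i ((J i)%:R / m.+1%:R).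
rewrite (_ : mkset _ = [set K | Kspace R n K /\ K `&` U1 !=set0] `|`
  ([set K | exists m, exists J : {ffun 'I_n -> 'I_m.+2}, ray (pnt m J) /\
     (Kspace R n K /\ satellites (shrink @` K) (pnt m J))] `|`
   [set K | floor /\ Kspace R n K])).
  apply: vborelU; last apply: vborelU.
  - apply: vborel_hit; apply/openE_norm => x /= Ux.
    have /openE_norm/(_ _ Ux)[e e0 eU] := Uo.
    have /continuous_normP/(_ x e e0)[d d0 dP] := shrink_continuous.
    exists d => // y xy; apply: eU; rewrite embB subrr.
    by apply: norm_emb_lt; rewrite ?normr0//; exact: dP.
  - apply: vborel_countable => m; apply: vborel_countable => J.
    by apply: vborel_if; exact: vborel_satellite.
  - by apply: vborel_if; exact: vborelT.
apply/seteqP; split=> K.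
  move=> [KK [p [[[x [x' Kx <-] ->]|[u [z [u01 Zz ->]]]|[y Cy ->]] Up]]].
  - by left; split=> //; exists x'.
  - right; left; have [cK KC] := KK.
    (* As [U] is open, the ray over a boundary point can be traded for that of a nearby satellite;
       scaling by [u <= 1] does not increase the distance. *)
    have [z' Dz' rz'] : exists2 z', satellites (shrink @` K) z' & ray z'.
      case: Zz => [bz|Dz]; last by exists z => //; exists u.
      have /openE_norm/(_ _ Up)[e e0 eU] := Uo.
      have [d Dd zd] := satellites_limit
        (row_compact_closed (compact_shrink cK)) (middle_shrink KC) bz e0.
      exists d => //; exists u; split=> //; apply: eU; rewrite embB subrr -scalerBr.
      apply: norm_emb_lt; rewrite ?normr0// normrZ; apply: le_lt_trans zd.
      by have /andP[u0 u1] := u01; rewrite ler_piMl// ger0_norm.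
    have [_ [m [[J zJ] _]]] := Dz'; exists m, J; rewrite /pnt -zJ; split=> //.
  - by right; right; split=> //; exists y.
case=> [[KK [x [Kx Ux]]]|[[m [J [[u [u01 Uu]] [KK Dz]]]]|[[y [Cy Uy]] KK]]].
- split=> //; exists (emb 1 (shrink x)); split=> //; apply: Or31.
  by exists (shrink x) => //; exists x.
- split=> //; exists (emb u (u *: pnt m J)); split=> //; apply: Or32.
  by exists u, (pnt m J); split=> //; right.
- by split=> //; exists (emb 0 y); split=> //; apply: Or33; exists y.
Qed.

End MainReduction.
(** For [n = 0] the first reduction is impossible: the empty set and the point form two classes,
    whereas all zero-dimensional continua are single points. *)
Theorem theorem3p19 (R : realType) (n : nat) (hn : (0 < n)%N) :
  homeo_borel_reducible R n n.+1 (Kspace R n) (Cdim_space R n.+1 n) /\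
  homeo_borel_reducible R n n.+1 (Kspace R n) (Cspace R n.+1).
Proof.
have bm : borel_map R n n.+1 (@reduction R n).
  by apply: borel_map_hit; [exact: reduction_Kspace|exact: vborel_reduction_hit].
have inC K : Kspace R n K -> Cspace R n.+1 (@reduction R n K).
  move=> KK; have [cK KC] := KK; split; first exact: reduction_Kspace.
  split; last split.
  - by exists (emb 0 0); apply: Or33; exists 0 => // i; rewrite mxE lexx ler01.
  - exact/compact_coneX/compact_shrink.
  - apply: connected_coneX => //; [exact: compact_shrink|exact: middle_shrink].
have homeo K L : Kspace R n K -> Kspace R n L ->
    homeomorphic R n n K L <->
    homeomorphic R n.+1 n.+1 (@reduction R n K) (@reduction R n L).
  move=> [cK KC] [cL LC].
  have sK := homeomorphic_shrink K; have sL := homeomorphic_shrink L.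
  have [c1 c2] := (compact_shrink cK, compact_shrink cL).
  have [m1 m2] := (middle_shrink KC, middle_shrink LC).
  split=> h.
    apply: homeomorphic_coneX => //.
    exact: homeomorphic_trans (homeomorphic_sym sK) (homeomorphic_trans h sL).
  have := coneX_homeomorphic hn c1 c2 m1 m2 h => h'.
  exact: homeomorphic_trans sK (homeomorphic_trans h' (homeomorphic_sym sL)).
split; exists (@reduction R n); split=> // K KK; split; first exact: inC.
by apply: coneX_covdim => //; apply: compact_shrink; exact: KK.1.
Qed.
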